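(* Let $u\in\hat C$ and $\delta\ge 0$. Put $M=\delta^{-1/2}$ if $\delta>0$ and $M=\infty$ if $\delta=0$. Suppose that $u$ contains a conical part with vertex $(x_0,y_0,-z_0)$ and arc $\{(\cos\varphi,\sin\varphi,0):\varphi\in[\alpha,\beta]\}$, where $z_0>0$, $(x_0,y_0)=(r_0\cos\varphi_0,r_0\sin\varphi_0)$ with $0\le r_0<1$, and $\alpha<\beta$. If there exists $\varphi\in[\alpha,\beta]$ such that \[ \frac{3r_0^2\sin^2(\varphi-\varphi_0)-[1-r_0\cos(\varphi-\varphi_0)]^2}{[1-r_0\cos(\varphi-\varphi_0)]^2\,[1+r_0^2-2r_0\cos(\varphi-\varphi_0)]}<\delta z_0^{-2}, \] then $u$ is not optimal for $J_M$, i.e. $u$ is not a minimizer of $J_M$ over $\hat C$.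
   Context: Let $\Omega=\{(x,y)\in\mathbb{R}^2: x^2+y^2\le 1\}$. $\hat C$ denotes the set of all functions $u\colon\Omega\to[-1,0]$ that are convex and closed (i.e. lower semicontinuous). Each such $u$ is locally Lipschitz in $\operatorname{int}\Omega$, hence differentiable a.e. For $0<M<\infty$ and $u\in\hat C$, \[ J_M(u)=\int_\Omega\frac{1}{|\nabla u(x)|^2+M^{-2}}\,dx,\qquad J_\infty(u)=\int_\Omega\frac{1}{|\nabla u(x)|^2}\,dx\in[0,\infty], \] where the integrand of $J_\infty$ is taken to be $+\infty$ where $\nabla u=0$. Saying that $u$ contains a conical part with vertex $(x_0,y_0,-z_0)$ and arc $\{(\cos\varphi,\sin\varphi,0):\varphi\in[\alpha,\beta]\}\subset\partial\Omega\times\{0\}$ means that the conical surface formed by all segments joining the vertex to points of the arc lies in the graph of $u$: for all $\lambda\in[0,1]$ and $\varphi\in[\alpha,\beta]$, \[ u\bigl((1-\lambda)x_0+\lambda\cos\varphi,\;(1-\lambda)y_0+\lambda\sin\varphi\bigr)=-(1-\lambda)z_0 . \] *)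

(* Defs.v *)
From mathcomp Require Import all_boot all_order all_algebra.
From mathcomp Require Import all_classical all_reals all_analysis.

Set Implicit Arguments.
Unset Strict Implicit.
Unset Printing Implicit Defensive.

Import Order.TTheory GRing.Theory Num.Theory.
Import numFieldNormedType.Exports.
Local Open Scope classical_set_scope.
Local Open Scope ring_scope.

(* The library norm on R * R is the sup norm, so Euclidean norms are written
   out below as sums of squares. *)
Definition Omega (R : realType) : set (R * R) :=
  [set p | p.1 ^+ 2 + p.2 ^+ 2 <= 1].
Arguments Omega R : clear implicits.

(* A function on Omega is encoded as a total function on R * R; the values
   outside Omega are unconstrained. *)
Definition Chat (R : realType) : set (R * R -> R) :=
  [set u | [/\ forall p, Omega R p -> -1 <= u p <= 0,
               convex_function (Omega R) u &
               lower_semicontinuous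
                 ((fun p => (u p)%:E) : subspace (Omega R) -> \bar R)]].
Arguments Chat R : clear implicits.

(* |grad u|^2. Where a partial derivative does not exist, 'D_v has an
   unspecified value, and at boundary points of Omega it depends on the values
   of u outside Omega; for u in Chat this concerns a Lebesgue-null set only. *)
Definition grad_norm2 (R : realType) (u : R * R -> R) (p : R * R) : R :=
  ('D_(1, 0) u p) ^+ 2 + ('D_(0, 1) u p) ^+ 2.

(* The inverse is that of \bar R: +oo^-1 = 0 and 0^-1 = +oo. Hence for M = +oo
   the integrand is 1 / |grad u|^2, equal to +oo where grad u = 0. *)
Definition J (R : realType) (M : \bar R) (u : R * R -> R) : \bar R :=
  (\int[lebesgue_measure \x lebesgue_measure]_(p in Omega R)
     ((grad_norm2 u p)%:E + M^-1 ^+ 2)^-1)%E.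

Definition optimal (R : realType) (M : \bar R) (u : R * R -> R) : Prop :=
  Chat R u /\ forall v, Chat R v -> (J M u <= J M v)%E.

Definition conical_part (R : realType) (u : R * R -> R)
    (x0 y0 z0 alpha beta : R) : Prop :=
  forall lambda phi : R, 0 <= lambda <= 1 -> alpha <= phi <= beta ->
    u ((1 - lambda) * x0 + lambda * cos phi,
       (1 - lambda) * y0 + lambda * sin phi) = - ((1 - lambda) * z0).

(* Main.v *)
Require Import Defs.
From mathcomp Require Import all_boot all_order all_algebra.
From mathcomp Require Import all_classical all_reals all_analysis.
From mathcomp Require Import measurable_realfun.
From mathcomp Require Import ring lra.

Set Implicit Arguments.
Unset Strict Implicit.
Unset Printing Implicit Defensive.

Import Order.TTheory GRing.Theory Num.Theory.
Import numFieldNormedType.Exports.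
Local Open Scope classical_set_scope.
Local Open Scope ring_scope.

(** Let w(t) = (1 - x0 cos t - y0 sin t) / z0. The cone is tangent, along its
    ruling of angle t, to the plane p |-> (p . e_t - 1) / w(t), where
    e_t = (cos t, sin t); so 1 / w(t) is the slope of the cone there, and by
    convexity this plane supports the whole graph of u. Integrating over thin
    sectors, an arc of the cone contributes (z0 / 2) * int G(w(t)) dt to the
    functional, where G(w) = w^3 / (1 + delta w^2).

    The competitor lowers the graph over a short arc [m - e, m + e] inside the
    arc of the conical part. Let T be the point at height 0 above the meeting
    point of the two tangents to the unit circle at the ends of the arc. The
    supporting planes at the two ends both contain T and the vertex, hence the
    segment between them; the vertex is moved along that segment, by a fraction s
    of it, and over the fan spanned by the arc u is replaced by the maximum of
    finitely many supporting planes of the lowered cone. The two end planes are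
    unchanged, so the new function agrees with u on the two end rulings and stays
    convex ([glue_convex], [competitor_Chat]). In terms of w the move is
    w |-> w - s q / ((1 - s) z0) with q(t) = cos (t - m) / cos e - 1, which vanishes at
    both ends and satisfies q + q'' = -1.

    To first order in s the functional changes by half of
      s z0 * int q (G - w G' + w'^2 G'') dt
    (the boundary terms left by the integration by parts are exactly the cost of
    the two thin triangles between the old and the new end rulings), and
      G - w G' + w'^2 G'' =
        2 w / (1 + delta w^2)^3 * (3 w'^2 - w^2 - delta w^2 (w^2 + w'^2)),
    which is negative at some angle precisely by the hypothesis, hence on a small
    arc around it. So the competitor is strictly better when s is small.

    Polar integration along the cone is avoided: the fan is cut into thin sectors,
    and the comparison is made sector by sector ([piece]). Each sector of the cone
    contains a triangle of known area on which the integrand is bounded below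
    ([cone_lower_bound]); the lowered fan is covered, up to a null set, by wedges of
    known area on which the integrand is constant ([competitor_upper_bound]). The
    sectors come from a compactness argument ([cousin_chain]): the comparison
    holds for all short intervals around a given angle, because there it is a strict
    inequality between derivatives ([local_piece]); the strict total gain is
    carried by an increment of an auxiliary primitive K ([fan_exists]).

    The integrand of a general u is handled through the integral of nonnegative
    functions as a supremum over simple functions, which is additive over
    measurable pieces of the domain ([ge0_integral_split]). Subtracting the common
    part of the two functionals requires the value at u to be finite; an optimal u
    has a finite value, since an affine function does ([tilt_cost]). *)

(** * Integrals of nonnegative functions over arbitrary sets *)

Section nonneg_integral.
Context d (T : measurableType d) (R : realType).
Variable mu : {measure set T -> \bar R}.
Local Open Scope ereal_scope.
Import HBNNSimple.

(** The integral of a nonnegative function is a supremum over the simple functions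
    below it, and there are more of these below g than below f. *)
Lemma ge0_integral_mono (D : set T) (f g : T -> \bar R) :
  (forall x, D x -> 0 <= f x) -> (forall x, D x -> f x <= g x) ->
  \int[mu]_(x in D) f x <= \int[mu]_(x in D) g x.
Proof.
move=> f0 fg; have g0 x : D x -> 0 <= g x.
  by move=> Dx; exact: le_trans (f0 _ Dx) (fg _ Dx).
rewrite !ge0_integralE//; apply: ereal_sup_le => /= _ [h hf <-].
exists h => // x; apply: le_trans (hf x) _.
by rewrite !patchE; case: ifPn => // /set_mem; exact: fg.
Qed.

Lemma ge0_integral_subset (A B : set T) (f : T -> \bar R) :
  A `<=` B -> (forall x, B x -> 0 <= f x) ->
  \int[mu]_(x in A) f x <= \int[mu]_(x in B) f x.
Proof.
move=> AB f0; rewrite !ge0_integralE//; last by move=> x /AB; exact: f0.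
apply: ereal_sup_le => /= _ [h hf <-].
exists h => // x; apply: le_trans (hf x) _.
rewrite !patchE; case: ifPn => [/set_mem/AB/mem_set -> //|_].
by case: ifPn => // /set_mem; exact: f0.
Qed.

(** Restricting a simple function to A and to its complement keeps it simple, which
    gives one inequality; the sum of a simple function supported in A and one
    supported outside A is again below f, which gives the other. Here f may be the
    integrand of an arbitrary convex function. *)
Lemma ge0_integral_split (D A : set T) (f : T -> \bar R) : measurable A ->
  (forall x, D x -> 0 <= f x) ->
  \int[mu]_(x in D) f x =
  \int[mu]_(x in D `&` A) f x + \int[mu]_(x in D `\` A) f x.
Proof.
move=> mA f0; have f0' (B : set T) x : (D `&` B) x -> 0 <= f x.
  by move=> [Dx _]; exact: f0.
rewrite setDE.
have mAC : measurable (~` A) by exact: measurableC.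
apply/eqP; rewrite eq_le; apply/andP; split.
  rewrite [leLHS]ge0_integralE//; apply: ge_ereal_sup => _ [h /= hf <-].
  have hP (B : set T) (mB : measurable B) :
      sintegral mu (proj_nnsfun h mB) <= \int[mu]_(x in D `&` B) f x.
    rewrite ge0_integralE; last exact: f0'.
    apply: ereal_sup_ubound; exists (proj_nnsfun h mB) => //= x.
    rewrite patchE in_setI; have := hf x; rewrite patchE /= /measurable_realfun.mindic indicE.
    case: (x \in D) => /=; case: (x \in B) => /=;
      rewrite ?mulr1 ?mulr0 //.
  apply: le_trans (leeD (hP _ mA) (hP _ mAC)).
  rewrite -sintegralD; apply: le_sintegral => x /=.
  rewrite /measurable_realfun.mindic !indicE in_setC; case: (x \in A) => /=;
    by rewrite ?mulr1 ?mulr0 ?addr0 ?add0r.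
have H (B : set T) : \int[mu]_(x in D `&` B) f x =
    ereal_sup [set sintegral mu h |
      h in [set h : {nnsfun T >-> R} | forall x, (h x)%:E <= (f \_ (D `&` B)) x]].
  by rewrite ge0_integralE//; exact: f0'.
rewrite [X in X + _]H.
have I0 : 0 <= \int[mu]_(x in D `&` ~` A) f x.
  by apply: integral_ge0; exact: f0'.
have [Ioo|Ioo] := eqVneq (\int[mu]_(x in D `&` ~` A) f x) +oo.
  rewrite Ioo; apply: le_trans (leey _) _; rewrite -Ioo.
  by apply: ge0_integral_subset => // x [].
have Ifin : \int[mu]_(x in D `&` ~` A) f x \is a fin_num.
  by rewrite ge0_fin_numE// lt_neqAle Ioo leey.
rewrite -leeBrDr//; apply: ge_ereal_sup => _ [h /= hf <-].
rewrite leeBrDr// addeC.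
have [s0|soo] := eqVneq (sintegral mu h) +oo.
  rewrite s0; apply: le_trans (leey _) _; rewrite -s0.
  rewrite [leRHS]ge0_integralE//; apply: ereal_sup_ubound; exists h => //= x.
  have := hf x; rewrite !patchE in_setI.
  case: ifPn; first by move=> /andP[->].
  by move=> _ /le_trans; apply; case: ifPn => // /set_mem; exact: f0.
have sfin : sintegral mu h \is a fin_num.
  by rewrite ge0_fin_numE ?sintegral_ge0// lt_neqAle soo leey.
rewrite -leeBrDr// H; apply: ge_ereal_sup => _ [k /= kf <-].
rewrite leeBrDr// -sintegralD [leRHS]ge0_integralE//.
apply: ereal_sup_ubound; exists (add_nnsfun k h) => //= x.
have := hf x; have := kf x; rewrite !patchE !in_setI in_setC.
have k0 : (0 <= k x)%R by []. have h0 : (0 <= h x)%R by [].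
case: (x \in D) => /=; case: (x \in A) => /=; rewrite ?lee_fin => k1 h1.
- have -> : k x = 0%R by apply/le_anti; rewrite k1 k0.
  by rewrite add0r.
- have -> : h x = 0%R by apply/le_anti; rewrite h1 h0.
  by rewrite addr0.
- by rewrite -[leRHS]addr0 lerD.
- by rewrite -[leRHS]addr0 lerD.
Qed.

Lemma ge0_integral_null_set (D N : set T) (f : T -> \bar R) : measurable N ->
  mu N = 0 -> D `<=` N -> (forall x, D x -> 0 <= f x) ->
  \int[mu]_(x in D) f x = 0.
Proof.
move=> mN N0 DN f0; apply/eqP; rewrite eq_le integral_ge0// andbT.
apply: (@le_trans _ _ (\int[mu]_(x in D) +oo)).
  by apply: ge0_integral_mono => // x _; exact: leey.
apply: (@le_trans _ _ (\int[mu]_(x in N) +oo)).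
  by apply: ge0_integral_subset.
by rewrite integral_cst// N0 mule0.
Qed.

(** Induction on the cover: split off the first cell, on which f is bounded by a
    constant, and continue on what remains of D. Cells may overlap. *)
Lemma integral_le_cover (D N : set T) (f : T -> \bar R)
    (s : seq (set T * R)) : measurable N -> mu N = 0 ->
  (forall x, D x -> 0 <= f x) ->
  (forall c, c \in s -> [/\ measurable c.1, (0 <= c.2)%R &
     forall x, D x -> c.1 x -> ~ N x -> f x <= c.2%:E]) ->
  (forall x, D x -> N x \/ exists2 c, c \in s & c.1 x) ->
  \int[mu]_(x in D) f x <= \sum_(c <- s) c.2%:E * mu c.1.
Proof.
move=> mN N0; elim: s D => [|[A c] s IH] D f0 Hs Dcov.
  rewrite big_nil; rewrite (@ge0_integral_null_set _ N)// => x /Dcov[//|[]//].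
rewrite big_cons /= (@ge0_integral_split D N)//.
rewrite (@ge0_integral_null_set (D `&` N) N)//; last by move=> x [] /f0.
rewrite add0e.
have [mA c0 fc] := Hs _ (mem_head _ _); rewrite /= in mA c0 fc.
rewrite (@ge0_integral_split _ A)//; last by move=> x [] /f0.
apply: leeD.
  rewrite -integral_cst//.
  apply: (@le_trans _ _ (\int[mu]_(x in (D `\` N) `&` A) (cst c%:E x))).
    by apply: ge0_integral_mono => x [[Dx Nx] Ax]; [exact: f0|exact: fc].
  apply: ge0_integral_subset; first by move=> x [].
  by move=> x _; rewrite lee_fin.
apply: IH.
- by move=> x [[/f0]].
- move=> e es; have [me e0 fe] := Hs e (mem_behead (s := (A, c) :: s) es).
  by split => // x [[Dx _] _]; exact: fe.
- move=> x [[Dx Nx] Ax]; case: (Dcov x Dx) => [//|[e]].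
  by rewrite inE => /orP[/eqP -> /= //|es ex]; right; exists e.
Qed.

Lemma cst_le_integral (D : set T) (f : T -> \bar R) (c : R) : measurable D ->
  (0 <= c)%R -> (forall x, D x -> c%:E <= f x) ->
  c%:E * mu D <= \int[mu]_(x in D) f x.
Proof.
by move=> mD c0 cf; rewrite -integral_cst//; apply: ge0_integral_mono.
Qed.

End nonneg_integral.

(** * Planar Lebesgue measure of triangles *)

Section affine_measure.
Context (R : realType).
Local Notation mu1 := (@lebesgue_measure R).
Local Notation mu2 := (mu1 \x mu1)%E.

(** Lebesgue measure is determined by its values on intervals, where the formula is
    immediate. *)
Lemma lebesgue_measure_affine (d e : R) (A : set (measurableTypeR R)) : d != 0 ->
  measurable A ->
  mu1 ((fun y => d * y + e) @^-1` A) = ((`|d|^-1)%:E * mu1 A)%E.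
Proof.
move=> d0 mA.
pose f : measurableTypeR R -> measurableTypeR R := fun y => d * y + e.
have mf : measurable_fun setT f.
  by apply: measurable_funD => //; exact: measurable_funM.
have nd0 : 0 < `|d| by rewrite normr_gt0.
pose r : {nonneg R} := NngNum (ltW nd0).
have H := @lebesgue_measure_unique R (mscale r (pushforward mu1 f)).
have -> : mu1 ((fun y => d * y + e) @^-1` A) = pushforward mu1 f A by [].
have K : forall X, ocitv X -> mu1 X = mscale r (pushforward mu1 f) X.
  move=> ? X [[a b]] _ <-; rewrite /mscale /= /pushforward.
  have [d1|d1] := ltP 0 d.
    have -> : f @^-1` `]a, b] = `](a - e) / d, (b - e) / d]%classic.
      by apply/seteqP; split => y /=; rewrite !in_itv /= /f
        ltr_pdivrMr// ler_pdivlMr// ltrBlDr lerBrDr [y * d]mulrC.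
    rewrite !lebesgue_measure_itv /= !lte_fin ltr_pM2r ?invr_gt0// ltrD2r.
    case: ifP => _; rewrite ?mule0// -!EFinB -EFinM; congr EFin.
    by rewrite gtr0_norm//; field.
  have {}d1 : d < 0 by rewrite lt_neqAle d0.
  have -> : f @^-1` `]a, b] = `[(b - e) / d, (a - e) / d[%classic.
    by apply/seteqP; split => y /=; rewrite !in_itv /= /f
      ler_ndivrMr// ltr_ndivlMr// lerBrDr ltrBlDr [y * d]mulrC andbC.
  rewrite !lebesgue_measure_itv /= !lte_fin ltr_nM2r ?invr_lt0// ltrD2r.
  case: ifP => _; rewrite ?mule0// -!EFinB -EFinM; congr EFin.
  by rewrite ltr0_norm//; field.
rewrite (H mf (K mf) A mA) /mscale /= muleA -EFinM mulVf ?mul1e//.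
by rewrite normr_eq0.
Qed.

Lemma measurable_affine (a b c : R) :
  measurable_fun [set: R * R] (fun p : R * R => a * p.1 + b * p.2 + c).
Proof.
apply: measurable_funD => //; apply: measurable_funD;
  apply: measurable_funM => //.
Qed.

Lemma mu2_swapE (A : set (R * R)) : measurable A ->
  mu2 A = (mu1 \x^ mu1)%E A.
Proof.
move=> mA; apply: product_measure_unique => // B C mB mC.
exact: product_measure2E.
Qed.

Lemma measurable_preimageT d d' (T : measurableType d) (T' : measurableType d')
  (f : T -> T') (A : set T') : measurable_fun setT f -> measurable A ->
  measurable (f @^-1` A).
Proof. by move=> mf mA; rewrite -[X in measurable X]setTI; exact: mf. Qed.

(** On each vertical section the map is affine with slope d. *)
Lemma mu2_scale_snd (c d e : R) (A : set (R * R)) : d != 0 -> measurable A ->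
  mu2 ((fun p => (p.1, c * p.1 + d * p.2 + e)) @^-1` A) =
    ((`|d|^-1)%:E * mu2 A)%E.
Proof.
move=> d0 mA; rewrite /product_measure1.
rewrite -ge0_integralZl//; last first.
  exact: measurable_fun_xsection.
apply: eq_integral => x _ /=.
rewrite -(@lebesgue_measure_affine d (c * x + e))//; last exact: measurable_xsection.
congr (mu1 _); apply/seteqP; split => y; rewrite /xsection/= !inE /=;
by rewrite addrA [d * y + _]addrC.
Qed.

Lemma mu2_scale_fst (c d e : R) (A : set (R * R)) : d != 0 -> measurable A ->
  mu2 ((fun p => (d * p.1 + c * p.2 + e, p.2)) @^-1` A) =
    ((`|d|^-1)%:E * mu2 A)%E.
Proof.
move=> d0 mA; rewrite !mu2_swapE//; last first.
  apply: measurable_preimageT => //.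
  apply/measurable_fun_pairP; split; first exact: measurable_affine.
  exact: measurable_snd.
rewrite /product_measure2 -ge0_integralZl//; last first.
  exact: measurable_fun_ysection.
apply: eq_integral => x _ /=.
rewrite -(@lebesgue_measure_affine d (c * x + e))//; last exact: measurable_ysection.
congr (mu1 _); apply/seteqP; split => y; rewrite /ysection/= !inE /=;
by rewrite addrA.
Qed.

Let swap_pair (p : R * R) : R * R := (p.2, p.1).

Let measurable_swap_pair : measurable_fun [set: R * R] swap_pair.
Proof.
by apply/measurable_fun_pairP; split; [exact: measurable_snd|exact: measurable_fst].
Qed.

Lemma mu2_swap (A : set (R * R)) : measurable A ->
  mu2 (swap_pair @^-1` A) = mu2 A.
Proof.
move=> mA; by rewrite [RHS]mu2_swapE.
Qed.

(** An invertible affine map is a composition of the two one-coordinate maps above,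
    up to a swap of the coordinates. *)
Lemma mu2_affine (x1 x2 x3 y1 y2 y3 : R) (A : set (R * R)) :
  x1 * y2 - x2 * y1 != 0 -> measurable A ->
  mu2 ((fun p => (x1 * p.1 + x2 * p.2 + x3, y1 * p.1 + y2 * p.2 + y3)) @^-1` A)
   = ((`|x1 * y2 - x2 * y1|^-1)%:E * mu2 A)%E.
Proof.
move=> D0 mA.
wlog x10 : x1 x2 x3 y1 y2 y3 A D0 mA / x1 != 0.
  move=> H; have [x10|/H] := eqVneq x1 0; last exact.
  (* when x1 vanishes, swap the two coordinates of the target *)
  have y10 : y1 != 0.
    by apply: contraNneq D0 => ->; rewrite x10 mul0r mulr0 subr0.
  have mB : measurable (swap_pair @^-1` A).
    by apply: measurable_preimageT => //; exact: measurable_swap_pair.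
  have D0' : y1 * x2 - y2 * x1 != 0 by rewrite -oppr_eq0 opprB [y2 * _]mulrC [y1 * _]mulrC.
  have := H y1 y2 y3 x1 x2 x3 _ D0' mB y10.
  rewrite mu2_swap// => E.
  have -> : `|x1 * y2 - x2 * y1| = `|y1 * x2 - y2 * x1|.
    by rewrite -normrN opprB [y2 * _]mulrC [y1 * _]mulrC.
  exact: E.
(* eliminate the first coordinate from the second *)
pose B := (fun q : R * R => (q.1, (y1 / x1) * q.1 + ((x1 * y2 - x2 * y1) / x1) * q.2
                             + (y3 - y1 * x3 / x1))) @^-1` A.
have mB : measurable B.
  apply: measurable_preimageT mA.
  apply/measurable_fun_pairP; split; first exact: measurable_fst.
  exact: measurable_affine.
have -> : (fun p => (x1 * p.1 + x2 * p.2 + x3, y1 * p.1 + y2 * p.2 + y3)) @^-1` A =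
  (fun p => (x1 * p.1 + x2 * p.2 + x3, p.2)) @^-1` B.
  apply/seteqP; split => p; rewrite /B /preimage /= => Ap.
    have -> : y1 / x1 * (x1 * p.1 + x2 * p.2 + x3) + (x1 * y2 - x2 * y1) / x1 * p.2 +
      (y3 - y1 * x3 / x1) = y1 * p.1 + y2 * p.2 + y3 by field.
    exact: Ap.
  have <- : y1 / x1 * (x1 * p.1 + x2 * p.2 + x3) + (x1 * y2 - x2 * y1) / x1 * p.2 +
      (y3 - y1 * x3 / x1) = y1 * p.1 + y2 * p.2 + y3 by field.
  exact: Ap.
rewrite mu2_scale_fst// mu2_scale_snd//; last by rewrite mulf_neq0// invr_eq0.
rewrite muleA -EFinM; congr (_%:E * _)%E.
by rewrite -invfM -normrM; congr (`|_|^-1); field.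
Qed.

Lemma null_line (a b c : R) : (a != 0) || (b != 0) ->
  mu2 [set p : R * R | a * p.1 + b * p.2 = c] = 0%E.
Proof.
move=> ab.
have [b0|b0] := eqVneq b 0.
  move: ab; rewrite b0 eqxx orbF => a0.
  have -> : [set p : R * R | a * p.1 + 0 * p.2 = c] = [set (c / a)] `*` setT.
    apply/seteqP; split => -[x y] /=; rewrite mul0r addr0.
      by move=> <-; split => //; field.
    by move=> [-> _]; field.
  rewrite product_measure1E//.
  rewrite [X in (X * _)%E](_ : _ = 0%E) ?mul0e//; exact: lebesgue_measure_set1.
have -> : [set p : R * R | a * p.1 + b * p.2 = c] =
    (fun p => (p.1, a * p.1 + b * p.2 + - c)) @^-1` (setT `*` [set 0]).
  apply/seteqP; split => -[x y] /=.
    by move=> ->; rewrite subrr.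
  by move=> [_ /eqP]; rewrite subr_eq0 => /eqP.
rewrite mu2_scale_snd//; last exact: measurableX.
rewrite product_measure1E//.
rewrite [X in (_ * (_ * X))%E](_ : _ = 0%E) ?mule0 ?mule0//; exact: lebesgue_measure_set1.
Qed.

Definition std_triangle : set (R * R) := [set p | [/\ 0 <= p.1, 0 <= p.2 & p.1 + p.2 <= 1]].

Lemma measurable_affine_ge0 (a b c : R) :
  measurable [set p : R * R | 0 <= a * p.1 + b * p.2 + c].
Proof.
have -> : [set p : R * R | 0 <= a * p.1 + b * p.2 + c] =
  (fun p => a * p.1 + b * p.2 + c) @^-1` `[0, +oo[.
  by apply/seteqP; split => p /=; rewrite in_itv /= andbT.
apply: measurable_preimageT => //; exact: measurable_affine.
Qed.

Lemma measurable_std_triangle : measurable std_triangle.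
Proof.
have -> : std_triangle = [set p : R * R | 0 <= 1 * p.1 + 0 * p.2 + 0] `&`
   ([set p : R * R | 0 <= 0 * p.1 + 1 * p.2 + 0] `&`
   [set p : R * R | 0 <= -1 * p.1 + -1 * p.2 + 1]).
  apply/seteqP; split => -[x y]; rewrite /std_triangle /=.
    by move=> [? ? ?]; split; [lra|split; lra].
  by move=> [? [? ?]]; split; lra.
by do 2 (apply: measurableI; first exact: measurable_affine_ge0);
  exact: measurable_affine_ge0.
Qed.

Lemma mu2_std_triangle : mu2 std_triangle = (2^-1)%:E.
Proof.
rewrite /product_measure1.
pose f (x : R) : R := 1 - x.
transitivity (\int[mu1]_(x in `[0%R, 1%R]) (f x)%:E)%E.
  rewrite [RHS]integral_mkcond; apply: eq_integral => x _ /=.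
  rewrite patchE; case: ifPn => [|].
    rewrite inE /= in_itv /= => /andP[x0 x1].
    have -> : xsection std_triangle x = `[0, 1 - x]%classic.
      apply/seteqP; split => y; rewrite /xsection /std_triangle /= inE /= in_itv /=.
        by move=> [_ -> /=]; lra.
      by move=> /andP[-> ?]; split => //; lra.
    rewrite lebesgue_measure_itv /= lte_fin subr_gt0.
    have [_|x1'] := ltP x 1; first by rewrite -EFinB subr0.
    by rewrite /f; congr EFin; lra.
  rewrite notin_setE /= in_itv /= => /negP; rewrite negb_and -!ltNge => xN.
  have -> : xsection std_triangle x = set0.
    apply/seteqP; split => y //; rewrite /xsection /std_triangle /= inE /=.
    by move=> [? ? ?]; case/orP: xN; lra.
  by rewrite measure0.
pose F (x : R) : R := x - x ^+ 2 / 2.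
have dF (x : R) : is_derive x (1 : R) F (f x).
  by apply: is_derive_eq; rewrite /f /GRing.scale /=; field.
have dcont (x : R) : {for x, continuous F}.
  by apply: differentiable_continuous; apply/derivable1_diffP; exact: ex_derive.
rewrite (@continuous_FTC2 _ f F) //.
- by rewrite -EFinB; congr EFin; rewrite /F expr0n /= expr1n; field.
- apply: continuous_subspaceT => x; apply: cvgB; [exact: cvg_cst|exact: cvg_id].
- split.
  + by move=> x _; exact: ex_derive.
  + exact/cvg_at_right_filter/dcont.
  + exact/cvg_at_left_filter/dcont.
- by move=> x _; rewrite derive1E derive_val.
Qed.

Lemma mu2_triangle (x1 x2 x3 y1 y2 y3 : R) :
  x1 * y2 - x2 * y1 != 0 ->
  let X p := x1 * p.1 + x2 * p.2 + x3 in
  let Y p := y1 * p.1 + y2 * p.2 + y3 in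
  mu2 [set p : R * R | [/\ 0 <= X p, 0 <= Y p & X p + Y p <= 1]] =
  ((2 * `|x1 * y2 - x2 * y1|)^-1)%:E.
Proof.
move=> D0 X Y.
have := mu2_affine x3 y3 D0 measurable_std_triangle.
by rewrite mu2_std_triangle -EFinM -invfM mulrC; exact.
Qed.

Definition open_std_triangle : set (R * R) :=
  [set p | [/\ 0 < p.1, 0 < p.2 & p.1 + p.2 < 1]].

Lemma measurable_affine_gt0 (a b c : R) :
  measurable [set p : R * R | 0 < a * p.1 + b * p.2 + c].
Proof.
have -> : [set p : R * R | 0 < a * p.1 + b * p.2 + c] =
  (fun p => a * p.1 + b * p.2 + c) @^-1` `]0, +oo[.
  by apply/seteqP; split => p /=; rewrite in_itv /= andbT.
apply: measurable_preimageT => //; exact: measurable_affine.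
Qed.

Lemma measurable_affine_eq (a b c : R) :
  measurable [set p : R * R | a * p.1 + b * p.2 = c].
Proof.
have -> : [set p : R * R | a * p.1 + b * p.2 = c] =
  (fun p => a * p.1 + b * p.2 + - c) @^-1` [set 0].
  apply/seteqP; split => p /=; first by move=> ->; rewrite subrr.
  by move/eqP; rewrite subr_eq0 => /eqP.
apply: measurable_preimageT => //; exact: measurable_affine.
Qed.

Lemma measurable_open_std_triangle : measurable open_std_triangle.
Proof.
have -> : open_std_triangle = [set p : R * R | 0 < 1 * p.1 + 0 * p.2 + 0] `&`
   ([set p : R * R | 0 < 0 * p.1 + 1 * p.2 + 0] `&`
   [set p : R * R | 0 < -1 * p.1 + -1 * p.2 + 1]).
  apply/seteqP; split => -[x y]; rewrite /open_std_triangle /=.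
    by move=> [/= ? ? ?]; split; [lra|split; lra].
  by move=> [? [? ?]]; split=> /=; lra.
by do 2 (apply: measurableI; first exact: measurable_affine_gt0);
  exact: measurable_affine_gt0.
Qed.

Lemma mu2_U0 (A B : set (R * R)) : measurable A -> measurable B ->
  mu2 B = 0%E -> mu2 (A `|` B) = mu2 A.
Proof. exact: (@measureU0 _ (measurableTypeR R * measurableTypeR R)%type R mu2). Qed.

Lemma mu2_le (A B : set (R * R)) : measurable A -> measurable B ->
  A `<=` B -> (mu2 A <= mu2 B)%E.
Proof.
move=> mA mB.
have H := @le_measure _ R (measurableTypeR R * measurableTypeR R)%type mu2.
by move=> AB; apply: (H A B _ _ AB); rewrite inE.
Qed.

(** The closed triangle differs from the open one by three segments. *)
Lemma mu2_open_std_triangle : mu2 open_std_triangle = (2^-1)%:E.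
Proof.
have mO := measurable_open_std_triangle.
have mL a b c := measurable_affine_eq a b c.
have nL a b c ab := @null_line a b c ab.
have n1 := oner_neq0 R.
rewrite -mu2_std_triangle; apply/eqP; rewrite eq_le; apply/andP; split.
  apply: mu2_le => //; first exact: measurable_std_triangle.
  by move=> [x y] [/= ? ? ?]; split => /=; exact: ltW.
have e1 : mu2 [set p : R * R | 1 * p.1 + 0 * p.2 = 0] = 0%E.
  by apply: nL; rewrite n1.
have e2 : mu2 [set p : R * R | 0 * p.1 + 1 * p.2 = 0] = 0%E.
  by apply: nL; rewrite n1 orbT.
have e3 : mu2 [set p : R * R | 1 * p.1 + 1 * p.2 = 1] = 0%E.
  by apply: nL; rewrite n1.
have mO1 := measurableU _ _ mO (mL 1 0 0).
have mO2 := measurableU _ _ mO1 (mL 0 1 0).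
rewrite -(mu2_U0 mO (mL 1 0 0) e1) -(mu2_U0 mO1 (mL 0 1 0) e2).
rewrite -(mu2_U0 mO2 (mL 1 1 1) e3).
apply: mu2_le => //; [exact: measurable_std_triangle|exact: measurableU|].
move=> [x y] [/= x0 y0 xy1].
move: x0; rewrite le_eqVlt => /orP[/eqP x0|x0].
  by left; left; right; rewrite /=; lra.
move: y0; rewrite le_eqVlt => /orP[/eqP y0|y0].
  by left; right; rewrite /=; lra.
move: xy1; rewrite le_eqVlt => /orP[/eqP xy1|xy1].
  by right; rewrite /=; lra.
by left; left; left.
Qed.

Lemma mu2_open_triangle (x1 x2 x3 y1 y2 y3 : R) :
  x1 * y2 - x2 * y1 != 0 ->
  let X p := x1 * p.1 + x2 * p.2 + x3 in
  let Y p := y1 * p.1 + y2 * p.2 + y3 in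
  measurable [set p : R * R | [/\ 0 < X p, 0 < Y p & X p + Y p < 1]] /\
  mu2 [set p : R * R | [/\ 0 < X p, 0 < Y p & X p + Y p < 1]] =
  ((2 * `|x1 * y2 - x2 * y1|)^-1)%:E.
Proof.
move=> D0 X Y; split.
  apply: (@measurable_preimageT _ _ _ _ (fun p : R * R => (X p, Y p)) open_std_triangle).
    by apply/measurable_fun_pairP; split; exact: measurable_affine.
  exact: measurable_open_std_triangle.
have := mu2_affine x3 y3 D0 measurable_open_std_triangle.
by rewrite mu2_open_std_triangle -EFinM -invfM mulrC; exact.
Qed.

(** Each vertical line meets the circle in at most two points. *)
Lemma measurable_null_circle : measurable [set p : R * R | p.1 ^+ 2 + p.2 ^+ 2 = 1] /\
  mu2 [set p : R * R | p.1 ^+ 2 + p.2 ^+ 2 = 1] = 0%E.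
Proof.
have mC : measurable [set p : R * R | p.1 ^+ 2 + p.2 ^+ 2 = 1].
  apply: (@measurable_preimageT _ _ _ _ (fun p : R * R => p.1 ^+ 2 + p.2 ^+ 2) [set 1]) => //.
  by apply: measurable_funD; apply: measurable_funX;
    [exact: measurable_fst|exact: measurable_snd].
split=> //; rewrite /product_measure1; apply: integral0_eq => x _ /=.
have m0 (z : R) : mu1 [set z] = 0%E by exact: lebesgue_measure_set1.
have mS z : measurable [set z : measurableTypeR R] by exact: measurable_set1.
set s := Num.sqrt (1 - x ^+ 2).
have sub : xsection [set p : R * R | p.1 ^+ 2 + p.2 ^+ 2 = 1] x `<=` [set s] `|` [set - s].
  move=> y /=; rewrite -/(y \in _) => /set_mem /=; rewrite /mkset /= => xy.
  have : (y - s) * (y + s) = 0.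
    by rewrite -subr_sqr sqr_sqrtr -xy; [ring|rewrite addrAC subrr add0r sqr_ge0].
  by move=> /eqP; rewrite mulf_eq0 subr_eq0 addr_eq0 => /orP[]/eqP; [left|right].
apply/eqP; rewrite eq_le measure_ge0 andbT.
apply: (@le_trans _ _ (mu1 ([set s] `|` [set - s]))).
  apply: le_measure => //; rewrite inE; first exact: measurable_xsection.
  exact: measurableU.
have := measureU0 (mu := mu1) (mS s) (mS (- s)) (m0 _).
by move=> E; rewrite le_eqVlt; apply/orP; left; apply/eqP; exact: (etrans E (m0 s)).
Qed.

End affine_measure.

(** * Fine partitions of an interval *)

Section cousin.
Context (R : realType).

Fixpoint chain (P : R -> R -> Prop) (x : R) (s : seq R) : Prop :=
  if s is y :: s' then [/\ x < y, P x y & chain P y s'] else True.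

Lemma chain_rcons P x s y : chain P x s -> last x s < y -> P (last x s) y ->
  chain P x (rcons s y).
Proof.
elim: s x => [|z s IH] x /=; first by move=> _ xy Pxy; split.
by move=> [xz Pxz c] lt Pl; split => //; exact: IH.
Qed.

(** Cousin's argument: the supremum c of the points reachable from a by a chain is
    itself reachable and cannot be smaller than b, because every short interval
    around c is allowed as a link. *)
Lemma cousin_chain (P : R -> R -> Prop) (a b : R) : a <= b ->
  (forall c, a <= c <= b -> exists2 d, 0 < d & forall x y,
     a <= x <= c -> c <= y <= b -> x < y -> y - x < d -> P x y) ->
  exists2 s, chain P a s & last a s = b.
Proof.
move=> ab H.
pose S := [set x | x <= b /\ exists2 s, chain P a s & last a s = x].
have Sa : S a by split => //; exists [::].
have Sub : ubound S b by move=> x [].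
have hS : has_sup S by split; [exists a|exists b].
pose c := sup S.
have ac : a <= c by exact: sup_upper_bound.
have cb : c <= b by apply: ge_sup => //; exists a.
have [|d d0 Hd] := H c; first by rewrite ac cb.
have d20 : 0 < d / 2 by lra.
have [x [xb [s cs lx]] xlt] := sup_adherent d20 hS.
have xc : x <= c by apply: sup_upper_bound => //; split => //; exists s.
have ax : a <= x.
  rewrite -lx; elim: (s) (a) cs => //= z t IH y [yz _ /IH]; apply: le_trans.
  exact: ltW.
pose y := Num.min (c + d / 2) b.
have cy : c <= y by rewrite /y le_min cb andbT lerDl ltW// d20.
have yb : y <= b by rewrite /y ge_min lexx orbT.
have [xb'|xneb] := eqVneq x b; first by exists s => //; rewrite lx.
have xy : x < y.
  by rewrite lt_min [x < b]lt_neqAle xneb xb !andbT (le_lt_trans xc)// ltrDl d20.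
have Sy : S y.
  split => //; exists (rcons s y); last by rewrite last_rcons.
  apply: chain_rcons => //; rewrite lx //; apply: Hd; rewrite ?ax ?cy//.
  have : y <= c + d / 2 by rewrite /y ge_min lexx.
  move: xlt; rewrite -/c; lra.
have yc : y <= c by exact: sup_upper_bound.
case: Sy => _ [t ct lt]; exists t => //; rewrite lt.
move: yc; rewrite /y; case: (leP (c + d / 2) b) => // _.
by rewrite gerDl; lra.
Qed.

(** The intervals [p.1, p.2] that contain c, shrinking to c. The links asked for by
    [cousin_chain] at c are those of a property that holds eventually for this filter. *)
Definition straddle (c : R) : set_system (R * R) :=
  [set A | exists2 d, 0 < d & forall p : R * R, p.1 <= c <= p.2 ->
     p.1 < p.2 -> p.2 - p.1 < d -> A p].

Global Instance straddle_filter c : Filter (straddle c).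
Proof.
split.
- by exists 1.
- move=> A B [d1 d10 H1] [d2 d20 H2]; exists (Num.min d1 d2).
    by rewrite lt_min d10.
  by move=> p pc lt; rewrite lt_min => /andP[? ?]; split; [exact: H1|exact: H2].
- move=> A B AB [d d0 H]; exists d => // p pc lt pd; exact/AB/H.
Qed.

Global Instance straddle_proper c : ProperFilter (straddle c).
Proof.
split; last exact: straddle_filter.
by move=> [d d0 /(_ (c, c + d / 2))/=]; apply; lra.
Qed.

Lemma straddle_fst c : fst @ straddle c --> c.
Proof.
apply/cvgrPdist_lt => e e0; exists e => // -[x y] /= /andP[xc cy] xy yx.
by rewrite ger0_norm; lra.
Qed.

Lemma straddle_snd c : snd @ straddle c --> c.
Proof.
apply/cvgrPdist_lt => e e0; exists e => // -[x y] /= /andP[xc cy] xy yx.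
by rewrite ler0_norm; lra.
Qed.

(** The difference quotient over [a, b] is a convex combination of those over [a, c]
    and [c, b]. *)
Lemma straddle_derive (f : R -> R) (c l : R) : is_derive c (1 : R) f l ->
  (fun p : R * R => (f p.2 - f p.1) / (p.2 - p.1)) @ straddle c --> l.
Proof.
move=> [df dfl]; have : (fun h => h^-1 *: ((f \o shift c) (h *: (1:R)) - f c)) @ 0^' --> l.
  by rewrite -dfl; exact: df.
move=> /cvgrPdist_le H; apply/cvgrPdist_le => e e0.
have [d /= d0 Hd] := H e e0.
have K x : `|x - c| < d -> `|f x - f c - l * (x - c)| <= e * `|x - c|.
  have [->|xc] := eqVneq x c; first by rewrite !subrr mulr0 subrr normr0 mulr0.
  have xc0 : x - c != 0 by rewrite subr_eq0.
  move=> xd; have := Hd (x - c); rewrite /= sub0r normrN => /(_ xd xc0).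
  rewrite /GRing.scale /= mulr1 subrK => h.
  have -> : f x - f c - l * (x - c) = - ((x - c) * (l - (x - c)^-1 * (f x - f c))).
    by field.
  by rewrite normrN normrM mulrC ler_wpM2r.
exists d => // -[x y] /= /andP[xc cy] xy yx.
have yx0 : 0 < y - x by rewrite subr_gt0.
have Kx : `|f x - f c - l * (x - c)| <= e * (c - x).
  rewrite -[X in e * X](_ : `|x - c| = c - x); last by rewrite ler0_norm; lra.
  by apply: K; rewrite ler0_norm; lra.
have Ky : `|f y - f c - l * (y - c)| <= e * (y - c).
  rewrite -[X in e * X](_ : `|y - c| = y - c); last by rewrite ger0_norm; lra.
  by apply: K; rewrite ger0_norm; lra.
suff : `|(l - (f y - f x) / (y - x)) * (y - x)| <= e * (y - x).
  by rewrite normrM (gtr0_norm yx0) ler_pM2r.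
have -> : (l - (f y - f x) / (y - x)) * (y - x) =
  (f x - f c - l * (x - c)) - (f y - f c - l * (y - c)).
  by field; rewrite gt_eqF.
apply: le_trans (ler_normB _ _) _; lra.
Qed.

Lemma straddle_length (f : R -> R) (c l : R) : f 0 = 0 -> is_derive (0 : R) (1 : R) f l ->
  (fun p : R * R => f (p.2 - p.1) / (p.2 - p.1)) @ straddle c --> l.
Proof.
move=> f0 [df dfl]; have : (fun h => h^-1 *: ((f \o shift 0) (h *: (1:R)) - f 0)) @ 0^' --> l.
  by rewrite -dfl; exact: df.
move=> /cvgrPdist_lt H; apply/cvgrPdist_lt => e e0.
have [d /= d0 Hd] := H e e0.
exists d => // -[x y] /= /andP[xc cy] xy yx.
have yx0 : 0 < y - x by rewrite subr_gt0.
have := Hd (y - x); rewrite /= sub0r normrN gtr0_norm// => /(_ yx) .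
by rewrite gt_eqF// => /(_ isT); rewrite /GRing.scale /= mulr1 addr0 f0 subr0 mulrC.
Qed.

End cousin.

(** * Slopes of a cone and the energy of its sectors *)

Section profile_functions.
Context (R : realType).
Implicit Types x y z t w d h m e : R.

(** The reciprocal slope, along the ruling of angle t, of the cone with vertex
    (x, y, -z) over the unit circle. *)
Definition inv_slope x y z t : R := (1 - x * cos t - y * sin t) / z.
Definition inv_slope' x y z t : R := (x * sin t - y * cos t) / z.

(** The integrand at slope 1 / w is w^2 / (1 + d w^2); the extra factor w is the
    width of a sector of the cone, relative to its height and its angle. *)
Definition sector_energy d w : R := w ^+ 3 / (1 + d * w ^+ 2).
Definition sector_energy' d w : R := (3 * w ^+ 2 + d * w ^+ 4) / (1 + d * w ^+ 2) ^+ 2.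
Definition sector_energy'' d w : R := (6 * w - 2 * d * w ^+ 3) / (1 + d * w ^+ 2) ^+ 3.

(** The integrand of the functional at slope 1 / w. *)
Definition slope_density d w : R := w ^+ 2 / (1 + d * w ^+ 2).

(** Moving the vertex towards the meeting point of the tangents at angles m - e and
    m + e subtracts a multiple of this function from the reciprocal slope; see
    [inv_slope_lower_vertex]. *)
Definition lowering m e t : R := cos (t - m) / cos e - 1.
Definition lowering' m e t : R := - sin (t - m) / cos e.
Definition tan_half h : R := sin (h / 2) / cos (h / 2).

Lemma den_gt0 d w : 0 <= d -> 0 < 1 + d * w ^+ 2.
Proof. by move=> d0; rewrite ltr_pwDl// mulr_ge0// sqr_ge0. Qed.

Lemma is_derive_inv_slope x y z t : is_derive t (1 : R) (inv_slope x y z) (inv_slope' x y z t).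
Proof.
by apply: is_derive_eq; rewrite /inv_slope' /GRing.scale /=; ring.
Qed.

Lemma is_derive_inv_slope' x y z t : z != 0 ->
  is_derive t (1 : R) (inv_slope' x y z) (1 / z - inv_slope x y z t).
Proof.
by move=> z0; apply: is_derive_eq; rewrite /inv_slope /GRing.scale /=; field.
Qed.

Lemma is_derive_lowering m e t : is_derive t (1 : R) (lowering m e) (lowering' m e t).
Proof.
by apply: is_derive_eq; rewrite /lowering' /GRing.scale /=; ring.
Qed.

Lemma is_derive_lowering' m e t : is_derive t (1 : R) (lowering' m e) (- 1 - lowering m e t).
Proof.
by apply: is_derive_eq; rewrite /lowering /GRing.scale /=; ring.
Qed.

Lemma is_derive_quot (f g : R -> R) (x a b : R) :
  is_derive x (1 : R) f a -> is_derive x (1 : R) g b -> g x != 0 ->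
  is_derive x (1 : R) (fun t => f t / g t) ((a * g x - f x * b) / g x ^+ 2).
Proof.
move=> df dg g0; have dV := is_deriveV g0 dg.
have dM := is_deriveM df dV.
by apply: is_derive_eq; rewrite /GRing.scale /=; field.
Qed.

Lemma is_derive_sector_energy d w : 0 <= d -> is_derive w (1 : R) (sector_energy d)
    (sector_energy' d w).
Proof.
move=> d0; have D0 := lt0r_neq0 (den_gt0 w d0).
have dn : is_derive w (1 : R) (fun w => w ^+ 3) (3 * w ^+ 2).
  by apply: is_derive_eq; rewrite /GRing.scale /=; ring.
have dd : is_derive w (1 : R) (fun w => 1 + d * w ^+ 2) (2 * d * w).
  by apply: is_derive_eq; rewrite /GRing.scale /=; ring.
have dq := is_derive_quot dn dd D0.
apply: (is_derive_eq dq); rewrite /sector_energy' /=; by field.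
Qed.

Lemma is_derive_sector_energy' d w : 0 <= d -> is_derive w (1 : R) (sector_energy' d)
    (sector_energy'' d w).
Proof.
move=> d0; have D0 := lt0r_neq0 (den_gt0 w d0).
have dn : is_derive w (1 : R) (fun w => 3 * w ^+ 2 + d * w ^+ 4) (6 * w + 4 * d * w ^+ 3).
  by apply: is_derive_eq; rewrite /GRing.scale /=; ring.
have dd : is_derive w (1 : R) (fun w => (1 + d * w ^+ 2) ^+ 2)
    (4 * d * w * (1 + d * w ^+ 2)).
  by apply: is_derive_eq; rewrite /GRing.scale /=; ring.
have D2 : (1 + d * w ^+ 2) ^+ 2 != 0 by rewrite expf_neq0.
have dq := is_derive_quot dn dd D2.
apply: (is_derive_eq dq); rewrite /sector_energy'' /=; by field.
Qed.

Lemma is_derive_tan_half : is_derive (0 : R) (1 : R) tan_half (1 / 2).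
Proof.
have dn : is_derive (0 : R) (1 : R) (fun h => sin (h / 2)) (2^-1).
  by apply: is_derive_eq; rewrite mul0r cos0 /GRing.scale /=; ring.
have dd : is_derive (0 : R) (1 : R) (fun h => cos (h / 2)) 0.
  by apply: is_derive_eq; rewrite mul0r sin0 /GRing.scale /=; ring.
have D : cos (0 / 2 : R) != 0 by rewrite mul0r cos0 oner_neq0.
apply: (is_derive_eq (is_derive_quot dn dd D)).
by rewrite mul0r cos0 sin0; field.
Qed.

(** Taylor's formula with a remainder that is uniform in d; after reduction to a
    common denominator the difference is a polynomial in d with nonnegative
    coefficients. *)
Lemma sector_energy_quadratic_bound d w y : 0 <= d -> 0 <= y <= w ->
  sector_energy d (w - y) <= sector_energy d w - y * sector_energy' d w + 3 * w * y ^+ 2.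
Proof.
move=> d0 /andP[y0 yw].
pose X := w - y; have X0 : 0 <= X by rewrite subr_ge0.
have w0 : 0 <= w by exact: le_trans yw.
have W0 := den_gt0 w d0; have V0 := den_gt0 (w - y) d0.
have [Wn Vn] := (lt0r_neq0 W0, lt0r_neq0 V0).
rewrite -subr_ge0.
have -> : sector_energy d w - y * sector_energy' d w + 3 * w * y ^+ 2 - sector_energy d (w
    - y) =
  (y ^+ 3 + d * (X * (w ^+ 2 - X ^+ 2) ^+ 2 + 6 * w ^+ 3 * y ^+ 2 + X ^+ 2 * y ^+ 3)
   + d ^+ 2 * (3 * w ^+ 5 * y ^+ 2 + 6 * X ^+ 2 * w ^+ 3 * y ^+ 2)
   + 3 * d ^+ 3 * w ^+ 5 * y ^+ 2 * X ^+ 2) /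
  ((1 + d * w ^+ 2) ^+ 2 * (1 + d * (w - y) ^+ 2)).
  by rewrite /sector_energy /sector_energy' /X; field; rewrite Wn Vn.
apply: divr_ge0; last by rewrite mulr_ge0 ?sqr_ge0// ltW.
have pos (a S : R) : 0 <= a -> 0 <= S -> 0 <= y ^+ 3 +
    d * (a * S + 6 * w ^+ 3 * y ^+ 2 + a ^+ 2 * y ^+ 3)
    + d ^+ 2 * (3 * w ^+ 5 * y ^+ 2 + 6 * a ^+ 2 * w ^+ 3 * y ^+ 2)
    + 3 * d ^+ 3 * w ^+ 5 * y ^+ 2 * a ^+ 2.
  by move=> a0 S0; rewrite !(addr_ge0, mulr_ge0, exprn_ge0, ler0n).
by apply: pos => //; exact: sqr_ge0.
Qed.

(** The left-hand side is the integrand of the first variation, with v = w'(t). It is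
    negative precisely under the hypothesis of the theorem. *)
Lemma sector_energy_second_variation d w v : 0 <= d ->
  sector_energy d w - w * sector_energy' d w + sector_energy'' d w * v ^+ 2 =
  2 * w / (1 + d * w ^+ 2) ^+ 3 *
   (3 * v ^+ 2 - w ^+ 2 - d * w ^+ 2 * (w ^+ 2 + v ^+ 2)).
Proof.
by move=> d0; have D0 := lt0r_neq0 (den_gt0 w d0); rewrite /sector_energy /sector_energy'
    /sector_energy''; field.
Qed.

(** The term produced by two integrations by parts in the first variation. *)
Definition boundary_term x y z d m e t : R :=
  z * (lowering m e t * sector_energy' d (inv_slope x y z t) * inv_slope' x y z t -
      lowering' m e t * sector_energy d (inv_slope x y z t)).

(** Uses w'' = 1 / z - w and q'' = - 1 - q. *)
Lemma is_derive_boundary_term x y z d m e t : 0 <= d -> z != 0 ->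
  is_derive t (1 : R) (boundary_term x y z d m e)
   (z * ((1 + lowering m e t) * sector_energy d (inv_slope x y z t) +
    lowering m e t * (sector_energy' d (inv_slope x y z t) * (1 / z - inv_slope x y z t) +
      sector_energy'' d (inv_slope x y z t) * inv_slope' x y z t ^+ 2))).
Proof.
move=> d0 z0.
have dw := is_derive_inv_slope x y z t; have dw' := is_derive_inv_slope' x y t z0.
have dq := is_derive_lowering m e t; have dq' := is_derive_lowering' m e t.
have dG := is_derive1_comp (is_derive_sector_energy (inv_slope x y z t) d0) dw.
have dG1 := is_derive1_comp (is_derive_sector_energy' (inv_slope x y z t) d0) dw.
have d1 := is_deriveM (is_deriveM dq dG1) dw'.
have d2 := is_deriveM dq' dG.
have d3 := is_deriveZ z (is_deriveB d1 d2).
apply: (is_derive_eq d3).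
have -> : (lowering m e * (sector_energy' d \o inv_slope x y z)) t = lowering m e t *
    sector_energy' d (inv_slope x y z t) by [].
rewrite /GRing.scale /=; ring.
Qed.

End profile_functions.

(** * Comparison of thin sectors *)

Section partition.
Context (R : realType).
Implicit Types x y z m e s t d c k : R.

Lemma is_derive_cvg (f : R -> R) (x l : R) : is_derive x (1 : R) f l ->
  f t @[t --> x] --> f x.
Proof.
by move=> df; apply: differentiable_continuous; apply/derivable1_diffP; exact: ex_derive.
Qed.

(** Twice the signed area of the triangle with vertices (x, y) and the points of the
    unit circle of angles a and b. *)
Definition chord_det (x y a b : R) : R :=
  (cos a - x) * (sin b - y) - (sin a - y) * (cos b - x).

Lemma chord_detE x y a b :
  chord_det x y a b = sin (b - a) - (x * sin b - y * cos b) + (x * sin a - y * cos a).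
Proof. by rewrite /chord_det sinB; ring. Qed.

Lemma straddle_chord_det x y z c : z != 0 ->
  (fun p : R * R => chord_det x y p.1 p.2 / (p.2 - p.1)) @ straddle c --> z * inv_slope x y z c.
Proof.
move=> z0.
have ds : is_derive (0 : R) (1 : R) (fun h => sin h) 1.
  by apply: is_derive_eq; rewrite cos0.
have h1 := straddle_length c (sin0 R) ds.
have dc : is_derive c (1 : R) (fun t => x * sin t - y * cos t) (x * cos c + y * sin c).
  by apply: is_derive_eq; rewrite /GRing.scale /=; ring.
have h2 := straddle_derive dc.
have FF := straddle_filter c.
have := cvgB h1 h2.
have -> : 1 - (x * cos c + y * sin c) = z * inv_slope x y z c by rewrite /inv_slope; field.
move=> /(_ FF) H; apply: cvg_trans H; apply: near_eq_cvg; near=> p; rewrite /= chord_detE.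
rewrite fctE -mulrBl; congr (_ / _); ring.
Unshelve. all: by end_near.
Qed.

Lemma inv_slope_lower_vertex (x y z m e s t : R) : z != 0 -> 1 - s != 0 -> cos e != 0 ->
  inv_slope ((1 - s) * x + s * (cos m / cos e)) ((1 - s) * y + s * (sin m / cos e))
     ((1 - s) * z) t = inv_slope x y z t - s / ((1 - s) * z) * lowering m e t.
Proof. by move=> z0 s1 e0; rewrite /inv_slope /lowering cosB; field; rewrite e0 z0 s1. Qed.

(** The sector [a, b] of the lowered cone, counted with the increment of K, costs no
    more than that of the original cone. Here mu bounds the integrand on the
    original cone from below, and [z1 * tan_half (b - a) * (_ + _)] is twice the
    energy of the two wedges cut out by the tangent planes at a and b; see
    [wedge_area]. *)
Definition piece (x y z d x1 y1 z1 : R) (K : R -> R) (a b : R) : Prop :=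
  exists mu, [/\ 0 <= mu, forall t, a <= t <= b -> mu <= slope_density d (inv_slope x y z t) &
   z1 * tan_half (b - a) * (sector_energy d (inv_slope x1 y1 z1 a) + sector_energy d
       (inv_slope x1 y1 z1 b)) + (K b - K a)
   <= mu * chord_det x y a b].

Lemma slope_density_mul (d w : R) : slope_density d w * w = sector_energy d w.
Proof. by rewrite /slope_density /sector_energy mulrAC -exprSr. Qed.

Lemma is_derive_slope_density (d w : R) : 0 <= d ->
  is_derive w (1 : R) (slope_density d) (2 * w / (1 + d * w ^+ 2) ^+ 2).
Proof.
move=> d0; have D0 := lt0r_neq0 (den_gt0 w d0).
have dn : is_derive w (1 : R) (fun w => w ^+ 2) (2 * w).
  by apply: is_derive_eq; rewrite /GRing.scale /=; ring.
have dd : is_derive w (1 : R) (fun w => 1 + d * w ^+ 2) (2 * d * w).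
  by apply: is_derive_eq; rewrite /GRing.scale /=; ring.
by apply: (is_derive_eq (is_derive_quot dn dd D0)); field.
Qed.

(** After division by b - a and passage to the limit, the inequality required of a
    piece becomes z1 G(w1) + k <= mu z w. It holds strictly at c for mu slightly
    below the integrand at c, hence for all short intervals around c. *)
Lemma local_piece x y z d x1 y1 z1 (K : R -> R) (c k : R) :
  0 < z -> 0 <= d -> 0 < inv_slope x y z c -> z1 != 0 ->
  is_derive c (1 : R) K k ->
  z1 * sector_energy d (inv_slope x1 y1 z1 c) + k < z * sector_energy d (inv_slope x y z c) ->
  exists2 r, 0 < r & forall a b, a <= c <= b -> a < b -> b - a < r ->
    piece x y z d x1 y1 z1 K a b.
Proof.
move=> z0 d0 w0 z10 dK H.
have zn := lt0r_neq0 z0.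
have F0 : 0 < slope_density d (inv_slope x y z c) by rewrite divr_gt0 ?exprn_gt0 ?den_gt0.
pose gap := z * sector_energy d (inv_slope x y z c) - (z1 * sector_energy d (inv_slope x1
    y1 z1 c) + k).
have gap0 : 0 < gap by rewrite subr_gt0.
have zw0 : 0 < z * inv_slope x y z c by rewrite mulr_gt0.
(* mu is the integrand at c minus th: at most half of the gap is spent, and mu stays
   nonnegative *)
pose th := Num.min (slope_density d (inv_slope x y z c)) (gap / (2 * (z * inv_slope x y z c))).
have th0 : 0 < th by rewrite lt_min F0 divr_gt0// mulr_gt0.
pose mu := slope_density d (inv_slope x y z c) - th.
have mu0 : 0 <= mu by rewrite subr_ge0 /th ge_min lexx.
have muz : z * sector_energy d (inv_slope x y z c) - gap < mu * (z * inv_slope x y z c).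
  have h : th * (z * inv_slope x y z c) <= gap / 2.
    apply: le_trans (_ : gap / (2 * (z * inv_slope x y z c)) * (z * inv_slope x y z c) <= _).
      by apply: ler_wpM2r; [exact: ltW|rewrite /th ge_min lexx orbT].
    by rewrite le_eqVlt; apply/orP; left; apply/eqP; field; rewrite zn lt0r_neq0.
  have -> : mu * (z * inv_slope x y z c) =
      z * sector_energy d (inv_slope x y z c) - th * (z * inv_slope x y z c).
    by rewrite -slope_density_mul /mu; ring.
  lra.
have dw1 := is_derive_inv_slope x1 y1 z1 c.
have cG : sector_energy d (inv_slope x1 y1 z1 t) @[t --> c] --> sector_energy d (inv_slope
    x1 y1 z1 c).
  exact: is_derive_cvg (is_derive1_comp (is_derive_sector_energy (inv_slope x1 y1 z1 c) d0)
      dw1).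
have cF : slope_density d (inv_slope x y z t) @[t --> c] --> slope_density d (inv_slope x y
    z c).
  exact: is_derive_cvg (is_derive1_comp (is_derive_slope_density (inv_slope x y z c) d0)
      (is_derive_inv_slope x y z c)).
have G1 := cvg_comp _ _ (@straddle_fst R c) cG.
have G2 := cvg_comp _ _ (@straddle_snd R c) cG.
have tn0 : tan_half (0 : R) = 0 by rewrite /tan_half mul0r sin0 mul0r.
have T := straddle_length c tn0 (is_derive_tan_half R).
have KK := straddle_derive dK.
have DD := @straddle_chord_det x y z c zn.
have FF := straddle_filter c.
have L := cvgB (cvgD (cvgM (cvgZr (k := z1) T) (cvgD G1 G2)) KK) (cvgZr (k := mu) DD).
have {}L := L FF FF FF FF FF FF.
have lt0 : (z1 *: (1 / 2)) * (sector_energy d (inv_slope x1 y1 z1 c) + sector_energy d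
    (inv_slope x1 y1 z1 c)) + k -
   mu *: (z * inv_slope x y z c) < 0.
  rewrite /GRing.scale /= subr_lt0.
  apply: le_lt_trans muz; rewrite /gap.
  by rewrite le_eqVlt; apply/orP; left; apply/eqP; field.
have [r1 r10 Hr1] := @cvgr_lt _ _ _ FF _ _ L _ lt0.
have mult : mu < slope_density d (inv_slope x y z c) by rewrite /mu gtrBl.
have nF : \forall t \near c, mu < slope_density d (inv_slope x y z t) by exact: (cvgr_gt _
    cF _ mult).
move/nbhs_ballP: nF => [r2 /= r20 Hr2].
exists (Num.min r1 r2); first by rewrite lt_min r10.
move=> a b acb ab; rewrite lt_min => /andP[br1 br2].
exists mu; split => //.
  move=> t /andP[ta tb]; apply/ltW/Hr2; rewrite /ball /=.
  by move: acb => /andP[ac cb]; rewrite ltr_distl; apply/andP; split; lra.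
have ba0 : b - a != 0 by rewrite subr_eq0 gt_eqF.
have : z1 * (tan_half (b - a) / (b - a)) * (sector_energy d (inv_slope x1 y1 z1 a) +
    sector_energy d (inv_slope x1 y1 z1 b)) +
  (K b - K a) / (b - a) - mu * (chord_det x y a b / (b - a)) < 0 := Hr1 (a, b) acb ab br1.
rewrite -subr_le0.
set A := z1 * tan_half (b - a) * _ + _ - _.
rewrite (_ : _ - _ = A / (b - a)); last by rewrite /A; field.
by rewrite pmulr_llt0 ?invr_gt0 ?subr_gt0//; exact: ltW.
Qed.

End partition.

(** * Choice of the arc, of the lowering and of the partition *)

Section fan_partition.
Context (R : realType).
Implicit Types x y z m e s t d c k : R.

(** Cauchy-Schwarz. *)
Lemma cos_sin_le x y r t : 0 <= r -> x ^+ 2 + y ^+ 2 <= r ^+ 2 ->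
  x * cos t + y * sin t <= r.
Proof.
move=> r0 xyr; have cs := cos2Dsin2 t.
rewrite (le_trans (ler_norm _))// -(ler_pXn2r (_ : 0 < 2)%N) ?nnegrE//.
rewrite real_normK ?num_real//; apply: le_trans xyr.
rewrite -[leRHS]mulr1 -cs -subr_ge0.
have -> : (x ^+ 2 + y ^+ 2) * (cos t ^+ 2 + sin t ^+ 2) - (x * cos t + y * sin t) ^+ 2
  = (x * sin t - y * cos t) ^+ 2 by ring.
exact: sqr_ge0.
Qed.

Lemma radius_exists x y : x ^+ 2 + y ^+ 2 < 1 ->
  exists r, [/\ 0 <= r, r < 1 & x ^+ 2 + y ^+ 2 <= r ^+ 2].
Proof.
move=> xy1; exists (Num.sqrt (x ^+ 2 + y ^+ 2)).
have xy0 : 0 <= x ^+ 2 + y ^+ 2 by rewrite addr_ge0 ?sqr_ge0.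
rewrite sqr_sqrtr// sqrtr_ge0; split => //.
by rewrite -(ltr_pXn2r (_ : 0 < 2)%N) ?nnegrE ?sqrtr_ge0// sqr_sqrtr// expr1n.
Qed.

(** The factor of q in the integrand of the first variation. *)
Definition second_variation x y z d t : R :=
  sector_energy d (inv_slope x y z t) - inv_slope x y z t * sector_energy' d (inv_slope x y
      z t) +
  sector_energy'' d (inv_slope x y z t) * inv_slope' x y z t ^+ 2.

Lemma continuous_second_variation x y z d c : 0 <= d -> z != 0 ->
  second_variation x y z d t @[t --> c] --> second_variation x y z d c.
Proof.
move=> d0 z0.
have dw := is_derive_inv_slope x y z c.
have cw := is_derive_cvg dw.
have cw' := is_derive_cvg (is_derive_inv_slope' x y c z0).
have cG := is_derive_cvg (is_derive1_comp (is_derive_sector_energy (inv_slope x y z c) d0) dw).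
have cG1 := is_derive_cvg (is_derive1_comp (is_derive_sector_energy' (inv_slope x y z c)
    d0) dw).
have cG2 : sector_energy'' d (inv_slope x y z t) @[t --> c] --> sector_energy'' d
    (inv_slope x y z c).
  have dn : is_derive (inv_slope x y z c) (1 : R) (fun w => 6 * w - 2 * d * w ^+ 3)
    (6 - 6 * d * inv_slope x y z c ^+ 2).
    by apply: is_derive_eq; rewrite /GRing.scale /=; ring.
  have dd : is_derive (inv_slope x y z c) (1 : R) (fun w => (1 + d * w ^+ 2) ^+ 3)
    (6 * d * inv_slope x y z c * (1 + d * inv_slope x y z c ^+ 2) ^+ 2).
    by apply: is_derive_eq; rewrite /GRing.scale /=; ring.
  have D0 : (1 + d * inv_slope x y z c ^+ 2) ^+ 3 != 0.
    by rewrite expf_neq0// lt0r_neq0// den_gt0.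
  exact: is_derive_cvg (is_derive1_comp (is_derive_quot dn dd D0) dw).
apply: cvgD; first by apply: cvgB => //; exact: cvgM.
by apply: cvgM => //; exact: (cvgM cw' cw').
Qed.

Lemma small_arc (r : R) : r < 1 ->
  exists2 e0, 0 < e0 <= 1 / 2 & forall t, `|t| <= 2 * e0 -> r < cos t.
Proof.
move=> r1; have c0 : cos t @[t --> (0 : R)] --> cos (0 : R).
  exact: (is_derive_cvg (is_derive_cos (0 : R))).
have nF : \forall t \near (0 : R), r < cos t.
  by apply: (cvgr_gt _ c0); rewrite cos0.
move/nbhs_ballP : nF => [h /= h0 Hh].
exists (Num.min (h / 4) (1 / 2)).
  by rewrite ge_min lexx orbT andbT lt_min; apply/andP; split; lra.
move=> t tle; apply: Hh; rewrite /ball /= sub0r normrN.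
apply: le_lt_trans tle _; have : Num.min (h / 4) (1 / 2) <= h / 4 by rewrite ge_min lexx.
lra.
Qed.

Lemma cos_lt_abs e t : 0 <= e <= 1 -> `|t| < e -> cos e < cos t.
Proof.
move=> /andP[e0 e1] te.
have -> : cos t = cos `|t|.
  by have [h|h] := ltP 0 t; [rewrite gtr0_norm|rewrite ler0_norm// cosN].
have p2 := pi_ge2 R.
rewrite ltr_cos// in_itv /=; apply/andP; split => //; lra.
Qed.

Lemma straddle_chain (P : R -> R -> Prop) (a b : R) : a < b ->
  (forall c, a <= c <= b -> exists2 r, 0 < r & forall u v,
     u <= c <= v -> u < v -> v - u < r -> P u v) ->
  exists2 ns, chain P a ns & last a ns = b.
Proof.
move=> ab H; apply: cousin_chain; first exact: ltW.
move=> c cab; have [r r0 Hr] := H c cab; exists r => // u v /andP[_ uc] /andP[cv _].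
by apply: Hr; rewrite uc.
Qed.

(** First-order expansion in s of the energy of the lowered cone. The quadratic error
    is of order s^2 q, so for s small with respect to c0 it uses up only half of the
    first-order gain s z c0 q; being proportional to q, the estimate survives at
    the ends of the arc, where q vanishes. *)
Lemma gain_pointwise x y z d s q w w' c0 : 0 < z -> 0 <= d -> 0 < s <= 1 / 2 ->
  0 <= q <= 1 -> 0 <= w <= 2 / z -> s <= c0 * z ^+ 3 / 24 ->
  2 * s / z * q <= w ->
  sector_energy d w - w * sector_energy' d w + sector_energy'' d w * w' ^+ 2 <= - c0 ->
  (1 - s) * z * sector_energy d (w - s / ((1 - s) * z) * q) +
   s * (z * ((1 + q) * sector_energy d w + q * (sector_energy' d w * (1 / z - w) +
       sector_energy'' d w * w' ^+ 2)))
   + z * s * c0 / 2 * q <= z * sector_energy d w.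
Proof.
move=> z0 d0 /andP[s0 s1] /andP[q0 q1] /andP[w0 wz] sc yw E.
have zn := lt0r_neq0 z0; have s1' : 0 < 1 - s by lra.
set sg := s / ((1 - s) * z).
have sg0 : 0 <= sg by rewrite divr_ge0 ?mulr_ge0 ?ltW.
have sg2 : sg <= 2 * s / z.
  rewrite /sg ler_pdivrMr ?mulr_gt0//.
  have -> : 2 * s / z * ((1 - s) * z) = s * (2 * (1 - s)) by field.
  rewrite -subr_ge0 (_ : _ - s = s * (1 - 2 * s)); last by ring.
  by apply: mulr_ge0; lra.
have yb : 0 <= sg * q <= w.
  rewrite mulr_ge0//= (le_trans _ yw)// ler_wpM2r//.
have T := sector_energy_quadratic_bound d0 yb.
have T' : (1 - s) * z * sector_energy d (w - sg * q) <= (1 - s) * z *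
   (sector_energy d w - sg * q * sector_energy' d w + 3 * w * (sg * q) ^+ 2).
  by apply: ler_wpM2l => //; rewrite mulr_ge0 ?ltW.
have quad : (1 - s) * z * (3 * w * (sg * q) ^+ 2) <= z * s * c0 / 2 * q.
  have -> : (1 - s) * z * (3 * w * (sg * q) ^+ 2) = (s * q) * (3 * w * sg * q).
    by rewrite /sg; field; rewrite zn lt0r_neq0.
  have -> : z * s * c0 / 2 * q = (s * q) * (z * c0 / 2) by ring.
  apply: ler_wpM2l; first by rewrite mulr_ge0// ltW.
  apply: (@le_trans _ _ (3 * (2 / z) * (2 * s / z) * 1)).
    have p0 : 0 <= 3 * w by apply: mulr_ge0.
    have p1 : 0 <= 3 * w * sg by apply: mulr_ge0.
    have p2 : 3 * w <= 3 * (2 / z) by rewrite ler_wpM2l.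
    by apply: ler_pM => //; apply: ler_pM.
  have -> : 3 * (2 / z) * (2 * s / z) * 1 = 12 * s / z ^+ 2 by field.
  rewrite ler_pdivrMr ?exprn_gt0//.
  have -> : z * c0 / 2 * z ^+ 2 = 12 * (c0 * z ^+ 3 / 24) by field.
  by rewrite ler_pM2l.
have lin : z * s * q * (sector_energy d w - w * sector_energy' d w + sector_energy'' d w *
    w' ^+ 2) <= z * s * q * - c0.
  by apply: ler_wpM2l => //; rewrite !mulr_ge0// ltW.
have e1 : (1 - s) * z * (sector_energy d w - sg * q * sector_energy' d w + 3 * w * (sg * q)
    ^+ 2) +
  s * (z * ((1 + q) * sector_energy d w + q * (sector_energy' d w * (1 / z - w) +
      sector_energy'' d w * w' ^+ 2)))
  = z * sector_energy d w + z * s * q * (sector_energy d w - w * sector_energy' d w +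
      sector_energy'' d w * w' ^+ 2) +
    (1 - s) * z * (3 * w * (sg * q) ^+ 2).
  by rewrite /sg; field; rewrite zn lt0r_neq0.
have e2 : z * s * q * - c0 = - (z * s * c0 / 2 * q) - (z * s * c0 / 2 * q) by field.
lra.
Qed.

End fan_partition.

Section fan_partition2.
Context (R : realType).
Implicit Types x y z m e s t d c k : R.

(** All the choices behind the competitor: the arc [m - e, m + e], the fraction s of
    the way that the vertex is moved, the nodes m - e :: ns, and the function K that
    records the gain. [fan_gain] says that the gain exceeds the cost of the two
    triangles between the old and the new end rulings. *)
Record fan (x y z d r m e s : R) (K : R -> R) (ns : seq R) : Prop := Fan {
  fan_r : 0 <= r < 1;
  fan_xy : x ^+ 2 + y ^+ 2 <= r ^+ 2;
  fan_e : 0 < e <= 1 / 2;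
  fan_s : 0 < s <= 1 / 2;
  fan_cos : forall t, `|t| <= 2 * e -> r < cos t;
  fan_inv_slope : forall t, `|t - m| <= e -> 0 < inv_slope x y z t - s / ((1 - s) * z) *
      lowering m e t;
  fan_chain : chain (piece x y z d ((1 - s) * x + s * (cos m / cos e))
    ((1 - s) * y + s * (sin m / cos e)) ((1 - s) * z) K) (m - e) ns;
  fan_last : last (m - e) ns = m + e;
  fan_gain : K (m - e) + s * z * (sin e / cos e) *
    (sector_energy d (inv_slope x y z (m - e)) + sector_energy d (inv_slope x y z (m + e)))
        < K (m + e) }.

Lemma lowering_end m e : cos e != 0 -> lowering m e (m - e) = 0 /\ lowering m e (m + e) = 0.
Proof.
move=> c0; rewrite /lowering.
have -> : m - e - m = - e by ring.
have -> : m + e - m = e by ring.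
by rewrite cosN divff// subrr.
Qed.

(** The hypothesis is an open condition on the angle, so it persists on a small arc;
    the arc is taken inside (alpha, beta) even when c is one of its ends. *)
Lemma arc_exists x y z d alpha beta c :
  0 < z -> 0 <= d -> x ^+ 2 + y ^+ 2 < 1 -> alpha < beta -> alpha <= c <= beta ->
  3 * inv_slope' x y z c ^+ 2 - inv_slope x y z c ^+ 2
    < d * inv_slope x y z c ^+ 2 * (inv_slope x y z c ^+ 2 + inv_slope' x y z c ^+ 2) ->
  exists r m e c0, [/\ 0 <= r < 1, x ^+ 2 + y ^+ 2 <= r ^+ 2, 0 < c0 & 0 < e <= 1 / 2] /\
    [/\ alpha < m - e, m + e < beta,
     forall t, `|t| <= 2 * e -> r < cos t /\ 1 / 2 < cos t &
     forall t, `|t - m| <= e -> second_variation x y z d t <= - c0].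
Proof.
move=> z0 d0 xy1 ab /andP[ac cb] Hc.
have zn := lt0r_neq0 z0.
have [r [r0 r1 xyr]] := radius_exists xy1.
have Ec : second_variation x y z d c < 0.
  rewrite /second_variation sector_energy_second_variation// pmulr_rlt0 ?subr_lt0//.
  apply: divr_gt0; last exact/exprn_gt0/den_gt0.
  rewrite mulr_gt0// /inv_slope divr_gt0//.
  by have := cos_sin_le c r0 xyr; lra.
have [c0 [c00 c0E]] : exists c0, 0 < c0 /\ second_variation x y z d c < - c0.
  by exists (- (second_variation x y z d c) / 2); split; lra.
have nF : \forall t \near c, second_variation x y z d t < - c0.
  exact: (cvgr_lt _ (@continuous_second_variation R x y z d c d0 zn)).
move/nbhs_ballP : nF => [h /= h0 Hh].
have r1' : Num.max r (1 / 2) < 1 by rewrite gt_max r1; lra.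
have [e0 /andP[e00 e01] He0] := small_arc r1'.
have [lo [hi [lohi alo clo bhi chi]]] :
    exists lo hi, [/\ lo < hi, alpha <= lo, c - h <= lo, hi <= beta & hi <= c + h].
  exists (Num.max alpha (c - h)), (Num.min beta (c + h)).
  split; rewrite ?le_max ?ge_min ?lexx ?orbT//.
  by rewrite gt_max !lt_min ab /=; apply/andP; split; [|apply/andP; split]; lra.
have [e [e_gt0 elo ee0]] : exists e, [/\ 0 < e, e <= (hi - lo) / 4 & e <= e0].
  exists (Num.min ((hi - lo) / 4) e0).
  by split; rewrite ?ge_min ?lexx ?orbT// lt_min e00 andbT; lra.
exists r, ((lo + hi) / 2), e, c0; split.
  by split => //; [rewrite r0|rewrite e_gt0 /= (le_trans ee0)].
split; [lra|lra| |].
  move=> t te; have := He0 t; rewrite gt_max => H.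
  by apply/andP/H; lra.
move=> t; rewrite ler_norml => /andP[t1 t2]; apply/ltW/Hh.
by rewrite /ball /= ltr_distl; apply/andP; split; lra.
Qed.

Lemma lowering_ge0 m e t : 0 < e <= 1 / 2 -> 0 < cos e -> `|t - m| <= e -> 0 <= lowering m e t.
Proof.
move=> /andP[e0 e1] ce0 tme.
have cc : cos e <= cos (t - m).
  move: tme; rewrite le_eqVlt => /orP[/eqP E|]; last first.
    by move=> ?; apply/ltW/cos_lt_abs => //; apply/andP; split; lra.
  rewrite -E; have [hh|hh] := ltP 0 (t - m); first by rewrite gtr0_norm.
  by rewrite ler0_norm// cosN.
by rewrite /lowering subr_ge0 ler_pdivlMr// mul1r.
Qed.

Lemma lowering_bounds m e t : 0 < e <= 1 / 2 -> 1 / 2 < cos e -> `|t - m| <= e ->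
  0 <= lowering m e t <= 1.
Proof.
move=> e01 ce tme; have ce0 : 0 < cos e by lra.
rewrite lowering_ge0//= lerBlDr ler_pdivrMr//; have := cos_le1 (t - m); lra.
Qed.

Definition lowering_primitive m e t : R := sin (t - m) / cos e - t.

Lemma is_derive_lowering_primitive m e t : is_derive t (1 : R) (lowering_primitive m e)
    (lowering m e t).
Proof. by apply: is_derive_eq; rewrite /lowering /GRing.scale /=; ring. Qed.

Lemma lowering_primitive_lt m e : 0 < e <= 1 / 2 -> 0 < cos e -> lowering_primitive m e (m
    - e) < lowering_primitive m e (m + e).
Proof.
move=> /andP[e0 e1] ce0; have me : m - e < m + e by lra.
have [||u uI E] := @MVT R (lowering_primitive m e) (lowering m e) _ _ me.
- by move=> u _; exact: is_derive_lowering_primitive.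
- by apply: continuous_subspaceT => u; exact: is_derive_cvg (is_derive_lowering_primitive m
    e u).
rewrite -subr_gt0 E; apply: mulr_gt0; last lra.
rewrite /lowering subr_gt0 ltr_pdivlMr// mul1r; apply: cos_lt_abs.
  by apply/andP; split; lra.
by move: uI; rewrite in_itv /= => /andP[? ?]; rewrite ltr_norml; apply/andP; split; lra.
Qed.

(** The derivative of K is the gain left over by [gain_pointwise], minus a constant that
    makes the inequality of [local_piece] strict everywhere on the arc. At the two ends
    [s * boundary_term] equals minus and plus the cost of the end triangles, so the
    increment of K pays for both and keeps half of the integral of the gain. *)
Lemma fan_exists x y z d alpha beta c :
  0 < z -> 0 <= d -> x ^+ 2 + y ^+ 2 < 1 -> alpha < beta -> alpha <= c <= beta ->
  3 * inv_slope' x y z c ^+ 2 - inv_slope x y z c ^+ 2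
    < d * inv_slope x y z c ^+ 2 * (inv_slope x y z c ^+ 2 + inv_slope' x y z c ^+ 2) ->
  exists r m e s K ns, [/\ alpha < m - e, m + e < beta & fan x y z d r m e s K ns].
Proof.
move=> z0 d0 xy1 ab cab Hc.
have [r [m [e [c0 [[/andP[r0 r1] xyr c00 e01] [am mb Hcos HE]]]]]] :=
  arc_exists z0 d0 xy1 ab cab Hc.
have /andP[e0 e1] := e01.
have zn := lt0r_neq0 z0.
have wlo t : (1 - r) / z <= inv_slope x y z t.
  by rewrite /inv_slope ler_pM2r ?invr_gt0//; have := cos_sin_le t r0 xyr; lra.
have whi t : inv_slope x y z t <= 2 / z.
  rewrite /inv_slope ler_pM2r ?invr_gt0//.
  have xyr' : (- x) ^+ 2 + (- y) ^+ 2 <= r ^+ 2 by rewrite !sqrrN.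
  by have := cos_sin_le t r0 xyr'; lra.
have w0 t : 0 < inv_slope x y z t.
  by apply: lt_le_trans (wlo t); rewrite divr_gt0// subr_gt0.
have ce : 1 / 2 < cos e by case: (Hcos e) => //; rewrite gtr0_norm//; lra.
have ce0 : 0 < cos e by lra.
have cn : cos e != 0 by rewrite gt_eqF.
have qb t := @lowering_bounds m e t e01 ce.
have [s [s0 s1 s2 s3]] : exists s, [/\ 0 < s, s <= 1 / 2,
    s <= c0 * z ^+ 3 / 24 & s <= (1 - r) / 4].
  exists (Num.min (1 / 2) (Num.min (c0 * z ^+ 3 / 24) ((1 - r) / 4))).
  split; rewrite ?ge_min ?lexx ?orbT//.
  rewrite !lt_min; apply/andP; split; first lra.
  by apply/andP; split; [rewrite divr_gt0// mulr_gt0// exprn_gt0|lra].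
have qw t : `|t - m| <= e -> 2 * s / z * lowering m e t < inv_slope x y z t.
  move=> /qb /andP[q0 q1]; apply: lt_le_trans (wlo t).
  apply: (@le_lt_trans _ _ (2 * s / z)).
    by rewrite ler_piMr// divr_ge0 ?mulr_ge0 ?ltW.
  by rewrite ltr_pM2r ?invr_gt0//; lra.
have s1' : 0 < 1 - s by lra.
have sg2 : s / ((1 - s) * z) <= 2 * s / z.
  rewrite ler_pdivrMr ?mulr_gt0//.
  have -> : 2 * s / z * ((1 - s) * z) = s * (2 * (1 - s)) by field.
  rewrite -subr_ge0 (_ : _ - s = s * (1 - 2 * s)); last by ring.
  by apply: mulr_ge0; lra.
have [kap [kap0 kapE]] : exists kap, 0 < kap /\ kap = z * s * c0 / 2.
  by exists (z * s * c0 / 2); rewrite divr_gt0// !mulr_gt0.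
have Qlt := @lowering_primitive_lt m e e01 ce0.
(* a slack [tau], small enough for half of the gain to survive *)
have [tau [tau0 tauE]] : exists tau, 0 < tau /\
    tau * (m + e) - tau * (m - e) = kap * (lowering_primitive m e (m + e) -
        lowering_primitive m e (m - e)) / 2.
  exists (kap * (lowering_primitive m e (m + e) - lowering_primitive m e (m - e)) / (4 * e)).
  split; first by rewrite divr_gt0 ?mulr_gt0 ?subr_gt0.
  by field; exact: lt0r_neq0.
pose K t := s * boundary_term x y z d m e t + kap * lowering_primitive m e t - tau * t.
have dK t : is_derive t (1 : R) K
   (s * (z * ((1 + lowering m e t) * sector_energy d (inv_slope x y z t) +
    lowering m e t * (sector_energy' d (inv_slope x y z t) * (1 / z - inv_slope x y z t) +
      sector_energy'' d (inv_slope x y z t) * inv_slope' x y z t ^+ 2))) + kap * lowering m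
          e t - tau).
  have dB := is_derive_boundary_term x y m e t d0 zn.
  have dQ := is_derive_lowering_primitive m e t.
  by apply: is_derive_eq; rewrite /GRing.scale /=; ring.
have [||ns cns lns] := @straddle_chain R (piece x y z d ((1 - s) * x + s * (cos m / cos e))
    ((1 - s) * y + s * (sin m / cos e)) ((1 - s) * z) K) (m - e) (m + e).
- lra.
- move=> t /andP[t1 t2].
  have tme : `|t - m| <= e by rewrite ler_norml; apply/andP; split; lra.
  apply: (local_piece z0 d0 (w0 t) _ (dK t)); first by rewrite mulf_neq0 ?gt_eqF.
  rewrite inv_slope_lower_vertex ?gt_eqF//.
  have G := @gain_pointwise R x y z d s (lowering m e t) (inv_slope x y z t) (inv_slope' x
      y z t) c0
    z0 d0 _ (qb t tme) _ s2 (ltW (qw t tme)) (HE t tme).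
  have := G _ _; rewrite s0 s1 ltW//= whi -kapE => /(_ isT isT); lra.
exists r, m, e, s, K, ns; split => //.
split => //.
- by rewrite r0.
- by rewrite s0.
- by move=> t /Hcos[].
- move=> t tme; rewrite subr_gt0; apply: le_lt_trans (qw t tme).
  by apply: ler_wpM2r => //; have /andP[] := qb t tme.
have [q1 q2] := @lowering_end m e cn.
have B2 : boundary_term x y z d m e (m + e) = z * (sin e / cos e) * sector_energy d
    (inv_slope x y z (m + e)).
  by rewrite /boundary_term q2 /lowering' (_ : m + e - m = e); ring.
have B1 : boundary_term x y z d m e (m - e) = - (z * (sin e / cos e) * sector_energy d
    (inv_slope x y z (m - e))).
  by rewrite /boundary_term q1 /lowering' (_ : m - e - m = - e) ?sinN; ring.
have gain : 0 < kap * (lowering_primitive m e (m + e) - lowering_primitive m e (m - e)) by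
    rewrite mulr_gt0 ?subr_gt0.
rewrite /K B1 B2.
move: tauE gain; set A := sector_energy d _; set B := sector_energy d _; set q :=
    lowering_primitive m e (m + e).
set q' := lowering_primitive m e (m - e); set T := sin e / cos e => tauE gain.
rewrite -subr_gt0 (_ : _ - _ = kap * (q - q') - (tau * (m + e) - tau * (m - e))).
  by rewrite tauE; lra.
by ring.
Qed.

End fan_partition2.

(** * Geometry of the fan spanned by an arc *)

Section cone_geometry.
Context (R : realType).
Implicit Types (x y z t a b : R) (p q : R * R).

(** Twice the signed area of the triangle with vertices (x, y), (cos t, sin t) and p. *)
Definition side x y t p : R :=
  (cos t - x) * (p.2 - y) - (sin t - y) * (p.1 - x).

Definition ruling x y t (l : R) : R * R :=
  ((1 - l) * x + l * cos t, (1 - l) * y + l * sin t).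

(** The plane tangent along the ruling of angle t to the cone with vertex (x, y, -z). *)
Definition plane x y z t p : R := (p.1 * cos t + p.2 * sin t - 1) / inv_slope x y z t.

Definition seg p q (t : R) : R * R :=
  ((1 - t) * p.1 + t * q.1, (1 - t) * p.2 + t * q.2).

(** Rulings of increasing angle turn counterclockwise around (x, y) by less than a
    half-turn. *)
Definition thin_arc x y a b : Prop :=
  forall t t', a <= t -> t < t' -> t' <= b -> 0 < chord_det x y t t'.

Lemma side_ruling x y a b (l : R) : side x y a (ruling x y b l) = l * chord_det x y a b.
Proof. by rewrite /side /ruling /chord_det /=; ring. Qed.

Lemma side_seg x y t p q (l : R) :
  side x y t (seg p q l) = (1 - l) * side x y t p + l * side x y t q.
Proof. by rewrite /side /seg /=; ring. Qed.

Lemma plane_seg x y z t p q (l : R) :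
  plane x y z t (seg p q l) = (1 - l) * plane x y z t p + l * plane x y z t q.
Proof. by rewrite /plane /seg /=; ring. Qed.

(** The chord from angle a to angle b is at distance cos ((b - a) / 2) from the
    origin, so (x, y) lies on the inner side of it when the arc is short. *)
Lemma chord_det_gt0 x y (r : R) a b : 0 <= r -> x ^+ 2 + y ^+ 2 <= r ^+ 2 ->
  a < b -> b - a < 2 -> r < cos ((b - a) / 2) -> 0 < chord_det x y a b.
Proof.
move=> r0 xyr ab ba2 rc.
set h := (b - a) / 2; set m := (a + b) / 2.
have eb : b = m + h by rewrite /m /h; field.
have ea : a = m - h by rewrite /m /h; field.
have -> : chord_det x y a b = 2 * sin h * (cos h - (x * cos m + y * sin m)).
  have -> : chord_det x y a b = 2 * sin h *
      (cos h * (cos m ^+ 2 + sin m ^+ 2) - (x * cos m + y * sin m)).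
    by rewrite /chord_det {1 2}eb {1 2}ea cosB cosD sinB sinD; ring.
  by rewrite cos2Dsin2 mulr1.
have := cos_sin_le m r0 xyr; rewrite -/h in rc => H.
rewrite mulr_gt0 ?subr_gt0 ?(le_lt_trans H)// mulr_gt0// sin2_gt0//.
by apply/andP; split; rewrite /h; lra.
Qed.

Lemma ruling_Omega x y t (l : R) : x ^+ 2 + y ^+ 2 <= 1 -> 0 <= l <= 1 ->
  Omega R (ruling x y t l).
Proof.
move=> xy /andP[l0 l1]; rewrite /Omega /=.
have cs := cos2Dsin2 t.
have c1 : x * cos t + y * sin t <= 1.
  by apply: cos_sin_le => //; rewrite expr1n.
have -> : ((1 - l) * x + l * cos t) ^+ 2 + ((1 - l) * y + l * sin t) ^+ 2 =
  (1 - l) ^+ 2 * (x ^+ 2 + y ^+ 2) + l ^+ 2 * (cos t ^+ 2 + sin t ^+ 2) +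
  2 * ((1 - l) * l) * (x * cos t + y * sin t) by ring.
rewrite cs.
have h1 : (1 - l) ^+ 2 * (x ^+ 2 + y ^+ 2) <= (1 - l) ^+ 2 * 1.
  by rewrite ler_wpM2l ?sqr_ge0.
have h2 : 2 * ((1 - l) * l) * (x * cos t + y * sin t) <= 2 * ((1 - l) * l) * 1.
  by rewrite ler_wpM2l// !mulr_ge0// subr_ge0.
by nra.
Qed.

(** By the intermediate value theorem the side of p with respect to some ruling line
    vanishes. Thinness selects the half-line, and p lies in the disc. *)
Lemma fan_ruling x y a b p : x ^+ 2 + y ^+ 2 < 1 -> a < b ->
  thin_arc x y a b ->
  Omega R p -> 0 <= side x y a p -> side x y b p <= 0 ->
  exists t l, [/\ a <= t <= b, 0 <= l <= 1 & p = ruling x y t l].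
Proof.
move=> xy1 ab HD pO sa sb.
have [t tI st] : exists2 t, t \in `[a, b] & side x y t p = 0.
  apply: IVT; first exact: ltW.
  - apply: continuous_subspaceT => t.
    apply: (@is_derive_cvg R (fun t => side x y t p) t
      (- sin t * (p.2 - y) - cos t * (p.1 - x))).
    by apply: is_derive_eq; rewrite /GRing.scale /=; ring.
  - by rewrite ge_min le_max sa sb !orbT.
move: tI; rewrite in_itv /= => /andP[ta tb].
have cs := cos2Dsin2 t.
pose N := (cos t - x) ^+ 2 + (sin t - y) ^+ 2.
have N0 : 0 < N.
  rewrite lt_neqAle eq_sym addr_ge0 ?sqr_ge0// andbT; apply/negP => /eqP.
  move/eqP; rewrite /N paddr_eq0 ?sqr_ge0// !sqrf_eq0 !subr_eq0 => /andP[/eqP cx /eqP sy].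
  by move: xy1; rewrite -cx -sy cs ltxx.
pose l := ((cos t - x) * (p.1 - x) + (sin t - y) * (p.2 - y)) / N.
have Nn := lt0r_neq0 N0.
have p1 : p.1 - x = l * (cos t - x).
  apply: (mulfI Nn); rewrite [RHS]mulrA [N * l]mulrC divfK//.
  have -> : N * (p.1 - x) = ((cos t - x) * (p.1 - x) + (sin t - y) * (p.2 - y)) * (cos t - x)
     - (sin t - y) * side x y t p by rewrite /N /side; ring.
  by rewrite st mulr0 subr0.
have p2 : p.2 - y = l * (sin t - y).
  apply: (mulfI Nn); rewrite [RHS]mulrA [N * l]mulrC divfK//.
  have -> : N * (p.2 - y) = ((cos t - x) * (p.1 - x) + (sin t - y) * (p.2 - y)) * (sin t - y)
     + (cos t - x) * side x y t p by rewrite /N /side; ring.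
  by rewrite st mulr0 addr0.
have pE : p = ruling x y t l.
  rewrite [LHS]surjective_pairing /ruling; congr pair.
    by rewrite -[LHS](subrK x) p1; ring.
  by rewrite -[LHS](subrK y) p2; ring.
have l0 : 0 <= l.
  have [tE|tN] := eqVneq t a.
    move: sb; rewrite pE side_ruling tE => h.
    have D0 : 0 < chord_det x y a b by apply: HD.
    have e : chord_det x y b a = - chord_det x y a b by rewrite /chord_det; ring.
    by move: h; rewrite e mulrN oppr_le0 pmulr_lge0.
  have at' : a < t by rewrite lt_neqAle eq_sym tN.
  by move: sa; rewrite pE side_ruling pmulr_lge0//; exact: HD.
exists t, l; split => //; first by rewrite ta.
rewrite l0 /= leNgt; apply/negP => l1.
move: pO; rewrite /Omega /= pE /ruling /=.
have -> : ((1 - l) * x + l * cos t) ^+ 2 + ((1 - l) * y + l * sin t) ^+ 2 =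
  (1 - l) * (x ^+ 2 + y ^+ 2) + l * (cos t ^+ 2 + sin t ^+ 2) - l * (1 - l) * N.
  by rewrite /N; ring.
rewrite cs => H.
have h1 : 0 < (l - 1) * (1 - (x ^+ 2 + y ^+ 2)) by rewrite mulr_gt0// subr_gt0.
have h2 : 0 < l * (l - 1) * N.
  have l1' : 0 < l - 1 by rewrite subr_gt0.
  exact: (mulr_gt0 (mulr_gt0 (lt_trans ltr01 l1) l1') N0).
nra.
Qed.

(** The plane meets the cone along its own ruling and lies below it elsewhere; the
    gap is explicit. *)
Lemma plane_ruling x y z t b (l : R) : 0 < inv_slope x y z t -> z != 0 ->
  plane x y z t (ruling x y b l) =
  - ((1 - l) * z) - l * (1 - cos (b - t)) / inv_slope x y z t.
Proof.
move=> w0 z0; have wn := lt0r_neq0 w0; have sb := cosB b t.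
rewrite /plane /ruling /= sb.
have e : x * cos t + y * sin t = 1 - z * inv_slope x y z t by rewrite /inv_slope; field.
apply: (mulIf wn); rewrite divfK//.
have -> : ((1 - l) * x + l * cos b) * cos t + ((1 - l) * y + l * sin b) * sin t - 1 =
  (1 - l) * (x * cos t + y * sin t) + l * (cos b * cos t + sin b * sin t) - 1 by ring.
by rewrite e; field.
Qed.

Lemma plane_ruling_le x y z t b (l : R) : 0 < inv_slope x y z t -> z != 0 -> 0 <= l ->
  plane x y z t (ruling x y b l) <= - ((1 - l) * z).
Proof.
move=> w0 z0 l0; rewrite plane_ruling// gerBl.
by apply: divr_ge0; [apply: mulr_ge0 => //; rewrite subr_ge0 cos_le1|exact: ltW].
Qed.

Lemma plane_own_ruling x y z t (l : R) : 0 < inv_slope x y z t -> z != 0 ->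
  plane x y z t (ruling x y t l) = - ((1 - l) * z).
Proof. by move=> w0 z0; rewrite plane_ruling// subrr cos0 subrr mulr0 mul0r subr0. Qed.

End cone_geometry.

(** * Supporting planes of a graph containing a cone *)

Section convexity_in_coordinates.
Context (R : realType).
Implicit Types (u : R * R -> R) (p q : R * R).

Lemma convex_functionP (A : set (R * R)) u : convex_function A u <->
  forall p q (t : R), A p -> A q -> 0 <= t <= 1 ->
    u (seg p q t) <= (1 - t) * u p + t * u q.
Proof.
split=> [cu p q t Ap Aq /andP[t0 t1]|cu t p q /set_mem Ap /set_mem Aq].
  have := cu (Itv01 t0 t1) q p (mem_set Aq) (mem_set Ap).
  rewrite convRE /= /conv /= /seg => H.
  have -> : (1 - t) * u p + t * u q = t * u q + (1 - t) * u p by rewrite addrC.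
  apply: le_trans H; rewrite le_eqVlt; apply/orP; left; apply/eqP; congr u.
  by rewrite /GRing.scale /=; congr pair; rewrite addrC.
have := cu q p t%:num Aq Ap; rewrite ge0 le1 => /(_ isT).
rewrite convRE addrC; apply: le_trans; rewrite le_eqVlt; apply/orP; left; apply/eqP.
by congr u; rewrite /seg /conv /GRing.scale /=; congr pair; rewrite addrC.
Qed.

End convexity_in_coordinates.

Section directional.
Context (R : realType).

(** At a point where the affine minorant touches, both one-sided quotients squeeze a
    derivative to k. Where the derivative does not exist, the operator returns 0 and
    the bound on squares still holds. *)
Lemma derive_touch (f : R * R -> R) (p v : R * R) (k : R) :
  (\forall h \near (0 : R), f p + h * k <= f (h *: v + p)) ->
  ('D_v f p) ^+ 2 <= k ^+ 2.
Proof.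
move=> H; have [df|ndf] := pselect (derivable f p v); last first.
  have -> : 'D_v f p = 0; last by rewrite expr0n /= sqr_ge0.
  exact: (dvgP ndf).
suff -> : 'D_v f p = k by [].
have /cvgrPdist_lt dF : (fun h => h^-1 *: ((f \o shift p) (h *: v) - f p)) @ 0^' --> 'D_v f
    p by exact: df.
have pick (e : R) : 0 < e -> exists2 h : R, 0 < h &
   [/\ `|'D_v f p - h^-1 * (f (h *: v + p) - f p)| < e,
       `|'D_v f p - (- h)^-1 * (f (- h *: v + p) - f p)| < e,
       f p + h * k <= f (h *: v + p) & f p + - h * k <= f (- h *: v + p)].
  move=> e0; have [d /= d0 Hd] := dF e e0.
  move/nbhs_ballP : H => [d' /= d'0 Hd'].
  have [h [h0 hd hd']] : exists h, [/\ 0 < h, h < d & h < d'].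
    exists (Num.min d d' / 2).
    have : 0 < Num.min d d' by rewrite lt_min d0.
    have : Num.min d d' <= d by rewrite ge_min lexx.
    have : Num.min d d' <= d' by rewrite ge_min lexx orbT.
    by move=> *; split; lra.
  exists h => //; split.
  - by apply: Hd; rewrite /= ?sub0r ?normrN ?gtr0_norm// gt_eqF.
  - by apply: Hd; rewrite /= ?sub0r ?opprK ?normrN ?gtr0_norm// oppr_eq0 gt_eqF.
  - by apply: Hd'; rewrite /ball /= sub0r normrN gtr0_norm.
  - by apply: Hd'; rewrite /ball /= sub0r opprK gtr0_norm.
apply/eqP; rewrite eq_le; apply/andP; split; rewrite leNgt; apply/negP => lt.
  have [|h h0 [_ + _ hk]] := pick ('D_v f p - k); first by rewrite subr_gt0.
  have : (- h)^-1 * (f (- h *: v + p) - f p) <= k.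
    rewrite invrN mulNr -mulrN opprB ler_pdivrMl//; lra.
  move=> hh /ltr_normlP [_]; lra.
have [|h h0 [+ _ hk _]] := pick (k - 'D_v f p); first by rewrite subr_gt0.
have : k <= h^-1 * (f (h *: v + p) - f p).
  by rewrite ler_pdivlMl//; lra.
move=> hh /ltr_normlP [+ _]; lra.
Qed.
End directional.

Section cone_in_graph.
Context (R : realType).
Implicit Types (u : R * R -> R) (x y z t a b : R) (p q : R * R).

(** The standing hypotheses on u and its conical part, in Cartesian coordinates. *)
Record cone_in_graph u x y z alpha beta : Prop := ConeInGraph {
  cone_chat : Chat R u;
  cone_z : 0 < z;
  cone_xy : x ^+ 2 + y ^+ 2 < 1;
  cone_part : conical_part u x y z alpha beta }.

Lemma Omega_seg p q (s : R) : Omega R p -> Omega R q -> 0 <= s <= 1 ->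
  Omega R (seg p q s).
Proof.
move=> + + /andP[s0 s1]; rewrite /Omega /seg /=.
case: p => A1 A2; case: q => B1 B2 /= H1 H2.
have e : ((1 - s) * A1 + s * B1) ^+ 2 + ((1 - s) * A2 + s * B2) ^+ 2 =
  (1 - s) * (A1 ^+ 2 + A2 ^+ 2) + s * (B1 ^+ 2 + B2 ^+ 2) -
    (s * (1 - s)) * ((A1 - B1) ^+ 2 + (A2 - B2) ^+ 2) by ring.
rewrite e.
have e1 : (1 - s) * (A1 ^+ 2 + A2 ^+ 2) <= (1 - s) * 1 by rewrite ler_wpM2l ?subr_ge0.
have e2 : s * (B1 ^+ 2 + B2 ^+ 2) <= s * 1 by rewrite ler_wpM2l.
have e3 : 0 <= (s * (1 - s)) * ((A1 - B1) ^+ 2 + (A2 - B2) ^+ 2).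
  by rewrite mulr_ge0 ?addr_ge0 ?sqr_ge0// mulr_ge0 ?subr_ge0.
lra.
Qed.

Lemma inv_slope_gt0 x y z t : 0 < z -> x ^+ 2 + y ^+ 2 < 1 -> 0 < inv_slope x y z t.
Proof.
move=> z0 xy1; have [r [r0 r1 xyr]] := radius_exists xy1.
by rewrite divr_gt0//; have := cos_sin_le t r0 xyr; lra.
Qed.

Lemma cone_ruling u x y z alpha beta t (l : R) :
  cone_in_graph u x y z alpha beta -> alpha <= t <= beta -> 0 <= l <= 1 ->
  u (ruling x y t l) = - ((1 - l) * z).
Proof. by move=> [_ _ _ H] tab l01; exact: H. Qed.

Lemma thin_arc_exists x y t alpha beta : x ^+ 2 + y ^+ 2 < 1 -> alpha < t < beta ->
  exists a b, [/\ alpha <= a, a < t, t < b, b <= beta & thin_arc x y a b].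
Proof.
move=> xy1 /andP[at' tb].
have [r [r0 r1 xyr]] := radius_exists xy1.
have [e0 /andP[e00 e01] He0] := small_arc r1.
have [h [h0 he ha hb]] : exists h, [/\ 0 < h, h <= e0, h <= t - alpha & h <= beta - t].
  exists (Num.min e0 (Num.min (t - alpha) (beta - t))).
  by split; rewrite ?ge_min ?lexx ?orbT// !lt_min e00 !subr_gt0 at'.
exists (t - h), (t + h); split; try lra.
move=> t1 t2 h1 h12 h2; apply: (chord_det_gt0 r0 xyr) => //; first lra.
by apply: He0; rewrite ger0_norm; lra.
Qed.

(** Over the fan the graph of u is the cone itself. *)
Lemma fan_graph_ge_plane u x y z alpha beta a b t p :
  cone_in_graph u x y z alpha beta -> alpha <= a -> a < b -> b <= beta ->
  thin_arc x y a b ->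
  Omega R p -> 0 <= side x y a p -> side x y b p <= 0 -> plane x y z t p <= u p.
Proof.
move=> C aa ab bb HD pO sa sb.
have [t' [l [/andP[t1 t2] l01 pE]]] := fan_ruling (cone_xy C) ab HD pO sa sb.
rewrite pE (cone_ruling C)//; last by apply/andP; split; lra.
apply: plane_ruling_le; [exact: inv_slope_gt0 (cone_z C) (cone_xy C)| |by case/andP: l01].
exact/lt0r_neq0/(cone_z C).
Qed.

(** The inequality holds in the fan, hence near an interior point of the ruling,
    where it is an equality; convexity of u along segments from that point extends it
    to the whole disc. *)
Lemma cone_subgradient u x y z alpha beta t p :
  cone_in_graph u x y z alpha beta -> alpha < t < beta -> Omega R p ->
  plane x y z t p <= u p.
Proof.
move=> C tab pO.
have [a [b [aa at' tb bb HD]]] := thin_arc_exists (cone_xy C) tab.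
pose p0 := ruling x y t (1 / 2).
have h12 : 0 <= (1 / 2 : R) <= 1 by apply/andP; split; lra.
have p0O : Omega R p0 by apply: ruling_Omega => //; exact/ltW/(cone_xy C).
have sa0 : 0 < side x y a p0 by rewrite side_ruling mulr_gt0 ?HD//; lra.
have sb0 : side x y b p0 < 0.
  rewrite side_ruling -oppr_gt0 -mulrN.
  have -> : - chord_det x y b t = chord_det x y t b by rewrite /chord_det; ring.
  by rewrite mulr_gt0 ?HD//; lra.
(* a point of the segment from p0 to p that still lies in the fan *)
have small (A B : R) : 0 < A -> exists2 s, 0 < s <= 1 &
    forall s', 0 <= s' <= s -> 0 <= (1 - s') * A + s' * B.
  move=> A0; have K : 0 < A + `|B| by rewrite ltr_pwDl.
  exists (A / (A + `|B|)).
    by rewrite divr_gt0//= ler_pdivrMr// mul1r lerDl.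
  move=> s' /andP[s0]; rewrite ler_pdivlMr// => sK.
  have := ler_norm (- B); rewrite normrN => nB.
  have : s' * - B <= s' * `|B| by rewrite ler_wpM2l.
  lra.
have [s1 /andP[s10 s11] Hs1] := small _ (side x y a p) sa0.
have [|s2 /andP[s20 s21] Hs2] := small (- side x y b p0) (- side x y b p).
  by rewrite oppr_gt0.
have [s [s0 ss1 ss2]] : exists s, [/\ 0 < s, s <= s1 & s <= s2].
  exists (Num.min s1 s2).
  by split; rewrite ?ge_min ?lexx ?orbT// lt_min s10.
have s1' : s <= 1 by lra.
have qO : Omega R (seg p0 p s) by apply: Omega_seg => //; rewrite ltW.
have := @fan_graph_ge_plane u x y z alpha beta a b t (seg p0 p s) C aa
  (lt_trans at' tb) bb HD qO.
rewrite !side_seg => H.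
have {}H : plane x y z t (seg p0 p s) <= u (seg p0 p s).
  apply: H; first by apply: Hs1; rewrite ltW.
  by rewrite -oppr_ge0 opprD -!mulrN; apply: Hs2; rewrite ltW.
have [_ cu _] := cone_chat C.
have s01 : 0 <= s <= 1 by rewrite ltW.
have := (convex_functionP _ _).1 cu p0 p s p0O pO s01.
have up0 : u p0 = plane x y z t p0.
  rewrite plane_own_ruling; last exact/lt0r_neq0/(cone_z C).
    by rewrite (cone_ruling C)//; case/andP: tab => ? ?; rewrite !ltW.
  exact: inv_slope_gt0 (cone_z C) (cone_xy C).
rewrite up0 => H2; move: (le_trans H H2); rewrite plane_seg lerD2l.
by rewrite ler_pM2l.
Qed.

End cone_in_graph.

(** * The integrand on the cone *)

Section energy_density.
Context (R : realType).
Implicit Types (u : R * R -> R) (x y z t a b d g w : R) (p q : R * R).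

Definition density d g : \bar R := ((g%:E + d%:E)^-1)%E.

Lemma density_ge0 d g : 0 <= d -> 0 <= g -> (0 <= density d g)%E.
Proof. by move=> d0 g0; rewrite /density inve_ge0 -EFinD lee_fin addr_ge0. Qed.

Lemma grad_norm2_ge0 u p : 0 <= grad_norm2 u p.
Proof. by rewrite /grad_norm2 addr_ge0 ?sqr_ge0. Qed.

Lemma le_density d g g' : 0 <= d -> 0 <= g -> g <= g' -> (density d g' <= density d g)%E.
Proof.
move=> d0 g0 gg'; have g'0 := le_trans g0 gg'.
rewrite /density lee_pV2 ?inE -?EFinD ?lee_fin ?lerD2r// addr_ge0//.
Qed.

Lemma density_slope d w : 0 <= d -> 0 < w -> density d (w ^- 2) = (slope_density d w)%:E.
Proof.
move=> d0 w0; rewrite /density -EFinD inver.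
have W2 : 0 < w ^+ 2 by rewrite exprn_gt0.
have pos : 0 < w ^- 2 + d by rewrite ltr_pwDl// invr_gt0.
rewrite gt_eqF//; congr EFin; rewrite /slope_density.
have D := lt0r_neq0 (den_gt0 w d0).
have wn := lt0r_neq0 w0.
have -> : w ^- 2 + d = (1 + d * w ^+ 2) / w ^+ 2 by field.
by rewrite invf_div.
Qed.

Lemma interior_Omega_near p (v : R * R) : p.1 ^+ 2 + p.2 ^+ 2 < 1 ->
  \forall h \near (0 : R), Omega R (h *: v + p).
Proof.
move=> p1.
have c : (fun h : R => (h * v.1 + p.1) ^+ 2 + (h * v.2 + p.2) ^+ 2) h @[h --> (0 : R)]
   --> (0 * v.1 + p.1) ^+ 2 + (0 * v.2 + p.2) ^+ 2.
  apply: (@is_derive_cvg R (fun h : R => (h * v.1 + p.1) ^+ 2 + (h * v.2 + p.2) ^+ 2) 0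
    (2 * v.1 * p.1 + 2 * v.2 * p.2)).
  by apply: is_derive_eq; rewrite /GRing.scale /=; ring.
have p1' : (0 * v.1 + p.1) ^+ 2 + (0 * v.2 + p.2) ^+ 2 < 1 by rewrite !mul0r !add0r.
have nF : \forall h \near (0 : R), (h * v.1 + p.1) ^+ 2 + (h * v.2 + p.2) ^+ 2 < 1.
  exact: (cvgr_lt _ c _ p1').
apply: filterS nF => h /= H.
by rewrite /Omega /=; exact: ltW.
Qed.

(** The tangent plane of the cone touches the graph of u from below along the
    ruling, which determines every partial derivative that exists. This bounds the
    integrand from below, the direction that [cone_lower_bound] needs. *)
Lemma cone_grad_le u x y z alpha beta t (l : R) :
  cone_in_graph u x y z alpha beta -> alpha < t < beta -> 0 <= l <= 1 ->
  (ruling x y t l).1 ^+ 2 + (ruling x y t l).2 ^+ 2 < 1 ->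
  grad_norm2 u (ruling x y t l) <= (inv_slope x y z t) ^- 2.
Proof.
move=> C tab l01 pI; set p := ruling x y t l.
have w0 := inv_slope_gt0 t (cone_z C) (cone_xy C); have wn := lt0r_neq0 w0.
have up : u p = plane x y z t p.
  rewrite plane_own_ruling//; last exact/lt0r_neq0/(cone_z C).
  by rewrite (cone_ruling C)//; case/andP: tab => ? ?; rewrite !ltW.
have touch (v : R * R) :
    ('D_v u p) ^+ 2 <= ((v.1 * cos t + v.2 * sin t) / inv_slope x y z t) ^+ 2.
  apply: derive_touch; have := interior_Omega_near v pI.
  apply: filterS => h hO; apply: le_trans (cone_subgradient C tab hO).
  rewrite up le_eqVlt; apply/orP; left; apply/eqP; rewrite /plane /=.
  by rewrite /GRing.scale /=; field.
have cs := cos2Dsin2 t.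
rewrite /grad_norm2 (le_trans (lerD (touch _) (touch _)))//=.
rewrite le_eqVlt; apply/orP; left; apply/eqP.
transitivity ((cos t ^+ 2 + sin t ^+ 2) / inv_slope x y z t ^+ 2); first by field.
by rewrite cs div1r.
Qed.

Lemma cone_density_ge u x y z alpha beta a b d mu p :
  cone_in_graph u x y z alpha beta -> 0 <= d -> alpha < a -> a < b -> b < beta ->
  thin_arc x y a b -> (forall t, a <= t <= b -> mu <= slope_density d (inv_slope x y z t)) ->
  p.1 ^+ 2 + p.2 ^+ 2 < 1 -> 0 <= side x y a p -> side x y b p <= 0 ->
  (mu%:E <= density d (grad_norm2 u p))%E.
Proof.
move=> C d0 aa ab bb HD Hmu pI sa sb.
have [t [l [tab l01 pE]]] := fan_ruling (cone_xy C) ab HD (ltW pI) sa sb.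
apply: (@le_trans _ _ (slope_density d (inv_slope x y z t))%:E); first by rewrite lee_fin Hmu.
rewrite -density_slope//; last exact: inv_slope_gt0 (cone_z C) (cone_xy C).
apply: le_density => //; first exact: grad_norm2_ge0.
rewrite pE in pI *; apply: (cone_grad_le C) => //.
by case/andP: tab => ? ?; apply/andP; split; lra.
Qed.

End energy_density.

(** * Lower bound for the energy of the cone *)

Section lower_bound.
Context (R : realType).
Implicit Types (u : R * R -> R) (x y z t a b c d : R) (p q : R * R).
Local Notation mu2 := (@lebesgue_measure R \x @lebesgue_measure R)%E.

Definition open_fan x y a b : set (R * R) :=
  [set p | [/\ p.1 ^+ 2 + p.2 ^+ 2 < 1, 0 < side x y a p & side x y b p < 0]].

(** The open triangle with vertices (x, y) and the points of the unit circle of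
    angles a and c. *)
Definition fan_triangle x y a c : set (R * R) :=
  [set p | [/\ 0 < side x y a p, side x y c p < 0 &
               side x y a p - side x y c p < chord_det x y a c]].

(** The Pluecker relation between the directions of three rulings and of p. *)
Lemma side_pluecker x y a b c p :
  side x y a p * chord_det x y c b = side x y c p * chord_det x y a b - side x y b p *
      chord_det x y a c.
Proof. by rewrite /side /chord_det; ring. Qed.

Lemma chord_detC x y a b : chord_det x y a b = - chord_det x y b a.
Proof. by rewrite /chord_det; ring. Qed.

Lemma fan_triangle_area x y a c : 0 < chord_det x y a c ->
  measurable (fan_triangle x y a c) /\
  mu2 (fan_triangle x y a c) = (chord_det x y a c / 2)%:E.
Proof.
set D := chord_det x y a c => D0; have Dn := lt0r_neq0 D0.
have det : (- (sin a - y) / D) * (- (cos c - x) / D) -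
    ((cos a - x) / D) * ((sin c - y) / D) = - D^-1.
  rewrite (_ : _ - _ = - (chord_det x y a c / D ^+ 2)); last first.
    by rewrite /chord_det; field.
  by rewrite -/D; congr (- _); field.
have det0 : (- (sin a - y) / D) * (- (cos c - x) / D) -
    ((cos a - x) / D) * ((sin c - y) / D) != 0.
  by rewrite det oppr_eq0 invr_eq0.
(* [side] at a and c, divided by D, map the triangle to the standard one *)
have [m e] := @mu2_open_triangle R (- (sin a - y) / D) ((cos a - x) / D)
  (((sin a - y) * x - (cos a - x) * y) / D)
  ((sin c - y) / D) (- (cos c - x) / D)
  ((- (sin c - y) * x + (cos c - x) * y) / D) det0.
have E : fan_triangle x y a c = [set p : R * R | [/\
   0 < - (sin a - y) / D * p.1 + (cos a - x) / D * p.2 +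
     ((sin a - y) * x - (cos a - x) * y) / D,
   0 < (sin c - y) / D * p.1 + - (cos c - x) / D * p.2 +
     (- (sin c - y) * x + (cos c - x) * y) / D &
   - (sin a - y) / D * p.1 + (cos a - x) / D * p.2 +
     ((sin a - y) * x - (cos a - x) * y) / D +
   ((sin c - y) / D * p.1 + - (cos c - x) / D * p.2 +
     (- (sin c - y) * x + (cos c - x) * y) / D) < 1]].
  apply/seteqP; split => p; rewrite /fan_triangle /mkset /=;
  rewrite (_ : - (sin a - y) / D * p.1 + (cos a - x) / D * p.2 +
     ((sin a - y) * x - (cos a - x) * y) / D = side x y a p / D);
    do ?[by rewrite /side; field];
  rewrite (_ : (sin c - y) / D * p.1 + - (cos c - x) / D * p.2 +
     (- (sin c - y) * x + (cos c - x) * y) / D = - side x y c p / D);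
    do ?[by rewrite /side; field];
  rewrite -mulrDl !pmulr_lgt0 ?invr_gt0// ltr_pdivrMr// mul1r oppr_gt0 => -[? ? ?]; by split.
rewrite E; split=> //; rewrite e det normrN normfV gtr0_norm//.
by congr EFin; field.
Qed.

Lemma fan_triangle_sub x y a b c : x ^+ 2 + y ^+ 2 < 1 -> a < c -> c <= b ->
  thin_arc x y a b -> fan_triangle x y a c `<=` open_fan x y a b.
Proof.
move=> xy1 ac cb HD p [sa sc sD].
have D0 : 0 < chord_det x y a c by apply: HD.
have Dab : 0 < chord_det x y a b by apply: HD => //; exact: lt_le_trans cb.
split => //; last first.
  have := side_pluecker x y b a c p.
  move: cb; rewrite le_eqVlt => /orP[/eqP <-//|cb].
  have Dcb : 0 < chord_det x y c b by apply: HD => //; exact: ltW.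
  rewrite (chord_detC x y c a) (chord_detC x y b a) (chord_detC x y b c) => H.
  have h1 : 0 < - side x y c p * chord_det x y a b by rewrite mulr_gt0// oppr_gt0.
  have h2 : 0 < side x y a p * chord_det x y c b by rewrite mulr_gt0.
  rewrite -(pmulr_llt0 _ D0); lra.
(* p is a convex combination of the vertex and two points of the circle, in
   which the vertex has a positive weight *)
set D := chord_det x y a c in sD D0 *; have Dn := lt0r_neq0 D0.
pose A := - side x y c p / D; pose B := side x y a p / D.
have A0 : 0 < A by rewrite divr_gt0 ?oppr_gt0.
have B0 : 0 < B by rewrite divr_gt0.
have AB1 : 0 < 1 - A - B.
  by rewrite /A /B -addrA -opprD -mulrDl subr_gt0 ltr_pdivrMr//; lra.
have p1 : p.1 = (1 - A - B) * x + A * cos a + B * cos c.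
  by rewrite /A /B; apply: (mulIf Dn); rewrite /side /D /chord_det; field; exact: Dn.
have p2 : p.2 = (1 - A - B) * y + A * sin a + B * sin c.
  by rewrite /A /B; apply: (mulIf Dn); rewrite /side /D /chord_det; field; exact: Dn.
have ca := cos2Dsin2 a; have cc := cos2Dsin2 c.
have id : p.1 ^+ 2 + p.2 ^+ 2 = (1 - A - B) * (x ^+ 2 + y ^+ 2) +
   A * (cos a ^+ 2 + sin a ^+ 2) + B * (cos c ^+ 2 + sin c ^+ 2) -
   (1 - A - B) * A * ((x - cos a) ^+ 2 + (y - sin a) ^+ 2) -
   (1 - A - B) * B * ((x - cos c) ^+ 2 + (y - sin c) ^+ 2) -
   A * B * ((cos a - cos c) ^+ 2 + (sin a - sin c) ^+ 2).
  by rewrite p1 p2; ring.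
rewrite id ca cc.
have h1 : (1 - A - B) * (x ^+ 2 + y ^+ 2) < (1 - A - B) * 1 by rewrite ltr_pM2l.
have sq (e f g h k : R) : 0 < k -> 0 <= k * ((e - f) ^+ 2 + (g - h) ^+ 2).
  by move=> k0; rewrite mulr_ge0 ?addr_ge0 ?sqr_ge0// ltW.
have h2 := sq x (cos a) y (sin a) _ (mulr_gt0 AB1 A0).
have h3 := sq x (cos c) y (sin c) _ (mulr_gt0 AB1 B0).
have h4 := sq (cos a) (cos c) (sin a) (sin c) _ (mulr_gt0 A0 B0).
lra.
Qed.

Lemma open_fan_sub x y a b c : a < c -> c <= b ->
  thin_arc x y a b -> open_fan x y c b `<=` open_fan x y a b.
Proof.
move=> ac cb HD p [p1 sc sb]; split => //.
have D0 : 0 < chord_det x y a c by apply: HD.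
have Dab : 0 < chord_det x y a b by apply: HD => //; exact: lt_le_trans cb.
move: cb; rewrite le_eqVlt => /orP[/eqP E|cb].
  by move: sc; rewrite E ltNge ltW.
have Dcb : 0 < chord_det x y c b by apply: HD => //; exact: ltW.
have := side_pluecker x y a b c p => H.
have h1 : 0 < - side x y b p * chord_det x y a c by rewrite mulr_gt0// oppr_gt0.
have h2 : 0 < side x y c p * chord_det x y a b by rewrite mulr_gt0.
rewrite -(pmulr_lgt0 _ Dcb) H; lra.
Qed.

Fixpoint chain_sum (L : R -> R -> R) a (ns : seq R) : R :=
  if ns is c :: ns' then L a c + chain_sum L c ns' else 0.

Lemma chain_last_ge (P : R -> R -> Prop) a ns : chain P a ns -> a <= last a ns.
Proof.
elim: ns a => //= c ns IH a [ac _ /IH]; apply: le_trans; exact: ltW.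
Qed.

(** The triangles spanned by consecutive nodes are disjoint subsets of the fan, of area
    [chord_det / 2], on which the integrand is at least the number mu of each piece. *)
Lemma cone_lower_bound u x y z alpha beta d x1 y1 z1 K a ns :
  cone_in_graph u x y z alpha beta -> 0 <= d -> alpha < a -> last a ns < beta ->
  thin_arc x y a (last a ns) -> chain (piece x y z d x1 y1 z1 K) a ns ->
  ((chain_sum (fun a b => z1 * tan_half (b - a) *
       (sector_energy d (inv_slope x1 y1 z1 a) + sector_energy d (inv_slope x1 y1 z1 b)) +
           (K b - K a)) a ns / 2)%:E
   <= \int[mu2]_(p in open_fan x y a (last a ns)) density d (grad_norm2 u p))%E.
Proof.
move=> C d0; elim: ns a => [|c ns IH] a /= aa lb HD.
  by move=> _; rewrite mul0r integral_ge0// => p _; apply: density_ge0 => //; exact: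
      grad_norm2_ge0.
move=> [ac [mu [mu0 Hmu Hpiece]] cn].
have cb := chain_last_ge cn; set b := last c ns in lb HD cb *.
have nn (A : set (R * R)) p : A p -> (0 <= density d (grad_norm2 u p))%E.
  by move=> _; apply: density_ge0 => //; exact: grad_norm2_ge0.
have D0 : 0 < chord_det x y a c by apply: HD.
have [mT eT] := fan_triangle_area D0.
have TW := fan_triangle_sub (cone_xy C) ac cb HD.
have WW := open_fan_sub ac cb HD.
rewrite (ge0_integral_split mu2 mT (@nn (open_fan x y a b))).
rewrite mulrDl EFinD; apply: leeD.
  rewrite (setIidr TW).
  apply: (@le_trans _ _ (mu%:E * mu2 (fan_triangle x y a c))%E).
    by rewrite eT -EFinM lee_fin [mu * _]mulrA ler_wpM2r.
  apply: cst_le_integral => // p [sa sc sD].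
  have [pI _ _] := TW p (And3 sa sc sD).
  apply: (@cone_density_ge R u x y z alpha beta a c d mu p C d0 aa ac _ _ Hmu pI).
  - exact: le_lt_trans lb.
  - by move=> t t' at' tt' tc'; apply: HD => //; exact: le_trans cb.
  - exact: ltW.
  - exact: ltW.
apply: le_trans (IH c _ _ _ cn) _.
- exact: lt_trans ac.
- exact: lb.
- by move=> t t' ct tt' tb; apply: HD => //; apply: le_trans ct; exact: ltW.
apply: ge0_integral_subset => [p Wp|p [Wp _]]; last exact: nn Wp.
split; first exact: WW.
by move=> [_ sc _]; move: Wp => [_ + _]; rewrite ltNge (ltW sc).
Qed.

End lower_bound.

(** * Gluing convex functions *)

Section glue.
Context (R : realType).
Implicit Types (u m : R * R -> R) (p q r : R * R).

Definition glue (D : set (R * R)) m u p : R := if p \in D then m p else u p.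

Lemma glue_in D m u p : D p -> glue D m u p = m p.
Proof. by move=> Dp; rewrite /glue mem_set. Qed.

Lemma glue_out D m u p : ~ D p -> glue D m u p = u p.
Proof. by move=> Dp; rewrite /glue memNset. Qed.

Lemma segC p q (t : R) : seg p q t = seg q p (1 - t).
Proof. by rewrite /seg; congr pair; ring. Qed.

Lemma seg_seg p q (s t : R) : s <= t -> t <= 1 -> exists2 k, 0 <= k <= 1 &
  1 - t = (1 - k) * (1 - s) /\ seg p q t = seg (seg p q s) q k.
Proof.
move=> st t1; have [s1|s1] := eqVneq s 1.
  exists 0; first by rewrite lexx ler01.
  have -> : t = 1 by apply/eqP; rewrite eq_le t1 -s1.
  by rewrite s1; split; rewrite ?/seg /=; [ring|congr pair; ring].
have s1' : 0 < 1 - s by rewrite subr_gt0 lt_neqAle s1 (le_trans st).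
have sn := lt0r_neq0 s1'.
exists ((t - s) / (1 - s)).
  apply/andP; split; first by apply: divr_ge0; [rewrite subr_ge0|exact: ltW].
  by rewrite ler_pdivrMr// mul1r lerB.
by split; rewrite ?/seg /=; [|congr pair]; field.
Qed.

(** On a segment that starts in D and leaves it, m is convex up to the exit point,
    where u <= m, and u is convex after it. Elsewhere convexity comes from m <= u,
    from convexity of D, or from convexity of u. *)
Lemma glue_convex D m u :
  (forall p q (t : R), Omega R p -> Omega R q -> 0 <= t <= 1 ->
     u (seg p q t) <= (1 - t) * u p + t * u q) ->
  (forall p q (t : R), 0 <= t <= 1 -> m (seg p q t) <= (1 - t) * m p + t * m q) ->
  (forall p, Omega R p -> m p <= u p) ->
  (forall p q (t : R), D p -> D q -> 0 <= t <= 1 -> D (seg p q t)) ->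
  (forall p q, D p -> Omega R q -> ~ D q -> exists s, [/\ 0 <= s <= 1,
      u (seg p q s) <= m (seg p q s) & forall t, 0 <= t <= s -> D (seg p q t)]) ->
  (forall p, D p -> Omega R p) ->
  forall p q (t : R), Omega R p -> Omega R q -> 0 <= t <= 1 ->
    glue D m u (seg p q t) <= (1 - t) * glue D m u p + t * glue D m u q.
Proof.
move=> cu cm mu cD crossing DO.
have mv p : Omega R p -> m p <= glue D m u p.
  by rewrite /glue; case: ifPn => // _; exact: mu.
have vu p : Omega R p -> glue D m u p <= u p.
  by rewrite /glue; case: ifPn => // _; exact: mu.
have key p q (t : R) : D p -> Omega R q -> ~ D q -> ~ D (seg p q t) -> 0 <= t <= 1 ->
    u (seg p q t) <= (1 - t) * m p + t * u q.
  move=> Dp Oq nDq nDt /andP[t0 t1].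
  have [s [/andP[s0 s1] um Hs]] := crossing p q Dp Oq nDq.
  have st : s <= t.
    by rewrite leNgt; apply/negP => ts; apply: nDt; apply: Hs; rewrite t0 ltW.
  have [k k01 [kE ->]] := seg_seg p q st t1.
  have Os : Omega R (seg p q s) by apply: DO; apply: Hs; rewrite s0 lexx.
  apply: le_trans (cu _ _ _ Os Oq k01) _; have /andP[k0 k1] := k01.
  have h1 : (1 - k) * u (seg p q s) <= (1 - k) * ((1 - s) * m p + s * u q).
    apply: ler_wpM2l; first by rewrite subr_ge0.
    apply: le_trans um _; apply: le_trans (cm _ _ _ _) _; first by rewrite s0.
    by rewrite lerD2l ler_wpM2l// mu.
  apply: le_trans (lerD h1 (lexx _)) _.
  have -> : (1 - k) * ((1 - s) * m p + s * u q) + k * u q =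
    (1 - k) * (1 - s) * m p + (1 - (1 - k) * (1 - s)) * u q by ring.
  by rewrite -kE (_ : 1 - (1 - t) = t); last ring.
move=> p q t Op Oq t01; have /andP[t0 t1] := t01.
have [Dpt|nDt] := pselect (D (seg p q t)).
  rewrite glue_in//; apply: le_trans (cm _ _ _ t01) _.
  by apply: lerD; apply: ler_wpM2l; rewrite ?subr_ge0// mv.
rewrite [leLHS]glue_out//.
have [Dp|nDp] := pselect (D p); have [Dq|nDq] := pselect (D q).
- by case: nDt; exact: cD.
- rewrite (glue_in _ _ Dp) (glue_out _ _ nDq); exact: key.
- rewrite (glue_in _ _ Dq) (glue_out _ _ nDp) segC.
  have := key q p (1 - t) Dq Op nDp; rewrite -segC (_ : 1 - (1 - t) = t); last ring.
  by rewrite [(1 - t) * u p + _]addrC; apply => //; apply/andP; split; lra.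
- rewrite (glue_out _ _ nDp) (glue_out _ _ nDq); exact: cu.
Qed.

(** Near a point of D the glued function is at least m, which is continuous; near the
    other points it is u. *)
Lemma glue_lsc D m u :
  lower_semicontinuous ((fun p => (u p)%:E) : subspace (Omega R) -> \bar R) ->
  (forall p, {for p, continuous m}) -> (forall p, Omega R p -> m p <= u p) ->
  (forall p, Omega R p -> ~ D p -> \forall q \near p, ~ D q) ->
  lower_semicontinuous ((fun p => (glue D m u p)%:E) : subspace (Omega R) -> \bar R).
Proof.
move=> lu cm mu oD p a.
have comb (q : R * R) (V : set (R * R)) : nbhs q (fun r => Omega R r -> V r) ->
    nbhs q (fun r => ~ D r) ->
    nbhs q (fun r => Omega R r -> [/\ Omega R r, V r & ~ D r]).
  move=> nV nD; have FF : Filter (nbhs q) by exact: nbhs_filter.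
  have nI := @filterI _ (nbhs q) FF _ _ nV nD.
  by apply: filterS nI => r /= [VO nDr] Or; split => //; exact: VO.
have nbm (q : R * R) (c : R) : c < m q -> \forall r \near q, c < m r.
  by move=> cq; exact: (cvgr_gt _ (cm q) _ cq).
have [Op|nOp] := pselect (Omega R p); last first.
  move=> av; exists [set p] => [|q ->//].
  by rewrite /nbhs /= -nbhs_subspace_out.
have [Dp|nDp] := pselect (D p).
  rewrite glue_in// lte_fin => am.
  have nF := nbm p a am.
  exists (fun q => Omega R q /\ a < m q).
    rewrite /nbhs /= -nbhs_subspace_in//; apply: filterS nF => q /= ? Oq; by [].
  move=> q [Oq aq]; rewrite lte_fin; apply: lt_le_trans aq _.
  by rewrite /glue; case: ifPn => // _; exact: mu.
rewrite glue_out// => au; have [V nV HV] := lu p a au.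
exists (fun q => [/\ Omega R q, V q & ~ D q]).
  move: nV; rewrite /nbhs /= -!nbhs_subspace_in// => nV.
  have nV' : nbhs (p : R * R) (fun q => Omega R q -> V q) by exact: nV.
  have nD := oD p Op nDp.
  exact: (comb p V nV' nD).
by move=> q [Oq Vq nDq]; rewrite glue_out//; exact: HV.
Qed.

Fixpoint envelope (f : R -> R * R -> R) (a : R) (ns : seq R) (p : R * R) : R :=
  if ns is c :: ns' then Num.max (f a p) (envelope f c ns' p) else f a p.

Lemma envelope_ge f a ns t p : t \in a :: ns -> f t p <= envelope f a ns p.
Proof.
elim: ns a => [|c ns IH] a /=; first by rewrite inE => /eqP ->.
rewrite inE => /orP[/eqP ->|/IH tc]; first by rewrite le_max lexx.
by rewrite le_max tc orbT.
Qed.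

Lemma envelope_attained f a ns p : exists2 t, t \in a :: ns & envelope f a ns p = f t p.
Proof.
elim: ns a => [|c ns IH] a /=; first by exists a => //; rewrite inE.
have [t tc tE] := IH c.
case: (leP (f a p) (envelope f c ns p)) => _.
  by exists t => //; rewrite inE tc orbT.
by exists a => //; rewrite mem_head.
Qed.

Lemma envelope_continuous f a ns :
  (forall t p, {for p, continuous (f t)}) -> forall p, {for p, continuous (envelope f a ns)}.
Proof.
move=> cf p; elim: ns a => [|c ns IH] a /=; first exact: cf.
exact: (continuous_max (cf a p) (IH c)).
Qed.

Lemma envelope_convex f a ns p q (l : R) :
  (forall t, f t (seg p q l) = (1 - l) * f t p + l * f t q) -> 0 <= l <= 1 ->
  envelope f a ns (seg p q l) <= (1 - l) * envelope f a ns p + l * envelope f a ns q.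
Proof.
move=> fE /andP[l0 l1]; have [t tN ->] := envelope_attained f a ns (seg p q l).
by rewrite fE; apply: lerD; apply: ler_wpM2l; rewrite ?subr_ge0// envelope_ge.
Qed.

End glue.

(** * The competitor and its admissibility *)

Section competitor.
Context (R : realType).
Implicit Types (u : R * R -> R) (x y z t a b c d r m e s : R) (p q : R * R).

(** The horizontal position of the vertex, moved by the fraction s towards the meeting
    point [(cos m, sin m) / cos e] of the tangents at the ends of the arc. *)
Definition lowered_x x m e s : R := (1 - s) * x + s * (cos m / cos e).
Definition lowered_y y m e s : R := (1 - s) * y + s * (sin m / cos e).

Definition closed_fan x y a b : set (R * R) :=
  [set p | [/\ Omega R p, 0 <= side x y a p & side x y b p <= 0]].

Definition lowered_plane x y z m e s t : R * R -> R :=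
  plane (lowered_x x m e s) (lowered_y y m e s) ((1 - s) * z) t.

Definition competitor u x y z m e s ns : R * R -> R :=
  glue (closed_fan x y (m - e) (m + e)) (envelope (lowered_plane x y z m e s) (m - e) ns) u.

Lemma chain_mem (P : R -> R -> Prop) a ns t : chain P a ns -> t \in a :: ns ->
  a <= t <= last a ns.
Proof.
elim: ns a => [|c ns IH] a /=; first by rewrite inE => _ /eqP ->; rewrite lexx.
move=> [ac Pac cn]; rewrite inE => /orP[/eqP ->|tc].
  by rewrite lexx (le_trans (ltW ac))// (chain_last_ge cn).
by have /andP[ct ->] := IH c cn tc; rewrite (le_trans (ltW ac)).
Qed.

Lemma continuous_affine2 (a b c : R) p :
  {for p, continuous (fun q : R * R => a * q.1 + b * q.2 + c)}.
Proof.
apply: cvgD; last exact: cvg_cst.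
by apply: cvgD; apply: cvgM; [exact: cvg_cst|exact: cvg_fst|exact: cvg_cst|exact: cvg_snd].
Qed.

Lemma plane_affine x y z t p : plane x y z t p =
  cos t / inv_slope x y z t * p.1 + sin t / inv_slope x y z t * p.2 + - (inv_slope x y z t)^-1.
Proof. by rewrite /plane; ring. Qed.

Lemma continuous_plane x y z t p : {for p, continuous (plane x y z t)}.
Proof.
have -> : plane x y z t = (fun q : R * R =>
  cos t / inv_slope x y z t * q.1 + sin t / inv_slope x y z t * q.2 + - (inv_slope x y z t)^-1).
  by apply/funext => q; exact: plane_affine.
exact: continuous_affine2.
Qed.

Lemma side_affine x y t p : side x y t p =
  - (sin t - y) * p.1 + (cos t - x) * p.2 + ((sin t - y) * x - (cos t - x) * y).
Proof. by rewrite /side; ring. Qed.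

Lemma continuous_side x y t p : {for p, continuous (side x y t)}.
Proof.
have -> : side x y t = (fun q : R * R =>
   - (sin t - y) * q.1 + (cos t - x) * q.2 + ((sin t - y) * x - (cos t - x) * y)).
  by apply/funext => q; exact: side_affine.
exact: continuous_affine2.
Qed.

Lemma Omega_circle p t : Omega R p -> p.1 * cos t + p.2 * sin t <= 1.
Proof. by move=> pO; apply: cos_sin_le => //; rewrite expr1n. Qed.

(** Parametrize the segment affinely: of the two constraints, take the first one that
    breaks. *)
Lemma closed_fan_exit x y a b p q : closed_fan x y a b p -> Omega R q ->
  ~ closed_fan x y a b q -> exists s, [/\ 0 <= s <= 1,
    forall t, 0 <= t <= s -> closed_fan x y a b (seg p q t) &
    side x y a (seg p q s) = 0 \/ side x y b (seg p q s) = 0].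
Proof.
move=> [pO Ap Bp] qO nq.
pose A0 := side x y a p; pose A1 := side x y a q.
pose B0 := - side x y b p; pose B1 := - side x y b q.
have A00 : 0 <= A0 by []. have B00 : 0 <= B0 by rewrite oppr_ge0.
have AB : A1 < 0 \/ B1 < 0.
  have [?|h1] := ltP A1 0; first by left.
  have [?|h2] := ltP B1 0; first by right.
  by case: nq; split => //; rewrite -oppr_ge0.
(* parameter at which an affine function with values X0 >= 0 at p and X1 at q
   vanishes, when it does *)
have param (X0 X1 : R) : 0 <= X0 -> exists s, [/\ 0 <= s <= 1,
    forall t, 0 <= t <= s -> 0 <= (1 - t) * X0 + t * X1,
    X1 < 0 -> (1 - s) * X0 + s * X1 = 0 & 0 <= X1 -> s = 1].
  move=> X00; have [X10|X10] := ltP X1 0; last first.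
    exists 1; split; rewrite ?lexx ?ler01//.
    by move=> t /andP[t0 t1]; rewrite addr_ge0 ?mulr_ge0 ?subr_ge0.
  have D0 : 0 < X0 - X1 by lra.
  have Dn := lt0r_neq0 D0.
  exists (X0 / (X0 - X1)); split.
  - apply/andP; split; first by apply: divr_ge0 => //; exact: ltW.
    by rewrite ler_pdivrMr// mul1r; lra.
  - move=> t /andP[t0]; rewrite ler_pdivlMr// => h; lra.
  - by move=> _; field.
  - by [].
have [sA [/andP[sA0 sA1] HA EA EA1]] := param A0 A1 A00.
have [sB [/andP[sB0 sB1] HB EB EB1]] := param B0 B1 B00.
have inD s t : s <= sA -> s <= sB -> 0 <= t <= s -> closed_fan x y a b (seg p q t).
  move=> sa sb /andP[t0 ts]; split.
  - apply: Omega_seg => //; rewrite t0 /=; lra.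
  - by rewrite side_seg; apply: HA; rewrite t0 (le_trans ts).
  - rewrite side_seg -oppr_ge0 opprD -!mulrN; apply: HB; rewrite t0 (le_trans ts)//.
have [sAB|sBA] := leP sA sB.
  exists sA; split; first by rewrite sA0.
    by move=> t; apply: inD.
  have [A10|A10] := ltP A1 0; first by left; rewrite side_seg; exact: EA.
  right; apply/eqP; rewrite -oppr_eq0 side_seg opprD -!mulrN; apply/eqP.
  have B10 : B1 < 0 by case: AB => // h; move: A10; rewrite leNgt h.
  have -> : sA = sB; last exact: EB.
  by apply/eqP; rewrite eq_le sAB (EA1 A10) sB1.
exists sB; split; first by rewrite sB0.
  by move=> t; apply: inD => //; exact: ltW.
have [B10|B10] := ltP B1 0.
  by right; apply/eqP; rewrite -oppr_eq0 side_seg opprD -!mulrN; apply/eqP; exact: EB.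
by move: sBA; rewrite (EB1 B10) ltNge sA1.
Qed.

End competitor.

Section competitor_admissible.
Context (R : realType).
Implicit Types (u : R * R -> R) (p q : R * R).
Variables (u : R * R -> R) (x y z alpha beta d r m e s : R) (K : R -> R) (ns : seq R).
Hypothesis C : cone_in_graph u x y z alpha beta.
Hypothesis F : fan x y z d r m e s K ns.
Hypothesis am : alpha < m - e.
Hypothesis mb : m + e < beta.

Let env := envelope (lowered_plane x y z m e s) (m - e) ns.
Let v := competitor u x y z m e s ns.

Lemma fan_zn0 : z != 0. Proof. exact/lt0r_neq0/(cone_z C). Qed.

Lemma fan_cos_gt0 : 0 < cos e.
Proof.
have /andP[r0 _] := fan_r F; have /andP[e0 _] := fan_e F.
by apply: le_lt_trans r0 _; apply: (fan_cos F); rewrite gtr0_norm//; lra.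
Qed.

Lemma fan_thin : thin_arc x y (m - e) (m + e).
Proof.
have /andP[r0 _] := fan_r F; have /andP[e0 e1] := fan_e F.
move=> t t' h1 h2 h3; apply: (chord_det_gt0 r0 (fan_xy F)) => //; first by lra.
by apply: (fan_cos F); rewrite ger0_norm; lra.
Qed.

Lemma fan_lt : m - e < m + e.
Proof. by have /andP[e0 _] := fan_e F; lra. Qed.

Lemma fan_node t : t \in m - e :: ns -> `|t - m| <= e.
Proof.
move=> tN; have := chain_mem (fan_chain F) tN; rewrite (fan_last F) => /andP[t1 t2].
by rewrite ler_norml; apply/andP; split; lra.
Qed.

Lemma fan_s_neq1 : 1 - s != 0.
Proof. by have /andP[s0 s1] := fan_s F; apply: lt0r_neq0; lra. Qed.

Lemma lowered_inv_slopeE t : inv_slope (lowered_x x m e s) (lowered_y y m e s) ((1 - s) * z) t =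
  inv_slope x y z t - s / ((1 - s) * z) * lowering m e t.
Proof.
apply: inv_slope_lower_vertex; [exact: fan_zn0|exact: fan_s_neq1|exact/lt0r_neq0/fan_cos_gt0].
Qed.

Lemma lowered_inv_slope_gt0 t : `|t - m| <= e ->
  0 < inv_slope (lowered_x x m e s) (lowered_y y m e s) ((1 - s) * z) t.
Proof. by move=> tm; rewrite lowered_inv_slopeE; exact: (fan_inv_slope F). Qed.

Lemma lowered_inv_slope_le t : `|t - m| <= e ->
  inv_slope (lowered_x x m e s) (lowered_y y m e s) ((1 - s) * z) t <= inv_slope x y z t.
Proof.
move=> tm; rewrite lowered_inv_slopeE gerBl mulr_ge0//.
  have /andP[s0 s1] := fan_s F; have z0 := cone_z C.
  by rewrite divr_ge0 ?mulr_ge0 ?ltW//; lra.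
exact: lowering_ge0 (fan_e F) fan_cos_gt0 tm.
Qed.

(** Planes of smaller reciprocal slope are steeper, and all of them vanish on the same
    tangent line of the circle. *)
Lemma lowered_plane_le t p : Omega R p -> `|t - m| <= e ->
  lowered_plane x y z m e s t p <= plane x y z t p.
Proof.
move=> pO tm; have w1 := lowered_inv_slope_gt0 tm; have w0 := lt_le_trans w1
    (lowered_inv_slope_le tm).
rewrite /lowered_plane /plane; apply: ler_wnM2l.
  by rewrite subr_le0; exact: Omega_circle.
by rewrite lef_pV2 ?posrE//; exact: lowered_inv_slope_le.
Qed.

(** The lowering vanishes at the ends of the arc. *)
Lemma lowered_plane_ends p :
  lowered_plane x y z m e s (m - e) p = plane x y z (m - e) p /\
  lowered_plane x y z m e s (m + e) p = plane x y z (m + e) p.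
Proof.
have [q1 q2] := @lowering_end R m e (lt0r_neq0 fan_cos_gt0).
by rewrite /lowered_plane /plane !lowered_inv_slopeE q1 q2 !mulr0 !subr0.
Qed.

Lemma envelope_le_graph p : Omega R p -> env p <= u p.
Proof.
move=> pO; rewrite /env; have [t tN ->] := envelope_attained (lowered_plane x y z m e s) (m
    - e) ns p.
have tm := fan_node tN.
apply: le_trans (lowered_plane_le pO tm) _.
apply: (cone_subgradient C) => //.
have [am' mb'] := (am, mb).
by move: tm; rewrite ler_norml => /andP[t1 t2]; apply/andP; split; lra.
Qed.

Lemma envelope_ge_end t p : t = m - e \/ t = m + e -> plane x y z t p <= env p.
Proof.
have [e1 e2] := lowered_plane_ends p.
move=> [->|->]; rewrite -?e1 -?e2; apply: envelope_ge; first exact: mem_head.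
by rewrite -(fan_last F) mem_last.
Qed.

Lemma side_eq0_ruling t p : t = m - e \/ t = m + e ->
  closed_fan x y (m - e) (m + e) p -> side x y t p = 0 ->
  exists2 l, 0 <= l <= 1 & p = ruling x y t l.
Proof.
move=> tE [pO pa pb] p0.
have [t' [l [/andP[t1 t2] l01 pE]]] := fan_ruling (cone_xy C) fan_lt fan_thin pO pa pb.
have : l * chord_det x y t t' = 0 by rewrite -side_ruling -pE.
move/eqP; rewrite mulf_eq0 => /orP[/eqP l0|D0].
  by exists 0; rewrite ?lexx ?ler01// pE l0 /ruling; congr pair; ring.
exists l => //; rewrite pE; congr (ruling x y _ l).
apply/eqP; apply: contraTT D0 => tt.
case: tE => tE.
  apply: lt0r_neq0; rewrite tE; apply: fan_thin => //.
  by rewrite lt_neqAle eq_sym -tE tt /= tE.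
rewrite chord_detC oppr_eq0; apply: lt0r_neq0; rewrite tE; apply: fan_thin => //.
by rewrite lt_neqAle -tE tt /= tE.
Qed.

(** The condition under which [glue_convex] lets a segment leave the fan. *)
Lemma graph_on_end_rulings t p : t = m - e \/ t = m + e ->
  closed_fan x y (m - e) (m + e) p -> side x y t p = 0 -> u p <= env p.
Proof.
move=> tE pD p0; apply: le_trans (envelope_ge_end p tE).
have [l l01 ->] := side_eq0_ruling tE pD p0.
have [lt am' mb'] := And3 fan_lt am mb; have tab : alpha <= t <= beta.
  by case: tE => ->; apply/andP; split; lra.
rewrite (cone_ruling C)// plane_own_ruling//; last exact: fan_zn0.
exact: inv_slope_gt0 (cone_z C) (cone_xy C).
Qed.

Lemma closed_fan_seg p q (t : R) : closed_fan x y (m - e) (m + e) p ->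
  closed_fan x y (m - e) (m + e) q -> 0 <= t <= 1 ->
  closed_fan x y (m - e) (m + e) (seg p q t).
Proof.
move=> [pO pa pb] [qO qa qb] t01; have /andP[t0 t1] := t01.
split; first exact: Omega_seg.
  by rewrite side_seg addr_ge0// mulr_ge0// subr_ge0.
rewrite side_seg -oppr_ge0 opprD -!mulrN.
by rewrite addr_ge0// mulr_ge0// ?subr_ge0// oppr_ge0.
Qed.

Lemma continuous_envelope_planes p : {for p, continuous env}.
Proof. by apply: envelope_continuous => t q; exact: continuous_plane. Qed.

Lemma closed_fan_compl p : Omega R p -> ~ closed_fan x y (m - e) (m + e) p ->
  \forall q \near p, ~ closed_fan x y (m - e) (m + e) q.
Proof.
move=> pO np.
have [h|h] := ltP (side x y (m - e) p) 0.
  have nF : \forall q \near p, side x y (m - e) q < 0.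
    exact: (cvgr_lt _ (@continuous_side R x y (m - e) p) _ h).
  by apply: filterS nF => q qs [_ + _]; rewrite leNgt qs.
have [h'|h'] := ltP 0 (side x y (m + e) p).
  have nF : \forall q \near p, 0 < side x y (m + e) q.
    exact: (cvgr_gt _ (@continuous_side R x y (m + e) p) _ h').
  by apply: filterS nF => q qs [_ _]; rewrite leNgt qs.
by case: np; split.
Qed.

(** Inside the fan the end plane at m - e is already above the level of the vertex;
    this uses that the arc is short compared with the distance from the vertex to
    the circle. It gives the lower bound -1 for the competitor. *)
Lemma envelope_ge_vertex p : closed_fan x y (m - e) (m + e) p -> - z <= env p.
Proof.
move=> [pO pa pb].
have [t [l [/andP[t1 t2] /andP[l0 l1] ->]]] := fan_ruling (cone_xy C) fan_lt fan_thin pO pa pb.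
apply: le_trans (envelope_ge_end _ (or_introl erefl)).
have w0 := inv_slope_gt0 (m - e) (cone_z C) (cone_xy C).
rewrite plane_ruling//; last exact: fan_zn0.
have /andP[r0 r1] := fan_r F.
have h : l * (1 - cos (t - (m - e))) / inv_slope x y z (m - e) <= l * z.
  rewrite -mulrA; apply: ler_wpM2l => //; rewrite ler_pdivrMr//.
  have -> : z * inv_slope x y z (m - e) = 1 - (x * cos (m - e) + y * sin (m - e)).
    by rewrite /inv_slope; field; exact: fan_zn0.
  have := cos_sin_le (m - e) r0 (fan_xy F).
  have := fan_cos F (t := t - (m - e)).
  rewrite ger0_norm; last lra.
  have ht : t - (m - e) <= 2 * e by lra.
  move=> /(_ ht); lra.
lra.
Qed.

Lemma competitor_Chat : Chat R v.
Proof.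
have [bu cu lu] := cone_chat C.
have cu' := (convex_functionP _ _).1 cu.
split.
- move=> p pO; have [pD|pD] := pselect (closed_fan x y (m - e) (m + e) p).
    rewrite /v /competitor glue_in//; apply/andP; split.
      apply: le_trans (envelope_ge_vertex pD).
      have O0 : Omega R (ruling x y (m - e) 0).
        by apply: ruling_Omega; rewrite ?lexx ?ler01// ltW// (cone_xy C).
      have := bu _ O0; rewrite (cone_ruling C) ?lexx ?ler01//.
        by rewrite subr0 mul1r => /andP[].
      by have [lt am' mb'] := And3 fan_lt am mb; apply/andP; split; lra.
    by apply: le_trans (envelope_le_graph pO) _; case/andP: (bu p pO).
  by rewrite /v /competitor glue_out//; exact: bu.
- apply/convex_functionP; apply: glue_convex => //.
  + move=> p q t t01; apply: envelope_convex => // t'; exact: plane_seg.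
  + exact: envelope_le_graph.
  + exact: closed_fan_seg.
  + move=> p q pD qO nq; have [k [k01 kD k0]] := closed_fan_exit pD qO nq.
    exists k; split => //; have /andP[k00 _] := k01.
    have kk : closed_fan x y (m - e) (m + e) (seg p q k) by apply: kD; rewrite k00 lexx.
    by case: k0 => k0; [apply: (graph_on_end_rulings (or_introl erefl))|
      apply: (graph_on_end_rulings (or_intror erefl))].
  + by move=> p [].
- apply: glue_lsc => //.
  + exact: continuous_envelope_planes.
  + exact: envelope_le_graph.
  + exact: closed_fan_compl.
Qed.

End competitor_admissible.

(** * Areas of wedges *)

Section wedge_areas.
Context (R : realType).
Implicit Types (x y z t a b c d r m e s k sg : R) (p q : R * R).
Local Notation mu2 := (@lebesgue_measure R \x @lebesgue_measure R)%E.

(** For p in the disc, its distance to the tangent line of the unit circle at angle t. *)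
Definition depth t p : R := 1 - p.1 * cos t - p.2 * sin t.

(** For s = 1, the triangle between the ruling of angle t from (x, y), the tangent line
    at angle t, and the line from (x, y) to a point of that tangent line. For s < 1, the
    part of it between the ruling and the segment from the same point of the circle to
    the vertex moved by the fraction s towards that point of the tangent line. The sign
    sg selects the side of the ruling. *)
Definition wedge x y t k s sg : set (R * R) :=
  [set p | [/\ 0 <= sg * side x y t p,
     sg * side x y t p <= k * (depth t (x, y) - depth t p) &
     (1 - s) * (sg * side x y t p) <= s * k * depth t p]].

Lemma side_frame x y t p : side x y t p =
  depth t (x, y) * (p.2 * cos t - p.1 * sin t) -
  (y * cos t - x * sin t) * depth t p.
Proof.
apply/eqP; rewrite -subr_eq0; apply/eqP.
rewrite (_ : _ - _ = (1 - (cos t ^+ 2 + sin t ^+ 2)) * (p.1 * y - x * p.2)).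
  by rewrite cos2Dsin2 subrr mul0r.
by rewrite /side /depth /=; ring.
Qed.

(** [side] and [depth] are affine coordinates, in which the three inequalities cut out
    a triangle. *)
Lemma wedge_area x y t k s sg : 0 < k -> 0 < s -> sg ^+ 2 = 1 ->
  0 < depth t (x, y) -> measurable (wedge x y t k s sg) /\
  mu2 (wedge x y t k s sg) = (k * s * depth t (x, y) / 2)%:E.
Proof.
move=> k0 s0 sg2 A00; set A0 := depth t (x, y).
have [kn sn An] := And3 (lt0r_neq0 k0) (lt0r_neq0 s0) (lt0r_neq0 A00).
have cs := cos2Dsin2 t.
(* coordinates in which the wedge is the standard triangle *)
pose X1 := - sg * (sin t - y) / (k * s * A0); pose X2 := sg * (cos t - x) / (k * s * A0).
pose X3 := sg * ((sin t - y) * x - (cos t - x) * y) / (k * s * A0).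
pose Y1 := (cos t + sg * (sin t - y) / k) / A0.
pose Y2 := (sin t - sg * (cos t - x) / k) / A0.
pose Y3 := (A0 - 1 - sg * ((sin t - y) * x - (cos t - x) * y) / k) / A0.
have XE p : X1 * p.1 + X2 * p.2 + X3 = sg * side x y t p / (k * s * A0).
  by rewrite /X1 /X2 /X3 /side; field; rewrite kn sn An.
have YE p : Y1 * p.1 + Y2 * p.2 + Y3 = (A0 - depth t p - sg * side x y t p / k) / A0.
  by rewrite /Y1 /Y2 /Y3 /side /depth; field; rewrite kn An.
have det : X1 * Y2 - X2 * Y1 = - (sg / (k * s * A0)).
  have -> : X1 * Y2 - X2 * Y1 = - (sg * ((cos t ^+ 2 + sin t ^+ 2) - x * cos t - y * sin t)
     / (k * s * A0 ^+ 2)).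
    by rewrite /X1 /X2 /Y1 /Y2; field; rewrite kn sn An.
  rewrite cs.
  have -> : 1 - x * cos t - y * sin t = A0 by rewrite /A0 /depth.
  by field; rewrite kn sn An.
have absg : `|sg| = 1.
  by apply/eqP; rewrite -(@eqrXn2 _ 2)// real_normK ?num_real// sg2 expr1n.
have sgn : sg != 0 by apply: contra_eq_neq sg2 => ->; rewrite expr0n /= eq_sym oner_eq0.
have D0 : 0 < k * s * A0 by rewrite !mulr_gt0.
have det0 : X1 * Y2 - X2 * Y1 != 0.
  by rewrite det oppr_eq0 mulf_neq0// invr_eq0 lt0r_neq0.
have E : wedge x y t k s sg = [set p : R * R | [/\ 0 <= X1 * p.1 + X2 * p.2 + X3,
   0 <= Y1 * p.1 + Y2 * p.2 + Y3 &
   X1 * p.1 + X2 * p.2 + X3 + (Y1 * p.1 + Y2 * p.2 + Y3) <= 1]].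
  apply/seteqP; split => p; rewrite /wedge /mkset XE YE -/A0; set S := sg * _.
    move=> [S0 h1 h2]; split.
    + by apply: divr_ge0 => //; exact: ltW.
    + by apply: divr_ge0; [rewrite subr_ge0 ler_pdivrMr// mulrC|exact: ltW].
    + rewrite -subr_ge0 (_ : _ - _ = (s * k * depth t p - (1 - s) * S) / (k * s * A0)).
        by apply: divr_ge0; [rewrite subr_ge0|exact: ltW].
      by field; rewrite kn sn An.
  move=> [h0 h1 h2]; have h0' := h0; have h1' := h1.
  rewrite pmulr_lge0 ?invr_gt0// in h0'.
  rewrite pmulr_lge0 ?invr_gt0// subr_ge0 ler_pdivrMr// mulrC in h1'.
  split => //; move: h2; rewrite -subr_ge0.
  rewrite (_ : _ - _ = (s * k * depth t p - (1 - s) * S) / (k * s * A0)).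
    by rewrite pmulr_lge0 ?invr_gt0// subr_ge0.
  by field; rewrite kn sn An.
rewrite E; split; last first.
  rewrite mu2_triangle// det normrN normrM absg mul1r normfV gtr0_norm//.
  by congr EFin; field; rewrite kn sn An.
have -> : [set p : R * R | [/\ 0 <= X1 * p.1 + X2 * p.2 + X3,
   0 <= Y1 * p.1 + Y2 * p.2 + Y3 &
   X1 * p.1 + X2 * p.2 + X3 + (Y1 * p.1 + Y2 * p.2 + Y3) <= 1]] =
  [set p : R * R | 0 <= X1 * p.1 + X2 * p.2 + X3] `&`
  ([set p : R * R | 0 <= Y1 * p.1 + Y2 * p.2 + Y3] `&`
   [set p : R * R | 0 <= - (X1 + Y1) * p.1 + - (X2 + Y2) * p.2 + (1 - X3 - Y3)]).
  apply/seteqP; split => p /=.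
    move=> [? ? h]; split => //; split => //; move: h; rewrite -subr_ge0.
    by congr (0 <= _); ring.
  move=> [? [? h]]; split => //; rewrite -subr_ge0; move: h.
  by congr (0 <= _); ring.
by do 2 (apply: measurableI; first exact: measurable_affine_ge0);
  exact: measurable_affine_ge0.
Qed.

Lemma inv_slope_depth x y z t : z != 0 -> depth t (x, y) = z * inv_slope x y z t.
Proof. by move=> z0; rewrite /depth /inv_slope /=; field. Qed.

Lemma tan_half_sin (h : R) : 0 < cos (h / 2) -> tan_half h * sin h = 1 - cos h.
Proof.
move=> c0; have cn := lt0r_neq0 c0.
have hE : h = h / 2 + h / 2 by field.
have cs := cos2Dsin2 (h / 2).
have s2 : sin h = 2 * sin (h / 2) * cos (h / 2) by rewrite {1}hE sinD; ring.
have c2 : cos h = cos (h / 2) ^+ 2 - sin (h / 2) ^+ 2 by rewrite {1}hE cosD; ring.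
by rewrite s2 c2 -[X in X - _]cs /tan_half; field.
Qed.

(** Both planes pass through (x, y, -z), so the difference depends only on the
    displacement of p from (x, y). *)
Lemma plane_compare x y z a c p : z != 0 ->
  (p.1 * cos a + p.2 * sin a - 1) * (z * inv_slope x y z c) -
  (p.1 * cos c + p.2 * sin c - 1) * (z * inv_slope x y z a) =
  (1 - cos (c - a)) * (depth a (x, y) - depth a p) - sin (c - a) * side x y a p.
Proof.
move=> z0; rewrite -!(inv_slope_depth _ _ _ z0) side_frame.
have cE : c = a + (c - a) by ring.
set h := c - a in cE *; rewrite {1 2 3}cE /depth /= cosD sinD; ring.
Qed.

(** The line where the planes of angles a and c agree meets the tangent line at angle
    a at the tangent-length tan ((c - a) / 2) from the point of contact. *)
Lemma plane_le_wedge x y z a c p : 0 < z -> 0 < inv_slope x y z a -> 0 < inv_slope x y z c ->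
  0 < cos ((c - a) / 2) -> plane x y z c p <= plane x y z a p ->
  sin (c - a) * side x y a p <= sin (c - a) * (tan_half (c - a) * (depth a (x, y) - depth a p)).
Proof.
move=> z0 wa wc ch; rewrite /plane ler_pdivrMr// mulrAC ler_pdivlMr// => H.
have e := @plane_compare x y z a c p (lt0r_neq0 z0).
have -> : sin (c - a) * (tan_half (c - a) * (depth a (x, y) - depth a p)) =
  (1 - cos (c - a)) * (depth a (x, y) - depth a p) by rewrite -tan_half_sin//; ring.
rewrite -subr_ge0 -e subr_ge0.
have := ler_wpM2l (ltW z0) H; lra.
Qed.

(** Affine interpolation between the vertex and the meeting point of the two
    tangents, for which the ruling at an end of the arc is the tangent itself. *)
Lemma lowered_side x y m e s p : cos e != 0 ->
  side (lowered_x x m e s) (lowered_y y m e s) (m - e) p =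
    (1 - s) * side x y (m - e) p - s * (sin e / cos e) * depth (m - e) p /\
  side (lowered_x x m e s) (lowered_y y m e s) (m + e) p =
    (1 - s) * side x y (m + e) p + s * (sin e / cos e) * depth (m + e) p.
Proof.
move=> c0.
have aff t : side (lowered_x x m e s) (lowered_y y m e s) t p =
    (1 - s) * side x y t p + s * side (cos m / cos e) (sin m / cos e) t p.
  by rewrite /side /lowered_x /lowered_y; ring.
rewrite !aff; split.
  suff -> : side (cos m / cos e) (sin m / cos e) (m - e) p =
    - (sin e / cos e) * depth (m - e) p by ring.
  have mE : m = (m - e) + e by ring.
  set t := m - e in mE *; have cs := cos2Dsin2 t.
  rewrite mE cosD sinD.
  rewrite (_ : side _ _ _ _ = (sin e / cos e) *
     (p.1 * cos t + p.2 * sin t - (cos t ^+ 2 + sin t ^+ 2))).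
    by rewrite cs /depth; ring.
  by rewrite /side; field.
suff -> : side (cos m / cos e) (sin m / cos e) (m + e) p =
    (sin e / cos e) * depth (m + e) p by ring.
have mE : m = (m + e) - e by ring.
set t := m + e in mE *; have cs := cos2Dsin2 t.
rewrite mE cosB sinB.
rewrite (_ : side _ _ _ _ = (sin e / cos e) *
    (- (p.1 * cos t + p.2 * sin t) + (cos t ^+ 2 + sin t ^+ 2))).
  by rewrite cs /depth; ring.
by rewrite /side; field.
Qed.

End wedge_areas.

(** * The gradient of the competitor *)

Section gradient_of_planes.
Context (R : realType).
Implicit Types (u : R * R -> R) (x y z t a b c d r m e s : R) (p q v : R * R).
Local Notation mu2 := (@lebesgue_measure R \x @lebesgue_measure R)%E.

Lemma derive_affine2 (a b c : R) p v :
  'D_v (fun q : R * R => a * q.1 + b * q.2 + c) p = a * v.1 + b * v.2.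
Proof.
rewrite /derive; apply: cvg_lim => //.
have nE : {near (0 : R)^', (fun=> a * v.1 + b * v.2) =1 (fun h => h^-1 *:
    (((fun q : R * R => a * q.1 + b * q.2 + c) \o shift p) (h *: v) -
    (a * p.1 + b * p.2 + c)))}.
  by apply: filterS (nbhs_dnbhs_neq (0 : R)) => h hn; rewrite /= /GRing.scale /=; field.
exact: cvg_trans (near_eq_cvg nE) (cvg_cst _).
Qed.

Lemma grad_norm2_plane x y z t p : 0 < inv_slope x y z t ->
  grad_norm2 (plane x y z t) p = (inv_slope x y z t) ^- 2.
Proof.
move=> w0; have wn := lt0r_neq0 w0.
have -> : plane x y z t = (fun q : R * R =>
  cos t / inv_slope x y z t * q.1 + sin t / inv_slope x y z t * q.2 + - (inv_slope x y z t)^-1).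
  by apply/funext => q; exact: plane_affine.
rewrite /grad_norm2 !derive_affine2 /=.
transitivity ((cos t ^+ 2 + sin t ^+ 2) / inv_slope x y z t ^+ 2); first by field.
by rewrite cos2Dsin2 div1r.
Qed.

Lemma near_eq_grad_norm2 u u' p : (\near p, u p = u' p) ->
  grad_norm2 u p = grad_norm2 u' p.
Proof. by move=> H; rewrite /grad_norm2 !(near_eq_derive _ H). Qed.

Lemma near_all (p : R * R) (l : seq R) (P : R -> R * R -> Prop) :
  (forall t, t \in l -> \forall q \near p, P t q) ->
  \forall q \near p, forall t, t \in l -> P t q.
Proof.
have FF : Filter (nbhs p) by exact: nbhs_filter.
elim: l => [|c l IH] H; first exact: filterE.
have h1 := H c (mem_head _ _).
have h2 : \forall q \near p, forall t, t \in l -> P t q.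
  by apply: IH => t tl; apply: H; rewrite inE tl orbT.
near=> q => t; rewrite inE => /orP[/eqP ->|tl].
  by near: q.
by have : forall t, t \in l -> P t q by [near: q]; apply.
Unshelve. all: by end_near. Qed.

Lemma continuous_norm2 p : {for p, continuous (fun q : R * R => q.1 ^+ 2 + q.2 ^+ 2)}.
Proof.
have c1 : q.1 @[q --> p] --> p.1 by exact: cvg_fst.
have c2 : q.2 @[q --> p] --> p.2 by exact: cvg_snd.
by apply: cvgD; [exact: (cvgM c1 c1)|exact: (cvgM c2 c2)].
Qed.

Lemma closed_fan_near x y a b p : p.1 ^+ 2 + p.2 ^+ 2 < 1 -> 0 < side x y a p ->
  side x y b p < 0 -> \forall q \near p, closed_fan x y a b q.
Proof.
move=> p1 pa pb.
have n1 : \forall q \near p, (q : R * R).1 ^+ 2 + q.2 ^+ 2 < 1.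
  exact: (cvgr_lt _ (@continuous_norm2 p) _ p1).
have n2 : \forall q \near p, 0 < side x y a q.
  exact: (cvgr_gt _ (@continuous_side R x y a p) _ pa).
have n3 : \forall q \near p, side x y b q < 0.
  exact: (cvgr_lt _ (@continuous_side R x y b p) _ pb).
near=> q; split.
- by apply: ltW; near: q.
- by apply: ltW; near: q.
- by apply: ltW; near: q.
Unshelve. all: by end_near. Qed.

(** Near a point where the maximum of the planes is attained only once, the competitor
    is that plane. *)
Lemma competitor_grad u x y z m e s ns p t :
  p.1 ^+ 2 + p.2 ^+ 2 < 1 -> 0 < side x y (m - e) p -> side x y (m + e) p < 0 ->
  t \in m - e :: ns ->
  0 < inv_slope (lowered_x x m e s) (lowered_y y m e s) ((1 - s) * z) t ->
  (forall t', t' \in m - e :: ns -> t' != t ->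
     lowered_plane x y z m e s t' p < lowered_plane x y z m e s t p) ->
  grad_norm2 (competitor u x y z m e s ns) p =
    (inv_slope (lowered_x x m e s) (lowered_y y m e s) ((1 - s) * z) t) ^- 2.
Proof.
move=> p1 pa pb tN w0 H.
rewrite -(grad_norm2_plane p w0); apply: near_eq_grad_norm2.
have nD := closed_fan_near p1 pa pb.
have nM : \forall q \near p, forall t', t' \in m - e :: ns -> t' != t ->
     lowered_plane x y z m e s t' q < lowered_plane x y z m e s t q.
  have FF : Filter (nbhs p) by exact: nbhs_filter.
  apply: near_all => t' t'n.
  have [->|t't] := eqVneq t' t; first by apply: filterE.
  have cc : {for p, continuous (fun q => lowered_plane x y z m e s t q -
      lowered_plane x y z m e s t' q)}.
    by apply: cvgB; exact: continuous_plane.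
  have pos : 0 < lowered_plane x y z m e s t p - lowered_plane x y z m e s t' p.
    by rewrite subr_gt0; exact: H.
  have nF : \forall q \near p, 0 < lowered_plane x y z m e s t q -
      lowered_plane x y z m e s t' q by exact: (cvgr_gt _ cc _ pos).
  by apply: filterS nF => q; rewrite subr_gt0.
near=> q.
have qD : closed_fan x y (m - e) (m + e) q by near: q.
have qM : forall t', t' \in m - e :: ns -> t' != t ->
     lowered_plane x y z m e s t' q < lowered_plane x y z m e s t q by near: q.
rewrite /competitor glue_in//.
have [t' t'n E] := envelope_attained (lowered_plane x y z m e s) (m - e) ns q.
rewrite E.
have [-> //|t't] := eqVneq t' t.
have := envelope_ge (lowered_plane x y z m e s) q tN.
by rewrite E leNgt (qM _ t'n t't).
Unshelve. all: by end_near. Qed.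

End gradient_of_planes.

Section null_sets.
Context (R : realType).
Local Notation mu2 := (@lebesgue_measure R \x @lebesgue_measure R)%E.

Definition null_set (A : set (R * R)) : Prop := measurable A /\ mu2 A = 0%E.

Lemma null_setU A B : null_set A -> null_set B -> null_set (A `|` B).
Proof.
move=> [mA A0] [mB B0]; split; first exact: measurableU.
by rewrite mu2_U0.
Qed.

Lemma null_set_seq (T : eqType) (l : seq T) (P : T -> set (R * R)) :
  (forall t, t \in l -> null_set (P t)) ->
  null_set [set p | exists2 t, t \in l & P t p].
Proof.
elim: l => [|c l IH] H.
  have -> : [set p | exists2 t, t \in [::] & P t p] = set0.
    by apply/seteqP; split => p // -[].
  split; first exact: measurable0.
  exact: (@measure0 _ (measurableTypeR R * measurableTypeR R)%type R mu2).
have -> : [set p | exists2 t, t \in c :: l & P t p] =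
    P c `|` [set p | exists2 t, t \in l & P t p].
  apply/seteqP; split => p /=.
    by move=> [t]; rewrite inE => /orP[/eqP -> ?|tl Pt]; [left|right; exists t].
  by move=> [?|[t tl Pt]]; [exists c => //; exact: mem_head|exists t => //; rewrite inE tl
      orbT].
apply: null_setU; first by apply: H; exact: mem_head.
by apply: IH => t tl; apply: H; rewrite inE tl orbT.
Qed.

Lemma null_set_line (a b c : R) : (a != 0) || (b != 0) ->
  null_set [set p : R * R | a * p.1 + b * p.2 = c].
Proof. by move=> ab; split; [exact: measurable_affine_eq|exact: null_line]. Qed.

Lemma null_set_circle : null_set [set p : R * R | p.1 ^+ 2 + p.2 ^+ 2 = 1].
Proof. exact: measurable_null_circle. Qed.

End null_sets.

(** * Upper bound for the energy of the competitor *)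

Section wedge_cover.
Context (R : realType).
Implicit Types (x y z t a b c d r m e s h k : R) (p q : R * R).
Local Notation mu2 := (@lebesgue_measure R \x @lebesgue_measure R)%E.

Lemma half_turn_gt0 h : 0 < h <= 1 -> [/\ 0 < sin h, 0 < cos (h / 2) & 0 < tan_half h].
Proof.
move=> /andP[h0 h1]; have p2 := @pi_ge2 R.
have s0 : 0 < sin h by apply: sin2_gt0; apply/andP; split; lra.
have c0 : 0 < cos (h / 2) by apply: cos_gt0_pihalf; apply/andP; split; lra.
split=> //; apply: divr_gt0 => //; apply: sin2_gt0; apply/andP; split; lra.
Qed.

Lemma tan_halfN h : tan_half (- h) = - tan_half h.
Proof. by rewrite /tan_half mulNr sinN cosN mulNr. Qed.

(** Between two consecutive nodes a and c, the tangent plane at a dominates that at c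
    in a wedge along the ruling of angle a, and conversely. [A t] restricts to the
    points where the plane of angle t is the maximal one. *)
Fixpoint wedges x y z d (A : R -> set (R * R)) a (ns : seq R) : seq (set (R * R) * R) :=
  if ns is c :: ns' then
    (wedge x y a (tan_half (c - a)) 1 1 `&` A a, slope_density d (inv_slope x y z a)) ::
    (wedge x y c (tan_half (c - a)) 1 (-1) `&` A c, slope_density d (inv_slope x y z c)) ::
    wedges x y z d A c ns'
  else [::].

Section nodes.
Variables (x y z d : R) (A : R -> set (R * R)) (P : R -> R -> Prop) (m e : R).
Hypothesis z0 : 0 < z.
Hypothesis e1 : e <= 1 / 2.
Hypothesis d0 : 0 <= d.
Hypothesis mA : forall t, measurable (A t).
Hypothesis w0 : forall t, `|t - m| <= e -> 0 < inv_slope x y z t.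

Lemma node_gap a c : `|a - m| <= e -> `|c - m| <= e -> a < c -> 0 < c - a <= 1.
Proof.
have e1' := e1; rewrite !ler_norml => /andP[? ?] /andP[? ?] ac.
by apply/andP; split; lra.
Qed.

Lemma node_wedge t k s sg : `|t - m| <= e -> 0 < k -> 0 < s -> sg ^+ 2 = 1 ->
  measurable (wedge x y t k s sg) /\
  mu2 (wedge x y t k s sg) = (k * s * (z * inv_slope x y z t) / 2)%:E.
Proof.
move=> tm k0 s0 sg1; rewrite -(inv_slope_depth _ _ _ (lt0r_neq0 z0)).
by apply: wedge_area => //; rewrite (inv_slope_depth _ _ _ (lt0r_neq0 z0)) mulr_gt0// w0.
Qed.

Lemma wedges_mem a ns (c : set (R * R) * R) : chain P a ns -> (forall t, t \in a :: ns ->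
    `|t - m| <= e) ->
  c \in wedges x y z d A a ns ->
  exists2 t, t \in a :: ns & [/\ measurable c.1, c.1 `<=` A t & c.2 = slope_density d
      (inv_slope x y z t)].
Proof.
elim: ns a => [//|b ns IH] a /= [ab _ cn] H.
have am := H _ (mem_head _ _).
have bm : `|b - m| <= e by apply: H; rewrite !inE eqxx orbT.
have [s1 c1 t1] := half_turn_gt0 (node_gap am bm ab).
have sq1 : (1 : R) ^+ 2 = 1 by rewrite expr1n.
have sqN1 : (-1 : R) ^+ 2 = 1 by rewrite sqrrN expr1n.
rewrite !inE => /or3P[/eqP ->|/eqP ->|cw].
- exists a; first exact: mem_head.
  split => //=; first by apply: measurableI => //; exact: (node_wedge am t1 ltr01 sq1).1.
- exists b; first by rewrite !inE eqxx orbT.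
  split => //=; first by apply: measurableI => //; exact: (node_wedge bm t1 ltr01 sqN1).1.
have [|t tN ht] := IH b cn _ cw; first by move=> t tb; apply: H; rewrite inE tb orbT.
by exists t => //; rewrite inE tN orbT.
Qed.

Lemma wedges_sum a ns : chain P a ns -> (forall t, t \in a :: ns -> `|t - m| <= e) ->
  (\sum_(c <- wedges x y z d A a ns) c.2%:E * mu2 c.1 <=
   (chain_sum (fun a b => z * tan_half (b - a) * (sector_energy d (inv_slope x y z a) +
       sector_energy d (inv_slope x y z b))) a ns / 2)%:E)%E.
Proof.
elim: ns a => [|b ns IH] a /=; first by rewrite big_nil mul0r.
move=> [ab _ cn] H.
have am := H _ (mem_head _ _).
have bm : `|b - m| <= e by apply: H; rewrite !inE eqxx orbT.
have [s1 c1 t1] := half_turn_gt0 (node_gap am bm ab).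
have sq1 : (1 : R) ^+ 2 = 1 by rewrite expr1n.
have sqN1 : (-1 : R) ^+ 2 = 1 by rewrite sqrrN expr1n.
rewrite !big_cons /= mulrDl EFinD addeA; apply: leeD; last first.
  by apply: IH => // t tb; apply: H; rewrite inE tb orbT.
have one t sg : `|t - m| <= e -> sg ^+ 2 = 1 ->
  ((slope_density d (inv_slope x y z t))%:E * mu2 (wedge x y t (tan_half (b - a)) 1 sg `&`
      A t) <=
   (z * tan_half (b - a) * sector_energy d (inv_slope x y z t) / 2)%:E)%E.
  move=> tm sg1; have [mw ew] := node_wedge tm t1 ltr01 sg1.
  rewrite -slope_density_mul (_ : _ / 2 = slope_density d (inv_slope x y z t) * (tan_half
      (b - a) * 1 * (z * inv_slope x y z t) / 2)); last by ring.
  rewrite [X in (_ <= X)%E]EFinM -ew; apply: lee_wpmul2l.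
    by rewrite lee_fin divr_ge0 ?sqr_ge0// ltW// den_gt0.
  by apply: mu2_le => //; exact: measurableI.
by rewrite mulrDr mulrDl EFinD; apply: leeD; exact: one.
Qed.

(** If the plane of angle t is the largest, it dominates in particular the plane of the
    next node, which confines p to the wedge on that side of its ruling. *)
Lemma wedges_right a ns t p : chain P a ns -> (forall t, t \in a :: ns -> `|t - m| <= e) ->
  Omega R p -> t \in a :: ns -> 0 <= side x y t p -> A t p ->
  (forall t', t' \in a :: ns -> plane x y z t' p <= plane x y z t p) ->
  t = last a ns \/ exists2 c, c \in wedges x y z d A a ns & c.1 p.
Proof.
move=> + + pO; elim: ns a => [|b ns IH] a /=.
  by rewrite inE => _ _ /eqP ->; left.
move=> [ab _ cn] H tN st At Hmax.
have am := H _ (mem_head _ _).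
have bm : `|b - m| <= e by apply: H; rewrite !inE eqxx orbT.
have [s1 c1 t1] := half_turn_gt0 (node_gap am bm ab).
move: (tN); rewrite inE => /orP[/eqP ta|tb]; last first.
  have Hb t' : t' \in b :: ns -> `|t' - m| <= e by move=> t'b; apply: H; rewrite inE t'b orbT.
  have [||[c cw cp]] := IH b cn Hb tb st At.
  - by move=> t' t'b; apply: Hmax; rewrite inE t'b orbT.
  - by left.
  by right; exists c => //; rewrite !inE cw !orbT.
right; exists (wedge x y a (tan_half (b - a)) 1 1 `&` A a, slope_density d (inv_slope x y z
    a)); first exact: mem_head.
subst t; split => //=; split; rewrite ?mul1r//.
- rewrite -(ler_pM2l s1); apply: (plane_le_wedge z0 (w0 am) (w0 bm) c1).
  by apply: Hmax; rewrite !inE eqxx orbT.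
- by rewrite subrr mul0r mulr_ge0 ?(ltW t1)// /depth; have := Omega_circle a pO; lra.
Qed.

Lemma wedges_left a ns t p : chain P a ns -> (forall t, t \in a :: ns -> `|t - m| <= e) ->
  Omega R p -> t \in a :: ns -> side x y t p <= 0 -> A t p ->
  (forall t', t' \in a :: ns -> plane x y z t' p <= plane x y z t p) ->
  t = a \/ exists2 c, c \in wedges x y z d A a ns & c.1 p.
Proof.
move=> + + pO; elim: ns a => [|b ns IH] a /=.
  by rewrite inE => _ _ /eqP ->; left.
move=> [ab _ cn] H tN st At Hmax.
have am := H _ (mem_head _ _).
have bm : `|b - m| <= e by apply: H; rewrite !inE eqxx orbT.
have [s1 c1 t1] := half_turn_gt0 (node_gap am bm ab).
move: (tN); rewrite inE => /orP[/eqP ta|tb]; first by left.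
have Hb t' : t' \in b :: ns -> `|t' - m| <= e by move=> t'b; apply: H; rewrite inE t'b orbT.
right; have [||[c cw cp]] := IH b cn Hb tb st At.
- by move=> t' t'b; apply: Hmax; rewrite inE t'b orbT.
- move=> tb'; subst t.
  exists (wedge x y b (tan_half (b - a)) 1 (-1) `&` A b, slope_density d (inv_slope x y z
      b)); first by rewrite !inE eqxx orbT.
  split => //=; split; rewrite ?mulN1r ?oppr_ge0//.
  + rewrite -(ler_pM2l s1).
    have := @plane_le_wedge R x y z b a p z0 (w0 bm) (w0 am).
    rewrite -(opprB b a) mulNr cosN sinN tan_halfN => /(_ c1 (Hmax a (mem_head _ _))).
    by rewrite !mulNr !mulrN opprK.
  + by rewrite subrr mul0r mulr_ge0 ?mul1r ?(ltW t1)// /depth; have := Omega_circle b pO; lra.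
by exists c => //; rewrite !inE cw !orbT.
Qed.

End nodes.
End wedge_cover.

Section competitor_cost.
Context (R : realType).
Implicit Types (t a b : R) (p q : R * R).
Local Notation mu2 := (@lebesgue_measure R \x @lebesgue_measure R)%E.
Variables (u : R * R -> R) (x y z alpha beta d r m e s : R) (K : R -> R) (ns : seq R).
Hypothesis C : cone_in_graph u x y z alpha beta.
Hypothesis F : fan x y z d r m e s K ns.
Hypothesis d0 : 0 <= d.

Let v := competitor u x y z m e s ns.
Let x1 := lowered_x x m e s.
Let y1 := lowered_y y m e s.
Let z1 := (1 - s) * z.

Definition maximal_on (t : R) : set (R * R) :=
  [set p | envelope (lowered_plane x y z m e s) (m - e) ns p <= lowered_plane x y z m e s t p].

Lemma measurable_plane x' y' z' t : measurable_fun [set: R * R] (plane x' y' z' t).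
Proof.
have -> : plane x' y' z' t = (fun q : R * R =>
  cos t / inv_slope x' y' z' t * q.1 + sin t / inv_slope x' y' z' t * q.2 + - (inv_slope x'
      y' z' t)^-1).
  by apply/funext => q; exact: plane_affine.
exact: measurable_affine.
Qed.

Lemma measurable_maximal_on t : measurable (maximal_on t).
Proof.
have mE a l : measurable_fun [set: R * R] (envelope (lowered_plane x y z m e s) a l).
  elim: l a => [|c l IH] a /=; first exact: measurable_plane.
  exact: measurable_maxr (measurable_plane _ _ _ _) (IH c).
have -> : maximal_on t = (fun p => lowered_plane x y z m e s t p -
    envelope (lowered_plane x y z m e s) (m - e) ns p) @^-1` `[0, +oo[.
  by apply/seteqP; split => p /=; rewrite in_itv /= andbT subr_ge0.
apply: measurable_preimageT => //; apply: measurable_funB => //.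
exact: measurable_plane.
Qed.

Lemma maximal_on_le t p t' : t \in m - e :: ns -> maximal_on t p ->
  t' \in m - e :: ns -> lowered_plane x y z m e s t' p <= lowered_plane x y z m e s t p.
Proof. by move=> tN tp t'N; apply: le_trans tp; exact: envelope_ge. Qed.

(** Along the diagonal this is empty, so that all pairs of nodes can be treated at once. *)
Definition tie t t' : set (R * R) :=
  [set p | t != t' /\ lowered_plane x y z m e s t p = lowered_plane x y z m e s t' p].

(** Two planes of different angles have different horizontal gradients, so they agree
    along a line only. *)
Lemma null_set_tie t t' : t \in m - e :: ns -> t' \in m - e :: ns -> null_set (tie t t').
Proof.
move=> tN t'N; have [tt|tt] := eqVneq t t'.
  rewrite (_ : tie t t' = set0); last by apply/seteqP; split => p // -[]; rewrite tt eqxx.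
  split; first exact: measurable0.
  exact: (@measure0 _ (measurableTypeR R * measurableTypeR R)%type R mu2).
have [tm t'm] := (fan_node F tN, fan_node F t'N).
have [w0 w0'] := (lt0r_neq0 (lowered_inv_slope_gt0 C F tm), lt0r_neq0
    (lowered_inv_slope_gt0 C F t'm)).
have -> : tie t t' = [set p : R * R |
    (cos t / inv_slope x1 y1 z1 t - cos t' / inv_slope x1 y1 z1 t') * p.1 +
    (sin t / inv_slope x1 y1 z1 t - sin t' / inv_slope x1 y1 z1 t') * p.2 =
    (inv_slope x1 y1 z1 t)^-1 - (inv_slope x1 y1 z1 t')^-1].
  apply/seteqP; split => p /=.
    move=> [_]; rewrite /lowered_plane !plane_affine -/x1 -/y1 -/z1 => E; lra.
  move=> E; split => //; rewrite /lowered_plane !plane_affine -/x1 -/y1 -/z1; lra.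
apply: null_set_line; rewrite -negb_and; apply/negP => /andP[/eqP h1 /eqP h2].
have /andP[e0 e1] := fan_e F.
have : sin (t - t') = 0.
  rewrite sinB; transitivity ((sin t / inv_slope x1 y1 z1 t - sin t' / inv_slope x1 y1 z1
      t') * cos t' * inv_slope x1 y1 z1 t -
    (cos t / inv_slope x1 y1 z1 t - cos t' / inv_slope x1 y1 z1 t') * sin t' * inv_slope x1
        y1 z1 t); first by field; rewrite w0 w0'.
  by rewrite h1 h2 !mul0r subrr.
move: tm t'm tt; rewrite !ler_norml neq_lt => /andP[? ?] /andP[? ?] /orP[tt|tt] /eqP.
  by rewrite -oppr_eq0 -sinN gt_eqF//; apply: sin2_gt0; apply/andP; split; lra.
by rewrite gt_eqF//; apply: sin2_gt0; apply/andP; split; lra.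
Qed.

(** Off this null set the competitor is, locally inside the fan, a single plane. *)
Definition kinks : set (R * R) :=
  [set p | p.1 ^+ 2 + p.2 ^+ 2 = 1] `|`
  [set p | exists2 t, t \in [:: m - e; m + e] & side x y t p = 0] `|`
  [set p | exists2 t, t \in m - e :: ns & exists2 t', t' \in m - e :: ns & tie t t' p].

Lemma null_set_kinks : null_set kinks.
Proof.
have /andP[r0 r1] := fan_r F.
have xy1 : x ^+ 2 + y ^+ 2 < 1.
  by apply: le_lt_trans (fan_xy F) _; rewrite -(expr1n R 2) ltrXn2r// ?nnegrE; lra.
apply: null_setU; first apply: null_setU.
- exact: null_set_circle.
- apply: (@null_set_seq _ _ _ (fun t => [set p | side x y t p = 0])) => t _.
  have -> : [set p | side x y t p = 0] = [set p : R * R | - (sin t - y) * p.1 + (cos t - x)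
      * p.2 =
      - ((sin t - y) * x - (cos t - x) * y)].
    by apply/seteqP; split => p /=; rewrite side_affine => h; lra.
  apply: null_set_line; rewrite oppr_eq0 !subr_eq0 -negb_and; apply/negP => /andP[/eqP h1
      /eqP h2].
  by move: xy1; rewrite -h1 -h2 cos2Dsin2 ltxx.
- apply: (@null_set_seq _ _ _ (fun t => [set p | exists2 t', t' \in m - e :: ns & tie t t'
    p])) => t tN.
  by apply: (@null_set_seq _ _ _ (tie t)) => t' t'N; exact: null_set_tie.
Qed.

Lemma competitor_density p t : closed_fan x y (m - e) (m + e) p -> ~ kinks p ->
  t \in m - e :: ns -> maximal_on t p ->
  density d (grad_norm2 v p) = (slope_density d (inv_slope x1 y1 z1 t))%:E.
Proof.
move=> [pO pa pb] nK tN tp.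
have W := lowered_inv_slope_gt0 C F (fan_node F tN).
have sn t' : t' \in [:: m - e; m + e] -> side x y t' p != 0.
  by move=> h; apply/eqP => h0; apply: nK; left; right; exists t'.
rewrite (@competitor_grad R u x y z m e s ns p t) => //.
- exact: density_slope.
- by rewrite lt_neqAle pO andbT; apply/eqP => h; apply: nK; left; left.
- by rewrite lt_neqAle eq_sym sn ?mem_head.
- by rewrite lt_neqAle sn ?inE ?eqxx ?orbT.
- move=> t' t'N t't; rewrite lt_neqAle maximal_on_le// andbT.
  by apply/eqP => h; apply: nK; right; exists t' => //; exists t.
Qed.

Lemma maximal_on_exists p : exists2 t, t \in m - e :: ns & maximal_on t p.
Proof.
have [t tN E] := envelope_attained (lowered_plane x y z m e s) (m - e) ns p.
by exists t => //; rewrite /maximal_on /mkset E.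
Qed.

(** The thin triangles between the end rulings from the original vertex and those from
    the lowered one. *)
Definition end_wedges : seq (set (R * R) * R) :=
  [:: (wedge x y (m - e) (sin e / cos e) s 1 `&` maximal_on (m - e), slope_density d
      (inv_slope x y z (m - e)));
      (wedge x y (m + e) (sin e / cos e) s (-1) `&` maximal_on (m + e), slope_density d
          (inv_slope x y z (m + e)))].

(** At a point where the plane of angle t is maximal, the side of the ruling of angle t
    from the lowered vertex decides between the next and the previous node. Beyond the
    last or before the first ruling, p is still inside the original fan, hence in an
    end wedge. *)
Lemma end_wedges_cover p : closed_fan x y (m - e) (m + e) p ->
  exists2 c, c \in wedges x1 y1 z1 d maximal_on (m - e) ns ++ end_wedges & c.1 p.
Proof.
move=> [pO pa pb].
have /andP[s0 s1] := fan_s F; have /andP[e0 e1] := fan_e F; have z0 := cone_z C.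
have z10 : 0 < z1 by rewrite mulr_gt0//; lra.
have [t tN tp] := maximal_on_exists p.
have H t' := @fan_node R x y z d r m e s K ns F t'.
have W t' := @lowered_inv_slope_gt0 R u x y z alpha beta d r m e s K ns C F t'.
have Hm t' := @maximal_on_le t p t' tN tp.
have lastN : m + e \in m - e :: ns by rewrite -(fan_last F) mem_last.
have ce0 := fan_cos_gt0 F; have cen := lt0r_neq0 ce0.
have em : `|(m - e) - m| <= e by apply: H; exact: mem_head.
have em' : `|(m + e) - m| <= e by apply: H.
have w0 := lt_le_trans (W _ em) (lowered_inv_slope_le C F em).
have w0' := lt_le_trans (W _ em') (lowered_inv_slope_le C F em').
have gap : m + e - (m - e) = 2 * e by ring.
have hgap : (m + e - (m - e)) / 2 = e by field.
have gap01 : 0 < m + e - (m - e) <= 1 by rewrite gap; apply/andP; split; lra.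
have [sg _ tg] := half_turn_gt0 gap01.
have tnE : tan_half (m + e - (m - e)) = sin e / cos e by rewrite /tan_half hgap.
have [E1 E2] := lowered_plane_ends C F p.
have [S1 S2] := @lowered_side R x y m e s p cen.
have [st|st] := leP 0 (side x1 y1 t p).
  have [tl|[c cw cp]] := @wedges_right R x1 y1 z1 d maximal_on _ m e z10 e1 W
    (m - e) ns t p (fan_chain F) H pO tN st tp Hm; last first.
    by exists c => //; rewrite mem_cat cw.
  rewrite (fan_last F) in tl; subst t.
  exists (wedge x y (m + e) (sin e / cos e) s (-1) `&` maximal_on (m + e), slope_density d
      (inv_slope x y z (m + e))).
    by rewrite mem_cat !inE eqxx !orbT.
  split => //=; split; rewrite ?mulN1r ?oppr_ge0//.
  - rewrite -(ler_pM2l sg).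
    have := @plane_le_wedge R x y z (m + e) (m - e) p z0 w0' w0.
    rewrite -(opprB (m + e)) mulNr cosN sinN tan_halfN hgap tnE => /(_ ce0).
    rewrite -E1 -E2 => /(_ (Hm _ (mem_head _ _))).
    by rewrite !mulNr !mulrN opprK.
  - by move: st; rewrite S2; lra.
have [tl|[c cw cp]] := @wedges_left R x1 y1 z1 d maximal_on _ m e z10 e1 W
    (m - e) ns t p (fan_chain F) H pO tN (ltW st) tp Hm; last first.
  by exists c => //; rewrite mem_cat cw.
subst t.
exists (wedge x y (m - e) (sin e / cos e) s 1 `&` maximal_on (m - e), slope_density d
    (inv_slope x y z (m - e))).
  by rewrite mem_cat !inE eqxx !orbT.
split => //=; split; rewrite ?mul1r//.
- rewrite -(ler_pM2l sg) -tnE; apply: (plane_le_wedge z0 w0 w0'); first by rewrite hgap.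
  by rewrite -E1 -E2; exact: Hm.
- by move: (ltW st); rewrite S1; lra.
Qed.

(** Off [kinks] the integrand is constant on each wedge, so [integral_le_cover] bounds the
    integral by a sum of constants times triangle areas. *)
Lemma competitor_upper_bound :
  (\int[mu2]_(p in closed_fan x y (m - e) (m + e)) density d (grad_norm2 v p) <=
   ((chain_sum (fun a b => z1 * tan_half (b - a) *
       (sector_energy d (inv_slope x1 y1 z1 a) + sector_energy d (inv_slope x1 y1 z1 b)))
           (m - e) ns +
     s * z * (sin e / cos e) * (sector_energy d (inv_slope x y z (m - e)) + sector_energy d
         (inv_slope x y z (m + e)))) / 2)%:E)%E.
Proof.
have /andP[s0 s1] := fan_s F; have /andP[e0 e1] := fan_e F; have z0 := cone_z C.
have z10 : 0 < z1 by rewrite mulr_gt0//; lra.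
have H t' := @fan_node R x y z d r m e s K ns F t'.
have W t' := @lowered_inv_slope_gt0 R u x y z alpha beta d r m e s K ns C F t'.
have lastN : m + e \in m - e :: ns by rewrite -(fan_last F) mem_last.
have em : `|(m - e) - m| <= e by apply: H; exact: mem_head.
have em' : `|(m + e) - m| <= e by apply: H.
have w0 := lt_le_trans (W _ em) (lowered_inv_slope_le C F em).
have w0' := lt_le_trans (W _ em') (lowered_inv_slope_le C F em').
have ce0 := fan_cos_gt0 F.
have T0 : 0 < sin e / cos e by apply: divr_gt0 => //; apply: sin2_gt0; apply/andP; split; lra.
have mA := measurable_maximal_on.
have zn := fan_zn0 C.
have [nm n0] := null_set_kinks.
have Fd0 w : 0 <= slope_density d w by rewrite divr_ge0 ?sqr_ge0// ltW// den_gt0.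
have sq1 : (1 : R) ^+ 2 = 1 by rewrite expr1n.
have sqN1 : (-1 : R) ^+ 2 = 1 by rewrite sqrrN expr1n.
have wE t' : t' = m - e \/ t' = m + e -> inv_slope x1 y1 z1 t' = inv_slope x y z t'.
  have [q1 q2] := @lowering_end R m e (lt0r_neq0 ce0).
  by move=> [] ->; rewrite /x1 /y1 /z1 (lowered_inv_slopeE C F) ?q1 ?q2 mulr0 subr0.
have EW t' sg : t' = m - e \/ t' = m + e -> sg ^+ 2 = 1 ->
    measurable (wedge x y t' (sin e / cos e) s sg) /\
    mu2 (wedge x y t' (sin e / cos e) s sg) = (sin e / cos e * s * (z * inv_slope x y z t')
        / 2)%:E.
  move=> t'E sg1; rewrite -(inv_slope_depth _ _ _ zn); apply: wedge_area => //.
  by rewrite (inv_slope_depth _ _ _ zn) mulr_gt0//; case: t'E => ->.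
have [mw1 ew1] := EW (m - e) 1 (or_introl erefl) sq1.
have [mw2 ew2] := EW (m + e) (-1) (or_intror erefl) sqN1.
apply: (@le_trans _ _ (\sum_(c <- wedges x1 y1 z1 d maximal_on (m - e) ns ++ end_wedges)
    c.2%:E * mu2 c.1)%E).
  apply: (@integral_le_cover _ (measurableTypeR R * measurableTypeR R)%type R mu2 _ kinks).
  - exact: nm.
  - exact: n0.
  - by move=> p _; apply: density_ge0 => //; exact: grad_norm2_ge0.
  - move=> c; rewrite mem_cat => /orP[cw|].
      have [t tN [mc ct c2]] := wedges_mem z10 e1 mA W (fan_chain F) H cw.
      split => //; first by rewrite c2.
      by move=> p pD cp nK; rewrite c2 (@competitor_density p t)//; exact: ct.
    have [mI1 mI2] := (measurableI _ _ mw1 (mA (m - e)), measurableI _ _ mw2 (mA (m + e))).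
    rewrite !inE => /orP[] /eqP -> /=; split => //.
    + move=> p pD [_ cp] nK; rewrite (competitor_density pD nK _ cp) ?mem_head//.
      by rewrite wE//; left.
    + move=> p pD [_ cp] nK; rewrite (competitor_density pD nK _ cp)//.
      by rewrite wE//; right.
  - by move=> p /end_wedges_cover; right.
rewrite big_cat /= mulrDl EFinD; apply: leeD.
  exact: wedges_sum z10 e1 d0 mA W _ _ (fan_chain F) H.
have one t' sg : measurable (wedge x y t' (sin e / cos e) s sg) ->
  mu2 (wedge x y t' (sin e / cos e) s sg) = (sin e / cos e * s * (z * inv_slope x y z t') /
      2)%:E ->
  ((slope_density d (inv_slope x y z t'))%:E * mu2 (wedge x y t' (sin e / cos e) s sg `&`
      maximal_on t') <=
   (s * z * (sin e / cos e) * sector_energy d (inv_slope x y z t') / 2)%:E)%E.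
  move=> mw ew.
  rewrite -slope_density_mul (_ : _ / 2 = slope_density d (inv_slope x y z t') * (sin e /
      cos e * s * (z * inv_slope x y z t') / 2)); last by ring.
  rewrite [X in (_ <= X)%E]EFinM -ew; apply: lee_wpmul2l; first by rewrite lee_fin.
  by apply: mu2_le => //; exact: measurableI.
rewrite !big_cons big_nil adde0 /= mulrDr mulrDl EFinD.
by apply: leeD; exact: one.
Qed.

End competitor_cost.

(** * Comparison of the two energies *)

Section optimality.
Context (R : realType).
Implicit Types (u v : R * R -> R) (x y z d : R) (p q : R * R).
Local Notation mu2 := (@lebesgue_measure R \x @lebesgue_measure R)%E.

Definition cost d u : \bar R := (\int[mu2]_(p in Omega R) density d (grad_norm2 u p))%E.

(** M^-2 = delta. *)
Lemma J_cost (M : \bar R) d u : 0 <= d ->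
  M = (if d == 0 then +oo%E else (d `^ (- (1 / 2)))%:E) -> J M u = cost d u.
Proof.
move=> d0 ->; apply: eq_integral => p _; rewrite /density; congr ((_ + _)^-1)%E.
have [->|dn] := eqVneq d 0; first by rewrite invey expeS mul0e.
have dp : 0 < d by rewrite lt_neqAle eq_sym dn.
rewrite inver gt_eqF ?powR_gt0// -EFin_expe; congr EFin.
rewrite powRN invrK -powR_mulrn ?powR_ge0// -powRrM.
by rewrite (_ : _ * _ = 1) ?powRr1//; field.
Qed.

Lemma chain_sum_telescope (L : R -> R -> R) (K : R -> R) a ns :
  chain_sum (fun a b => L a b + (K b - K a)) a ns =
  chain_sum L a ns + (K (last a ns) - K a).
Proof. by elim: ns a => [|c ns IH] a /=; [rewrite subrr addr0|rewrite IH; ring]. Qed.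

Lemma measurable_Omega : measurable (Omega R).
Proof.
have -> : Omega R = (fun p : R * R => p.1 ^+ 2 + p.2 ^+ 2) @^-1` `]-oo, 1].
  by apply/seteqP; split => p; rewrite /Omega /= in_itv.
apply: measurable_preimageT => //.
by apply: measurable_funD; apply: measurable_funX;
  [exact: measurable_fst|exact: measurable_snd].
Qed.

Lemma measurable_closed_fan x y a b : measurable (closed_fan x y a b).
Proof.
have -> : closed_fan x y a b = Omega R `&`
  ([set p : R * R | 0 <= - (sin a - y) * p.1 + (cos a - x) * p.2 + ((sin a - y) * x - (cos
      a - x) * y)] `&`
   [set p : R * R | 0 <= (sin b - y) * p.1 + - (cos b - x) * p.2 + - ((sin b - y) * x -
       (cos b - x) * y)]).
  apply/seteqP; split => p; rewrite /closed_fan /mkset /=.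
    move=> [pO]; rewrite !side_affine => pa pb; split => //; split; lra.
  by move=> [pO [pa pb]]; split => //; rewrite !side_affine; lra.
apply: measurableI; first exact: measurable_Omega.
by apply: measurableI; exact: measurable_affine_ge0.
Qed.

Lemma ltD_of_parts (I0 I1 I2 : \bar R) (c a b : R) : (I1 + I2 < +oo)%E ->
  (I0 <= ((c + a) / 2)%:E)%E -> a < b -> (((c + b) / 2)%:E <= I1)%E -> (0 <= I1)%E -> (0 <=
      I2)%E ->
  (I0 + I2 < I1 + I2)%E.
Proof.
move=> fin I0a ab bI1 I10 I20.
have I2fin : I2 \is a fin_num.
  by rewrite ge0_fin_numE//; apply: le_lt_trans fin; exact: leeDr.
rewrite lteD2rE//; apply: le_lt_trans I0a _; apply: lt_le_trans bI1; rewrite lte_fin; lra.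
Qed.

(** The two integrands agree outside the fan, because the competitor equals u near each
    point of the complement; inside it the two bounds are separated by [fan_gain]. *)
Lemma competitor_lt x y z u alpha beta d r m e s (K : R -> R) ns :
  cone_in_graph u x y z alpha beta -> fan x y z d r m e s K ns ->
  alpha < m - e -> m + e < beta -> 0 <= d -> (cost d u < +oo)%E ->
  (cost d (competitor u x y z m e s ns) < cost d u)%E.
Proof.
move=> C F am mb d0 fin; set v := competitor _ _ _ _ _ _ _ _.
have nn w (A : set (R * R)) p : A p -> (0 <= density d (grad_norm2 w p))%E.
  by move=> _; apply: density_ge0 => //; exact: grad_norm2_ge0.
have split w : cost d w =
  (\int[mu2]_(p in closed_fan x y (m - e) (m + e)) density d (grad_norm2 w p) +
   \int[mu2]_(p in Omega R `\` closed_fan x y (m - e) (m + e)) density d (grad_norm2 w p))%E.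
  rewrite /cost (@ge0_integral_split _ (measurableTypeR R * measurableTypeR R)%type R mu2 _
    (closed_fan x y (m - e) (m + e))) //; last by move=> p; exact: nn.
    by congr (integral _ _ _ + _)%E; apply/setIidPr => p [].
  exact: measurable_closed_fan.
have outside : (\int[mu2]_(p in Omega R `\` closed_fan x y (m - e) (m + e)) density d
    (grad_norm2 v p) =
  \int[mu2]_(p in Omega R `\` closed_fan x y (m - e) (m + e)) density d (grad_norm2 u p))%E.
  apply: eq_integral => p /set_mem [pO pD]; congr density; apply: near_eq_grad_norm2.
  have FF : Filter (nbhs p) by exact: nbhs_filter.
  by apply: filterS (closed_fan_compl pO pD) => q qD; rewrite /v /competitor glue_out.
have up := competitor_upper_bound C F d0.
have lo : (((chain_sum (fun a b => (1 - s) * z * tan_half (b - a) *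
     (sector_energy d (inv_slope (lowered_x x m e s) (lowered_y y m e s) ((1 - s) * z) a) +
      sector_energy d (inv_slope (lowered_x x m e s) (lowered_y y m e s) ((1 - s) * z) b)))
          (m - e) ns +
     (K (m + e) - K (m - e))) / 2)%:E <=
   \int[mu2]_(p in closed_fan x y (m - e) (m + e)) density d (grad_norm2 u p))%E.
  have lb : last (m - e) ns < beta by rewrite (fan_last F).
  have th : thin_arc x y (m - e) (last (m - e) ns) by rewrite (fan_last F); exact: fan_thin F.
  have := cone_lower_bound C d0 am lb th (fan_chain F).
  rewrite chain_sum_telescope (fan_last F) => H; apply: le_trans H _.
  apply: (@ge0_integral_subset _ (measurableTypeR R * measurableTypeR R)%type R mu2).
    by move=> p [p1 pa pb]; split; exact: ltW.
  by move=> p; exact: nn.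
move: fin; rewrite !split outside => fin.
apply: (ltD_of_parts fin up _ lo); [|by apply: integral_ge0 => p; exact: nn..].
by rewrite ltrBrDl; exact: fan_gain F.
Qed.

(** An affine function with nonzero gradient: its value is finite for every delta. *)
Definition tilt p : R := 1 / 2 * p.1 + 0 * p.2 + - (1 / 2).

Lemma tilt_Chat : Chat R tilt.
Proof.
split.
- move=> [a b]; rewrite /Omega /tilt /= => h.
  have h1 : a ^+ 2 <= 1 by apply: le_trans h; rewrite lerDl sqr_ge0.
  have : `|a| <= 1 by rewrite -(@ler_pXn2r _ 2)// ?nnegrE// real_normK ?num_real// expr1n.
  by rewrite ler_norml => /andP[? ?]; apply/andP; split; lra.
- apply/convex_functionP => p q l _ _ _; rewrite /seg /tilt /=; lra.
- move=> p a; have [Op|nOp] := pselect (Omega R p); last first.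
    move=> av; exists [set p] => [|q ->//].
    by rewrite /nbhs /= -nbhs_subspace_out.
  rewrite lte_fin => ap.
  have FF : Filter (nbhs (p : R * R)) by exact: nbhs_filter.
  have nF : \forall q \near (p : R * R), a < tilt q.
    by exact: (cvgr_gt _ (@continuous_affine2 R _ _ _ (p : R * R)) _ ap).
  exists (fun q : R * R => a < tilt q) => [|q]; last by rewrite lte_fin.
  by rewrite /nbhs /= -nbhs_subspace_in//; apply: filterS nF.
Qed.

Lemma tilt_cost d : 0 <= d -> (cost d tilt < +oo)%E.
Proof.
move=> d0.
have E p : density d (grad_norm2 tilt p) = (slope_density d 2)%:E.
  rewrite /grad_norm2 /tilt !derive_affine2 -(density_slope d0 (ltr0n R 2)); congr density.
  by rewrite /=; field.
rewrite /cost (eq_integral (cst (slope_density d 2)%:E)); last by move=> p _; exact: E.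
rewrite integral_cst; last exact: measurable_Omega.
apply: lte_mul_pinfty => //.
  by rewrite lee_fin divr_ge0 ?sqr_ge0// ltW// den_gt0.
(* the disc lies in a triangle of finite area *)
have D : (8^-1 : R) * 8^-1 - 0 * 0 != 0 by rewrite mul0r subr0 mulf_neq0// invr_neq0.
have [mT eT] := mu2_open_triangle (1 / 4) (1 / 4) D.
apply: (@le_lt_trans _ _ (mu2 [set p : R * R | [/\ 0 < 8^-1 * p.1 + 0 * p.2 + 1 / 4,
    0 < 0 * p.1 + 8^-1 * p.2 + 1 / 4 &
    8^-1 * p.1 + 0 * p.2 + 1 / 4 + (0 * p.1 + 8^-1 * p.2 + 1 / 4) < 1]])); last first.
  by rewrite eT ltry.
apply: mu2_le => //; first exact: measurable_Omega.
move=> [a b]; rewrite /Omega /= => h.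
have bd (c : R) : c ^+ 2 <= 1 -> - 1 <= c <= 1.
  by move=> c1; rewrite -ler_norml -(@ler_pXn2r _ 2)// ?nnegrE// real_normK ?num_real// expr1n.
have /bd /andP[? ?] : a ^+ 2 <= 1 by apply: le_trans h; rewrite lerDl sqr_ge0.
have /bd /andP[? ?] : b ^+ 2 <= 1 by apply: le_trans h; rewrite lerDr sqr_ge0.
by split; lra.
Qed.

End optimality.

Theorem theorem6 (R : realType) (u : R * R -> R) (delta : R) (M : \bar R)
  (x0 y0 z0 r0 phi0 alpha beta : R)
  (hu : Chat R u)
  (hdelta : 0 <= delta)
  (hM : M = if delta == 0 then +oo%E else (delta `^ (- (1 / 2)))%:E)
  (hcone : conical_part u x0 y0 z0 alpha beta)
  (hz0 : 0 < z0)
  (hvertex : (x0, y0) = (r0 * cos phi0, r0 * sin phi0))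
  (hr0 : 0 <= r0 < 1)
  (hab : alpha < beta)
  (hphi : exists2 phi : R, alpha <= phi <= beta &
    (3 * r0 ^+ 2 * sin (phi - phi0) ^+ 2 - (1 - r0 * cos (phi - phi0)) ^+ 2) /
      ((1 - r0 * cos (phi - phi0)) ^+ 2 *
       (1 + r0 ^+ 2 - 2 * r0 * cos (phi - phi0)))
    < delta * z0 ^- 2) :
  ~ optimal M u.
Proof.
move=> [_ opt]; move: hvertex => [x0E y0E].
have {}opt v : Chat R v -> (cost delta u <= cost delta v)%E.
  by move=> vC; rewrite -!(J_cost _ hdelta hM); exact: opt.
have zn := lt0r_neq0 hz0; have /andP[r00 r01] := hr0.
have xyE : x0 ^+ 2 + y0 ^+ 2 = r0 ^+ 2.
  by rewrite x0E y0E !exprMn -mulrDr cos2Dsin2 mulr1.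
have xy1 : x0 ^+ 2 + y0 ^+ 2 < 1 by rewrite xyE -(expr1n R 2) ltrXn2r// nnegrE.
have [phi phi_ab hphi'] := hphi.
have wE : inv_slope x0 y0 z0 phi = (1 - r0 * cos (phi - phi0)) / z0.
  by rewrite /inv_slope x0E y0E cosB; congr (_ / _); ring.
have w'E : inv_slope' x0 y0 z0 phi = r0 * sin (phi - phi0) / z0.
  by rewrite /inv_slope' x0E y0E sinB; congr (_ / _); ring.
have w0 := inv_slope_gt0 phi hz0 xy1.
have A0 : 0 < 1 - r0 * cos (phi - phi0) by move: w0; rewrite wE pmulr_lgt0 ?invr_gt0.
have BE : 1 + r0 ^+ 2 - 2 * r0 * cos (phi - phi0) =
    (1 - r0 * cos (phi - phi0)) ^+ 2 + (r0 * sin (phi - phi0)) ^+ 2.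
  have cs := cos2Dsin2 (phi - phi0).
  transitivity (1 + r0 ^+ 2 * (cos (phi - phi0) ^+ 2 + sin (phi - phi0) ^+ 2) - 2 * r0 *
      cos (phi - phi0)).
    by rewrite cs mulr1.
  by ring.
have B0 : 0 < 1 + r0 ^+ 2 - 2 * r0 * cos (phi - phi0).
  by rewrite BE ltr_pwDl ?sqr_ge0// exprn_gt0.
have key : 3 * inv_slope' x0 y0 z0 phi ^+ 2 - inv_slope x0 y0 z0 phi ^+ 2 <
    delta * inv_slope x0 y0 z0 phi ^+ 2 * (inv_slope x0 y0 z0 phi ^+ 2 + inv_slope' x0 y0
        z0 phi ^+ 2).
  move: hphi'; rewrite ltr_pdivrMr ?mulr_gt0 ?exprn_gt0// BE wE w'E => H.
  have z2 : 0 < z0 ^- 2 by rewrite invr_gt0 exprn_gt0.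
  move: H; rewrite -(ltr_pM2l z2); congr (_ < _); field; exact: zn.
have C : cone_in_graph u x0 y0 z0 alpha beta by split.
have [r [m [e [s [K [ns [am mb F]]]]]]] := fan_exists hz0 hdelta xy1 hab phi_ab key.
have fin : (cost delta u < +oo)%E := le_lt_trans (opt _ (tilt_Chat R)) (tilt_cost hdelta).
have := competitor_lt C F am mb hdelta fin.
by rewrite ltNge (opt _ (competitor_Chat C F am mb)).
Qed.
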